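(* Let $Y\in\Omega_n^r$ be a random simplicial complex with respect to $\mathbb{P}_{r,\mathfrak p}$, where $\mathfrak p=(p_0,p_1,\dots,p_r)$, $p_i=n^{-\alpha_i}$, and $\alpha=\alpha(n)=(\alpha_0,\dots,\alpha_r)\in\mathbb{R}_+^{r+1}$ is a sequence of vectors converging to a vector $\alpha_\ast\in\mathfrak{D}_k$ with $k\ge2$. Then the fundamental group $\pi_1(Y)$ has property (T), a.a.s.
   Context: Model. Fix an integer $r$. Let $\Delta_n$ be the simplex with vertex set $\{1,\dots,n\}$, viewed as an abstract simplicial complex. For a subcomplex $Y\subset\Delta_n$, $f_i(Y)$ is the number of $i$-dimensional simplexes of $Y$, and $e_i(Y)$ is the number of $i$-dimensional external faces of $Y$, i.e. $i$-simplexes $\sigma\subset\Delta_n$ with $\sigma\not\subset Y$ but $\partial\sigma\subset Y$ (for $i=0$: vertices not in $Y$). $\Omega_n^r$ is the set of all subcomplexes $Y\subset\Delta_n$ with $\dim Y\le r$ (including the empty one). For $\mathfrak p=(p_0,\dots,p_r)$ with $0\le p_i\le 1$ the probability measure on $\Omega_n^r$ is $$\mathbb{P}_{r,\mathfrak p}(Y)=\prod_{i=0}^r p_i^{f_i(Y)}\cdot\prod_{i=0}^r(1-p_i)^{e_i(Y)},\qquad 0^0=1.$$ Notation. $\mathbb{R}_+=[0,\infty)$. For $\alpha=(\alpha_0,\dots,\alpha_r)$ and $k=0,\dots,r$ put $\psi_k(\alpha)=\sum_{i=0}^r\binom{k}{i}\alpha_i$, with $\binom{k}{i}=0$ for $i>k$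 and $\binom00=1$. Domains: $\mathfrak{D}_k=\{\alpha\in\mathbb{R}^{r+1}_+:\psi_k(\alpha)<1<\psi_{k+1}(\alpha)\}$ for $0\le k\le r-1$, and $\mathfrak{D}_r=\{\alpha\in\mathbb{R}^{r+1}_+:\psi_r(\alpha)<1\}$ (so $k\le r$). Property (T) is Kazhdan's property (T) for discrete groups. ''A.a.s.'' means with probability tending to $1$ as $n\to\infty$. *)

(* Defs.v *)
From HB Require Import structures.
From mathcomp Require Import all_boot all_order all_algebra.
From mathcomp Require Import generic_quotient sesquilinear.
From mathcomp Require Import complex.
From mathcomp Require Import all_classical all_reals all_analysis.
From mathcomp Require Import ring lra.

Set Implicit Arguments.
Unset Strict Implicit.
Unset Printing Implicit Defensive.

Import Order.TTheory GRing.Theory Num.Theory.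
Import numFieldNormedType.Exports.

Local Open Scope classical_set_scope.
Local Open Scope ring_scope.

Section Within.
Context {R : realType}.

Lemma within_comp (U V W : topologicalType) (A : set U) (B : set V)
    (f : U -> V) (g : V -> W) :
  {within A, continuous f} -> {within B, continuous g} ->
  (forall x, A x -> B (f x)) -> {within A, continuous (fun x => g (f x))}.
Proof.
move=> /subspace_continuousP cf /subspace_continuousP cg fAB.
apply/subspace_continuousP => x Ax P /(cg _ (fAB _ Ax)) /(cf _ Ax).
by rewrite /nbhs/= /within/=; apply: filterS => y BPy Ay; exact: BPy (fAB _ Ay).
Qed.

Lemma within_paste (U X : topologicalType) (A : set U) (u : U -> R) (c : R)
    (F G : U -> X) :
  closed A -> continuous u ->
  {within A `&` [set x | u x <= c], continuous F} ->
  {within A `&` [set x | c <= u x], continuous G} ->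
  (forall x, A x -> u x = c -> F x = G x) ->
  {within A, continuous (fun x => if u x <= c then F x else G x)}.
Proof.
move=> cA cu cF cG FG.
have -> : A = (A `&` [set x | u x <= c]) `|` (A `&` [set x | c <= u x]).
  apply/seteqP; split=> x /=; last by case=> -[].
  by move=> Ax; case: (leP (u x) c) => [|/ltW]; [left|right].
have cl1 : closed [set x | u x <= c].
  by apply: (@closed_comp _ _ u [set y | y <= c]) => // ; exact: closed_le.
have cl2 : closed [set x | c <= u x].
  by apply: (@closed_comp _ _ u [set y | c <= y]) => // ; exact: closed_ge.
apply: withinU_continuous; [exact: closedI|exact: closedI| |].
- apply: (@subspace_eq_continuous _ _ _ F) => // x.
  by rewrite inE /from_subspace/= => -[_ /= ->].
- apply: (@subspace_eq_continuous _ _ _ G) => // x.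
  rewrite inE /from_subspace/= => -[Ax /= cx].
  by case: leP => // xc; rewrite FG //; apply/le_anti/andP.
Qed.

End Within.

Notation unit_itv R := (`[0%R : R, 1%R]%classic).

Section FundamentalGroup.
Context {R : realType} {X : topologicalType} (x0 : X).
Local Notation I := (unit_itv R).

(* A loop is a total function on [R], of which only the restriction to the unit
   interval matters: [homotopic] ignores the values taken elsewhere. *)
Record loop := Loop {
  loop_fun :> R -> X;
  loop_continuous : {within I, continuous loop_fun};
  loop_at0 : loop_fun 0 = x0;
  loop_at1 : loop_fun 1 = x0
}.

HB.instance Definition _ := gen_eqMixin loop.
HB.instance Definition _ := gen_choiceMixin loop.

Definition homotopic (p q : loop) : Prop :=
  exists H : R * R -> X,
    [/\ {within I `*` I, continuous H},
        forall t, I t -> H (t, 0) = p t /\ H (t, 1) = q t &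
        forall s, I s -> H (0, s) = x0 /\ H (1, s) = x0].

Lemma mem_itv01 t : I t <-> 0 <= t <= 1.
Proof. by rewrite /= in_itv/=. Qed.

Lemma closedI1 : closed I. Proof. exact: interval_closed. Qed.

Lemma closedII : closed (I `*` I).
Proof.
have -> : I `*` I = (fst @^-1` I) `&` (snd @^-1` I) :> set (R * R) by [].
apply: closedI; apply: closed_comp => [z _|]; try exact: closedI1.
  exact: cvg_fst.
exact: cvg_snd.
Qed.

Lemma cst_loop_continuous : {within I, continuous (cst x0 : R -> X)}.
Proof. by apply: continuous_subspaceT => x; exact: cvg_cst. Qed.

Definition cst_loop : loop := Loop cst_loop_continuous erefl erefl.

Lemma loop_within (Y : topologicalType) (A : set Y) (p : loop) (f : Y -> R) :
  continuous f -> (forall y, A y -> I (f y)) ->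
  {within A, continuous (fun y => p (f y))}.
Proof.
move=> cf AI; apply: (@within_comp _ _ _ A I f p) => //.
  exact: continuous_subspaceT.
exact: loop_continuous.
Qed.

Lemma square_within (A : set (R * R)) (H : R * R -> X) (f g : R * R -> R) :
  {within I `*` I, continuous H} -> continuous f -> continuous g ->
  (forall z, A z -> I (f z) /\ I (g z)) ->
  {within A, continuous (fun z => H (f z, g z))}.
Proof.
move=> cH cf cg AI.
apply: (@within_comp _ _ _ A (I `*` I) (fun z => (f z, g z)) H) => //.
by apply: continuous_subspaceT => z; exact: (cvg_pair (cf z) (cg z)).
Qed.

Lemma rev_loop_continuous (p : loop) :
  {within I, continuous (fun t => p (1 - t))}.
Proof.
apply: loop_within.
  by move=> t; apply: cvgB; [exact: cvg_cst|exact: cvg_id].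
by move=> t; rewrite !mem_itv01 => ?; lra.
Qed.

Lemma rev_loop_at0 (p : loop) : p (1 - 0) = x0.
Proof. by rewrite subr0 loop_at1. Qed.

Lemma rev_loop_at1 (p : loop) : p (1 - 1) = x0.
Proof. by rewrite subrr loop_at0. Qed.

Definition rev_loop (p : loop) : loop :=
  Loop (@rev_loop_continuous p) (rev_loop_at0 p) (rev_loop_at1 p).

Definition concat_fun (p q : R -> X) (t : R) : X :=
  if t <= 2^-1 then p (2 * t) else q (2 * t - 1).

Lemma continuous_mul2 : continuous (fun t : R => 2 * t).
Proof. by move=> t; apply: cvgMr; exact: cvg_id. Qed.

Lemma continuous_mul2B1 : continuous (fun t : R => 2 * t - 1).
Proof. by move=> t; apply: cvgB; [exact: continuous_mul2|exact: cvg_cst]. Qed.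

Lemma concat_loop_continuous (p q : loop) :
  {within I, continuous (concat_fun p q)}.
Proof.
apply: (@within_paste _ _ _ I id 2^-1 (fun t => p (2 * t))
  (fun t => q (2 * t - 1))).
- exact: closedI1.
- by move=> t; exact: cvg_id.
- apply: (@loop_within R _ p (fun t => 2 * t)).
    exact: continuous_mul2.
  by move=> t [/mem_itv01 ? /= ?]; apply/mem_itv01; lra.
- apply: (@loop_within R _ q (fun t => 2 * t - 1)).
    exact: continuous_mul2B1.
  by move=> t [/mem_itv01 ? /= ?]; apply/mem_itv01; lra.
- by move=> t _ ->; rewrite divff// subrr loop_at0 loop_at1.
Qed.

Lemma concat_loop_at0 (p q : loop) : concat_fun p q 0 = x0.
Proof. by rewrite /concat_fun invr_ge0 ler0n mulr0 loop_at0. Qed.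

Lemma concat_loop_at1 (p q : loop) : concat_fun p q 1 = x0.
Proof.
rewrite /concat_fun ifF; last by apply/negbTE; rewrite -ltNge; lra.
by have -> : 2 * 1 - 1 = 1 :> R by [lra|ring]; rewrite loop_at1.
Qed.

Definition concat_loop (p q : loop) : loop :=
  Loop (@concat_loop_continuous p q) (concat_loop_at0 p q)
    (concat_loop_at1 p q).

Lemma homotopic_refl p : homotopic p p.
Proof.
exists (fun z => p z.1); split.
- apply: loop_within.
    by move=> z; exact: cvg_fst.
  by move=> z [].
- by [].
- by move=> s _ /=; rewrite loop_at0 loop_at1.
Qed.

Lemma continuous_fstR : continuous (fst : R * R -> R).
Proof. by move=> z; exact: cvg_fst. Qed.

Lemma continuous_sndR : continuous (snd : R * R -> R).
Proof. by move=> z; exact: cvg_snd. Qed.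

Lemma continuous_compfst (f : R -> R) :
  continuous f -> continuous (fun z : R * R => f z.1).
Proof.
move=> cf z; apply: (@continuous_comp (R * R)%type R R fst f z).
  exact: continuous_fstR.
exact: cf.
Qed.

Lemma continuous_compsnd (f : R -> R) :
  continuous f -> continuous (fun z : R * R => f z.2).
Proof.
move=> cf z; apply: (@continuous_comp (R * R)%type R R snd f z).
  exact: continuous_sndR.
exact: cf.
Qed.

Lemma homotopic_sym p q : homotopic p q -> homotopic q p.
Proof.
move=> [H [cH H01 Hx]]; exists (fun z => H (z.1, 1 - z.2)); split.
- apply: (@square_within _ _ (fun z => z.1) (fun z => 1 - z.2) cH).
      exact: continuous_fstR.
    by move=> z; apply: cvgB; [exact: cvg_cst|exact: continuous_sndR].
  by move=> z [/mem_itv01 ? /mem_itv01 ?]; split; apply/mem_itv01 => /=; lra.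
- by move=> t /H01[? ?] /=; rewrite subr0 subrr.
- by move=> s /mem_itv01 ? /=; apply: Hx; apply/mem_itv01; lra.
Qed.

Lemma homotopic_trans q p r :
  homotopic p q -> homotopic q r -> homotopic p r.
Proof.
move=> [H [cH H01 Hx]] [K [cK K01 Kx]].
exists (fun z => if z.2 <= 2^-1 then H (z.1, 2 * z.2) else K (z.1, 2 * z.2 - 1)).
split.
- apply: (@within_paste _ _ _ _ snd).
  + exact: closedII.
  + exact: continuous_sndR.
  + apply: (@square_within _ _ (fun z => z.1) (fun z => 2 * z.2) cH).
        exact: continuous_fstR.
      exact: (continuous_compsnd continuous_mul2).
    by move=> z [[/mem_itv01 ? /mem_itv01 ?] /= ?]; split; apply/mem_itv01 => /=; lra.
  + apply: (@square_within _ _ (fun z => z.1) (fun z => 2 * z.2 - 1) cK).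
        exact: continuous_fstR.
      exact: (continuous_compsnd continuous_mul2B1).
    by move=> z [[/mem_itv01 ? /mem_itv01 ?] /= ?]; split; apply/mem_itv01 => /=; lra.
  + move=> z [zI _] ->; rewrite divff// subrr.
    by rewrite (H01 _ zI).2 (K01 _ zI).1.
- move=> t It /=; rewrite invr_ge0 ler0n mulr0 (H01 _ It).1; split => //.
  rewrite ifF; last by apply/negbTE; rewrite -ltNge; lra.
  by have -> : 2 * 1 - 1 = 1 :> R by [lra|ring]; rewrite (K01 _ It).2.
- move=> s /mem_itv01 Is /=; case: ifPn => [s2|]; last rewrite -ltNge => s2.
    by apply: Hx; apply/mem_itv01; lra.
  by apply: Kx; apply/mem_itv01; lra.
Qed.

Lemma homotopic_rev p q : homotopic p q -> homotopic (rev_loop p) (rev_loop q).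
Proof.
move=> [H [cH H01 Hx]]; exists (fun z => H (1 - z.1, z.2)); split.
- apply: (@square_within _ _ (fun z => 1 - z.1) (fun z => z.2) cH).
      by move=> z; apply: cvgB; [exact: cvg_cst|exact: continuous_fstR].
    exact: continuous_sndR.
  by move=> z [/mem_itv01 ? /mem_itv01 ?]; split; apply/mem_itv01 => /=; lra.
- by move=> t /mem_itv01 ? /=; apply: H01; apply/mem_itv01; lra.
- by move=> s /Hx[? ?] /=; rewrite subr0 subrr.
Qed.

Lemma homotopic_concat p p' q q' : homotopic p p' -> homotopic q q' ->
  homotopic (concat_loop p q) (concat_loop p' q').
Proof.
move=> [H [cH H01 Hx]] [K [cK K01 Kx]].
exists (fun z => if z.1 <= 2^-1 then H (2 * z.1, z.2) else K (2 * z.1 - 1, z.2)).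
split.
- apply: (@within_paste _ _ _ _ fst).
  + exact: closedII.
  + exact: continuous_fstR.
  + apply: (@square_within _ _ (fun z => 2 * z.1) (fun z => z.2) cH).
        exact: (continuous_compfst continuous_mul2).
      exact: continuous_sndR.
    by move=> z [[/mem_itv01 ? /mem_itv01 ?] /= ?]; split; apply/mem_itv01 => /=; lra.
  + apply: (@square_within _ _ (fun z => 2 * z.1 - 1) (fun z => z.2) cK).
        exact: (continuous_compfst continuous_mul2B1).
      exact: continuous_sndR.
    by move=> z [[/mem_itv01 ? /mem_itv01 ?] /= ?]; split; apply/mem_itv01 => /=; lra.
  + move=> z [_ zI] ->; rewrite divff// subrr.
    by rewrite (Hx _ zI).2 (Kx _ zI).1.
- move=> t /mem_itv01 It /=; rewrite /concat_fun; case: ifPn => [t2|]; last rewrite -ltNge => t2.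
    by apply: H01; apply/mem_itv01; lra.
  by apply: K01; apply/mem_itv01; lra.
- move=> s Is /=; rewrite invr_ge0 ler0n mulr0 (Hx _ Is).1; split => //.
  rewrite ifF; last by apply/negbTE; rewrite -ltNge; lra.
  by have -> : 2 * 1 - 1 = 1 :> R by [lra|ring]; rewrite (Kx _ Is).2.
Qed.

(* Two reparametrizations of one path with the same endpoints are homotopic
   through the straight-line homotopy of the parameters. *)
Lemma homotopic_reparam (f : loop) (phi psi : R -> R) (p q : loop) :
  continuous phi -> continuous psi ->
  (forall t, I t -> I (phi t)) -> (forall t, I t -> I (psi t)) ->
  phi 0 = psi 0 -> phi 1 = psi 1 ->
  (forall t, I t -> p t = f (phi t)) -> (forall t, I t -> q t = f (psi t)) ->
  homotopic p q.
Proof.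
move=> cphi cpsi Iphi Ipsi e0 e1 pE qE.
have I0 : I 0 by apply/mem_itv01; lra.
have I1 : I 1 by apply/mem_itv01; lra.
exists (fun z => f ((1 - z.2) * phi z.1 + z.2 * psi z.1)); split.
- apply: loop_within.
    move=> z; apply: cvgD; apply: cvgM.
    + by apply: cvgB; [exact: cvg_cst|exact: continuous_sndR].
    + exact: (continuous_compfst cphi).
    + exact: continuous_sndR.
    + exact: (continuous_compfst cpsi).
  by move=> z [/[dup] /Iphi /mem_itv01 ? /Ipsi /mem_itv01 ? /mem_itv01 ?]; apply/mem_itv01; nra.
- move=> t It /=; rewrite subr0 subrr !mul1r !mul0r addr0 add0r.
  by rewrite pE ?qE.
- move=> s _ /=; rewrite -e0 -e1 -!mulrDl subrK !mul1r.
  by rewrite -!pE// loop_at0 loop_at1.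
Qed.

Lemma homotopic_concatA p q r :
  homotopic (concat_loop p (concat_loop q r)) (concat_loop (concat_loop p q) r).
Proof.
apply: homotopic_sym.
apply: (@homotopic_reparam (concat_loop p (concat_loop q r))
  (fun t => Num.min (2 * t) (Num.min (t + 4^-1) ((t + 1) / 2))) id) => //.
- move=> t; apply: (@continuous_min R R (fun t => 2 * t)
    (fun t => Num.min (t + 4^-1) ((t + 1) / 2))); first exact: continuous_mul2.
  apply: (@continuous_min R R (fun t => t + 4^-1) (fun t => (t + 1) / 2)).
    by apply: cvgD; [exact: cvg_id|exact: cvg_cst].
  by apply: cvgMl; apply: cvgD; [exact: cvg_id|exact: cvg_cst].
- by move=> t; exact: cvg_id.
- by move=> t /mem_itv01 ?; apply/mem_itv01; rewrite /Num.min; case: (ltP (_ + 4^-1)) => ?; case: ltP => ?; lra.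
- by rewrite /Num.min; case: (ltP (_ + 4^-1)) => ?; case: ltP => ?; lra.
- by rewrite /Num.min; case: (ltP (_ + 4^-1)) => ?; case: ltP => ?; lra.
- move=> t /mem_itv01 ? /=; rewrite /concat_fun/= /concat_fun /Num.min.
  case: (ltP (_ + 4^-1)) => ?; case: ltP => ?; do 5 ?case: leP => ?; try (by exfalso; lra); congr (loop_fun _ _); lra.
Qed.

Lemma homotopic_concat1p p : homotopic (concat_loop cst_loop p) p.
Proof.
apply: (@homotopic_reparam p (fun t => Num.max 0 (2 * t - 1)) id) => //.
- move=> t; apply: (@continuous_max R R (fun t => 0) (fun t => 2 * t - 1)).
    exact: cvg_cst.
  exact: continuous_mul2B1.
- by move=> t; exact: cvg_id.
- by move=> t /mem_itv01 ?; apply/mem_itv01; rewrite /Num.max; case: ltP => ?; lra.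
- by rewrite /Num.max; case: ltP => ?; lra.
- by rewrite /Num.max; case: ltP => ?; lra.
- move=> t /mem_itv01 ? /=; rewrite /concat_fun /Num.max.
  case: ltP => ?; case: leP => ?; try (by exfalso; lra); rewrite ?loop_at0//.
Qed.

Lemma homotopic_concatp1 p : homotopic (concat_loop p cst_loop) p.
Proof.
apply: (@homotopic_reparam p (fun t => Num.min 1 (2 * t)) id) => //.
- move=> t; apply: (@continuous_min R R (fun t => 1) (fun t => 2 * t)).
    exact: cvg_cst.
  exact: continuous_mul2.
- by move=> t; exact: cvg_id.
- by move=> t /mem_itv01 ?; apply/mem_itv01; rewrite /Num.min; case: ltP => ?; lra.
- by rewrite /Num.min; case: ltP => ?; lra.
- by rewrite /Num.min; case: ltP => ?; lra.
- move=> t /mem_itv01 ? /=; rewrite /concat_fun /Num.min.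
  case: ltP => ?; case: leP => ?; try (by exfalso; lra); rewrite ?loop_at1//.
Qed.

Lemma homotopic_concatVp p : homotopic (concat_loop (rev_loop p) p) cst_loop.
Proof.
apply: (@homotopic_reparam p (fun t => `|2 * t - 1|) (cst 1)) => //.
- move=> t; apply: (@continuous_comp R R R (fun t => 2 * t - 1) Num.norm).
    exact: continuous_mul2B1.
  exact: norm_continuous.
- by move=> t; exact: cvg_cst.
- by move=> t /mem_itv01 ?; apply/mem_itv01; case: (ger0P (2 * _ - 1)) => /= ?; lra.
- by move=> t ?; apply/mem_itv01 => /=; lra.
- by case: (ger0P (2 * _ - 1)) => /= ?; lra.
- by case: (ger0P (2 * _ - 1)) => /= ?; lra.
- move=> t /mem_itv01 ? /=; rewrite /concat_fun /=.
  case: (ger0P (2 * _ - 1)) => /= ?; case: leP => ?; try (by exfalso; lra); congr (loop_fun _ _); lra.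
- by move=> t _ /=; rewrite loop_at1.
Qed.

Lemma homotopic_concatpV p : homotopic (concat_loop p (rev_loop p)) cst_loop.
Proof.
apply: (@homotopic_reparam p (fun t => 1 - `|2 * t - 1|) (cst 0)) => //.
- move=> t; apply: cvgB; first exact: cvg_cst.
  apply: (@continuous_comp R R R (fun t => 2 * t - 1) Num.norm).
    exact: continuous_mul2B1.
  exact: norm_continuous.
- by move=> t; exact: cvg_cst.
- by move=> t /mem_itv01 ?; apply/mem_itv01; case: (ger0P (2 * _ - 1)) => /= ?; lra.
- by move=> t ?; apply/mem_itv01 => /=; lra.
- by case: (ger0P (2 * _ - 1)) => /= ?; lra.
- by case: (ger0P (2 * _ - 1)) => /= ?; lra.
- move=> t /mem_itv01 ? /=; rewrite /concat_fun /=.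
  case: (ger0P (2 * _ - 1)) => /= ?; case: leP => ?; try (by exfalso; lra); congr (loop_fun _ _); lra.
- by move=> t _ /=; rewrite loop_at0.
Qed.

Definition homotopicb : rel loop := fun p q => `[< homotopic p q >].

Lemma homotopicb_refl : reflexive homotopicb.
Proof. by move=> p; apply/asboolP; exact: homotopic_refl. Qed.

Lemma homotopicb_sym : symmetric homotopicb.
Proof. by move=> p q; apply/asboolP/asboolP; exact: homotopic_sym. Qed.

Lemma homotopicb_trans : transitive homotopicb.
Proof.
by move=> q p r /asboolP pq /asboolP qr; apply/asboolP; exact: homotopic_trans qr.
Qed.

Canonical homotopic_equiv :=
  EquivRel homotopicb homotopicb_refl homotopicb_sym homotopicb_trans.

Local Open Scope quotient_scope.

Definition pi1 : Type := {eq_quot homotopic_equiv}.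

HB.instance Definition _ := Choice.on pi1.

Definition pi1_class (p : loop) : pi1 := \pi_{eq_quot homotopic_equiv} p.
Definition pi1_repr (a : pi1) : loop := repr (a : {eq_quot homotopic_equiv}).

Lemma pi1_classP (p q : loop) : pi1_class p = pi1_class q <-> homotopic p q.
Proof.
split => [/eqP|pq]; first by rewrite /pi1_class eqmodE => /asboolP.
by apply/eqP; rewrite /pi1_class eqmodE; apply/asboolP.
Qed.

Lemma pi1_reprK (a : pi1) : pi1_class (pi1_repr a) = a.
Proof. exact: reprK. Qed.

Lemma pi1_repr_class (p : loop) : homotopic (pi1_repr (pi1_class p)) p.
Proof. by apply/pi1_classP; rewrite pi1_reprK. Qed.

Definition pi1_one : pi1 := pi1_class cst_loop.
Definition pi1_inv (a : pi1) : pi1 := pi1_class (rev_loop (pi1_repr a)).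
Definition pi1_mul (a b : pi1) : pi1 :=
  pi1_class (concat_loop (pi1_repr a) (pi1_repr b)).

Lemma pi1_class_mul p q :
  pi1_mul (pi1_class p) (pi1_class q) = pi1_class (concat_loop p q).
Proof.
by apply/pi1_classP; apply: homotopic_concat; exact: pi1_repr_class.
Qed.

Lemma pi1_class_inv p : pi1_inv (pi1_class p) = pi1_class (rev_loop p).
Proof. by apply/pi1_classP; apply: homotopic_rev; exact: pi1_repr_class. Qed.

Lemma pi1_mulA : associative pi1_mul.
Proof.
move=> a b c; rewrite -(pi1_reprK a) -(pi1_reprK b) -(pi1_reprK c).
by rewrite !pi1_class_mul; apply/pi1_classP; exact: homotopic_concatA.
Qed.

Lemma pi1_mul1g : left_id pi1_one pi1_mul.
Proof.
move=> a; rewrite -(pi1_reprK a) pi1_class_mul; apply/pi1_classP.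
exact: homotopic_concat1p.
Qed.

Lemma pi1_mulg1 : right_id pi1_one pi1_mul.
Proof.
move=> a; rewrite -(pi1_reprK a) pi1_class_mul; apply/pi1_classP.
exact: homotopic_concatp1.
Qed.

Lemma pi1_mulVg : left_inverse pi1_one pi1_inv pi1_mul.
Proof.
move=> a; rewrite -(pi1_reprK a) pi1_class_inv pi1_class_mul; apply/pi1_classP.
exact: homotopic_concatVp.
Qed.

Lemma pi1_mulgV : right_inverse pi1_one pi1_inv pi1_mul.
Proof.
move=> a; rewrite -(pi1_reprK a) pi1_class_inv pi1_class_mul; apply/pi1_classP.
exact: homotopic_concatpV.
Qed.

HB.instance Definition _ :=
  isGroup.Build pi1 pi1_mulA pi1_mul1g pi1_mulg1 pi1_mulVg pi1_mulgV.

End FundamentalGroup.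

Arguments pi1 R {X} x0.

Section PropertyT.
Context (R : realType).
Local Open Scope complex_scope.

(* The norm of a module over [R[i]] takes its values in the nonnegative reals
   of [R[i]]. *)
Record hilbertSpace := HilbertSpace {
  hilbert_sort :> completeNormedModType R[i];
  inner : {dot hilbert_sort for Num.conj};
  innerE : forall v : hilbert_sort, inner v v = `|v| ^+ 2
}.

Record unitaryRep (G : groupType) (H : hilbertSpace) := UnitaryRep {
  rep_fun :> G -> {linear H -> H};
  rep1 : forall v : H, rep_fun 1%g v = v;
  repM : forall (g h : G) (v : H), rep_fun (g * h)%g v = rep_fun g (rep_fun h v);
  rep_inner : forall (g : G) (u v : H),
    inner H (rep_fun g u) (rep_fun g v) = inner H u v
}.

(* Kazhdan's property (T) of a discrete group, whose compact subsets are its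
   finite subsets. The condition [v != 0] matters when [Q] is empty. *)
Definition property_T (G : groupType) : Prop :=
  exists (Q : seq G) (eps : R), 0 < eps /\
    forall (H : hilbertSpace) (rho : unitaryRep G H),
      (exists2 v : H, v != 0 &
         forall g, g \in Q -> `|rho g v - v| < eps%:C * `|v|) ->
      exists2 w : H, w != 0 & forall g, rho g w = w.

End PropertyT.

Section RandomComplex.
Context {R : realType}.

(* A subcomplex of the simplex on [n] vertices is the set of its nonempty
   simplexes; an [i]-dimensional simplex is a set of [i.+1] vertices. *)
Definition is_subcomplex n (Y : {set {set 'I_n}}) : bool :=
  [forall s in Y, (0 < #|s|)%N &&
    [forall t : {set 'I_n}, (0 < #|t|)%N && (t \subset s) ==> (t \in Y)]].

Definition Omega (r n : nat) : {set {set {set 'I_n}}} :=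
  [set Y : {set {set 'I_n}} |
    is_subcomplex Y && [forall s in Y, (#|s| <= r.+1)%N]]%SET.

Definition face_count n (i : nat) (Y : {set {set 'I_n}}) : nat :=
  #|[set s in Y | #|s| == i.+1]%SET|.

(* For [i = 0] the last condition is void: the external vertices are those
   outside [Y]. *)
Definition external_count n (i : nat) (Y : {set {set 'I_n}}) : nat :=
  #|[set s : {set 'I_n} | [&& #|s| == i.+1, s \notin Y &
      [forall t : {set 'I_n}, (0 < #|t|)%N && (t \proper s) ==> (t \in Y)]]]%SET|.

(* [x ^+ 0 = 1] provides the convention 0^0 = 1. *)
Definition complex_weight r n (p : 'I_r.+1 -> R) (Y : {set {set 'I_n}}) : R :=
  (\prod_(i < r.+1) p i ^+ face_count i Y) *
  (\prod_(i < r.+1) (1 - p i) ^+ external_count i Y).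

Definition complex_prob r n (p : 'I_r.+1 -> R)
    (A : {set {set 'I_n}} -> Prop) : R :=
  \sum_(Y in Omega r n | `[< A Y >]) complex_weight p Y.

Definition psi r (k : nat) (a : 'rV[R]_r.+1) : R :=
  \sum_(i < r.+1) 'C(k, i)%:R * a ord0 i.

Definition domain r (k : nat) : set 'rV[R]_r.+1 :=
  [set a : 'rV[R]_r.+1 | [/\ forall i, 0 <= a ord0 i, (k <= r)%N, psi k a < 1 &
               (k < r)%N -> 1 < psi k.+1 a]].

End RandomComplex.

Arguments domain {R} r k _.

(* Barycentric coordinates: a point of the geometric realization is a convex
   combination of the vertices whose support is a simplex of [Y]. *)
Definition realization (R : realType) n (Y : {set {set 'I_n}}) : set 'rV[R]_n :=
  [set x : 'rV[R]_n | [/\ forall i, 0 <= x ord0 i, \sum_(i < n) x ord0 i = 1 &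
               [set i | x ord0 i != 0]%SET \in Y]].

Arguments realization R {n} Y _.

(* Main.v *)
(* If [psi_2 < 1] then the link of a vertex in the 2-skeleton is a random graph
   whose mean degree [D = n^(1 - psi_2)] is a power of [n], so its centred
   adjacency matrix has norm at most [D / 32] (trace method, with a fixed
   even moment), while every edge lies in at least [D / 8] triangles. Garland's
   local-to-global argument then bounds the energy of a 0-cochain, twisted by a
   unitary representation of the fundamental group, by a multiple of the square
   norm of its Laplacian. Starting from the constant cochain at an almost
   invariant vector, gradient descent therefore converges to a flat cochain
   nearby. A flat cochain is a nonzero invariant vector: up to homotopy a loop
   runs through open stars of vertices, that is along edges. Only this half of
   the comparison with the edge-path group is needed, as property (T) passes to
   quotients. *)
Require Import Defs.
From Corelib Require Setoid Morphisms.
From HB Require Import structures.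
From mathcomp Require Import all_boot all_order all_algebra.
From mathcomp Require Import complex.
From mathcomp Require Import all_classical all_reals all_analysis.
From mathcomp Require Import ring lra.

Set Implicit Arguments.
Unset Strict Implicit.
Unset Printing Implicit Defensive.

Import Order.TTheory GRing.Theory Num.Theory.
Import numFieldNormedType.Exports.

Local Open Scope classical_set_scope.
Local Open Scope ring_scope.

(** * Paths and homotopies *)

(** The adjacency form of a link is split into a centred form, small by the trace bound, plus [q]
    times the all-ones form, minus a nonnegative term that is dropped. Evaluated on a coboundary,
    the all-ones form is the square norm of the Laplacian at the vertex. So the one large eigenvalue
    of a link lands on the right of Garland's inequality, and two estimates remain: triangle counts
    from below, centred forms from above. The constants are such that twice [D / 32] is less than
    [D / 8]. A Kazhdan pair may depend on the complex, so the constants of the descent may be crude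
    and grow with [n]. The given measure couples a simplex to its boundary. It is handled as the
    image of an independent selection of all simplexes, where moments factor over disjoint blocks.
    The trace bound comes from iterated Cauchy-Schwarz instead of a spectral theorem, so the moment
    [2 * l] is a power of 2. The failure probability is at most a constant times [n ^ 2 / D ^ l],
    and [l] is chosen with [D ^ l >= n ^ 3]. *)

Section Paths.
Context {R : realType}.
Local Notation I := (unit_itv R).

(** End points are carried by the type, as the path groupoid requires; [loop] only provides based
    loops. As there, values outside the unit interval are irrelevant. *)
Record pathIn {X : topologicalType} (a b : X) := PathIn {
  path_fun :> R -> X;
  path_continuous : {within I, continuous path_fun};
  path_at0 : path_fun 0 = a;
  path_at1 : path_fun 1 = b
}.

Definition path_homotopic {X : topologicalType} {a b : X} (p q : pathIn a b) :=
  exists H : R * R -> X,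
    [/\ {within I `*` I, continuous H},
        forall t, I t -> H (t, 0) = p t /\ H (t, 1) = q t &
        forall s, I s -> H (0, s) = a /\ H (1, s) = b].

Lemma path_within (X Y : topologicalType) (a b : X) (p : pathIn a b)
    (A : set Y) (f : Y -> R) :
  {within A, continuous f} -> (forall y, A y -> I (f y)) ->
  {within A, continuous (fun y => p (f y))}.
Proof.
move=> cf AI; apply: (@within_comp _ _ _ A I f p) => //.
exact: path_continuous.
Qed.

Lemma concat_path_continuous (X : topologicalType) (a b c : X)
    (p : pathIn a b) (q : pathIn b c) : {within I, continuous (concat_fun p q)}.
Proof.
apply: (@within_paste _ _ _ I id 2^-1 (fun t => p (2 * t))
  (fun t => q (2 * t - 1))).
- exact: closedI1.
- by move=> t; exact: cvg_id.
- apply: path_within; first exact/continuous_subspaceT/continuous_mul2.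
  by move=> t [/mem_itv01 ? /= ?]; apply/mem_itv01; lra.
- apply: path_within; first exact/continuous_subspaceT/continuous_mul2B1.
  by move=> t [/mem_itv01 ? /= ?]; apply/mem_itv01; lra.
- by move=> t _ ->; rewrite divff// subrr path_at0 path_at1.
Qed.

Lemma concat_path_at0 (X : topologicalType) (a b c : X)
  (p : pathIn a b) (q : pathIn b c) : concat_fun p q 0 = a.
Proof. by rewrite /concat_fun invr_ge0 ler0n mulr0 path_at0. Qed.

Lemma concat_path_at1 (X : topologicalType) (a b c : X)
  (p : pathIn a b) (q : pathIn b c) : concat_fun p q 1 = c.
Proof.
rewrite /concat_fun ifF; last by apply/negbTE; rewrite -ltNge; lra.
by have -> : 2 * 1 - 1 = 1 :> R by [lra|ring]; rewrite path_at1.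
Qed.

Definition concat_path (X : topologicalType) (a b c : X)
    (p : pathIn a b) (q : pathIn b c) : pathIn a c :=
  PathIn (@concat_path_continuous _ _ _ _ p q) (concat_path_at0 p q)
    (concat_path_at1 p q).

Section Segment.
Context {V : normedModType R} (a b : V).

Lemma segment_continuous :
  {within I, continuous (fun t : R => (1 - t) *: a + t *: b)}.
Proof.
apply: continuous_subspaceT => t; apply: cvgD; apply: cvgZr_tmp.
  by apply: cvgB; [exact: cvg_cst|exact: cvg_id].
exact: cvg_id.
Qed.

Lemma segment_at0 : (1 - 0) *: a + 0 *: b = a :> V.
Proof. by rewrite subr0 scale1r scale0r addr0. Qed.

Lemma segment_at1 : (1 - 1) *: a + 1 *: b = b :> V.
Proof. by rewrite subrr scale1r scale0r add0r. Qed.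

Definition segment : pathIn a b :=
  PathIn segment_continuous segment_at0 segment_at1.

End Segment.

Definition convex_subset (V : lmodType R) (C : set V) :=
  forall a b t, C a -> C b -> I t -> C ((1 - t) *: a + t *: b).

Lemma concat_path_in (V : topologicalType) (C : set V) (a b c : V)
    (p : pathIn a b) (q : pathIn b c) :
  (forall t, I t -> C (p t)) -> (forall t, I t -> C (q t)) ->
  forall t, I t -> C (concat_path p q t).
Proof.
move=> Cp Cq t /mem_itv01 It /=; rewrite /concat_fun.
by case: leP => t2; [apply: Cp|apply: Cq]; apply/mem_itv01; lra.
Qed.

Lemma segment_in (V : normedModType R) (C : set V) (a b : V) :
  convex_subset C -> C a -> C b -> forall t, I t -> C (segment a b t).
Proof. by move=> cC Ca Cb t It; exact: cC. Qed.

Lemma concat_fun_comp (X V : topologicalType) (F : V -> X) (f g : R -> V) (p q : R -> X) :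
  (forall t, I t -> p t = F (f t)) -> (forall t, I t -> q t = F (g t)) ->
  forall t, I t -> concat_fun p q t = F (concat_fun f g t).
Proof.
move=> pF qF t /mem_itv01 It; rewrite /concat_fun.
by case: leP => t2; [apply: pF|apply: qF]; apply/mem_itv01; lra.
Qed.

(* The image of a convex set is simply connected as far as the images of paths
   in that set are concerned: use the straight-line homotopy upstairs. *)
Lemma convex_homotopic (X : topologicalType) (V : normedModType R) (C : set V)
    (F : V -> X) (a b : X) (p q : pathIn a b) (u w : V) (f g : pathIn u w) :
  convex_subset C -> {within C, continuous F} ->
  (forall t, I t -> C (f t)) -> (forall t, I t -> C (g t)) ->
  (forall t, I t -> p t = F (f t)) -> (forall t, I t -> q t = F (g t)) ->
  path_homotopic p q.
Proof.
move=> cC cF Cf Cg pF qF.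
have I0 : I 0 by apply/mem_itv01; lra.
have I1 : I 1 by apply/mem_itv01; lra.
exists (fun z => F ((1 - z.2) *: f z.1 + z.2 *: g z.1)); split.
- apply: (@within_comp _ _ _ _ C (fun z : R * R => (1 - z.2) *: f z.1 + z.2 *: g z.1) F) => //.
    have c1 (h : pathIn u w) : {within I `*` I, continuous (fun z : R * R => h z.1)}.
      apply: path_within; first exact/continuous_subspaceT/continuous_fstR.
      by move=> z [].
    move=> z; apply: cvgD.
      apply: cvgZ; last exact: c1.
      apply: cvgB; first exact: cvg_cst.
      exact: (continuous_subspaceT (@continuous_sndR R)).
    apply: cvgZ; last exact: c1.
    exact: (continuous_subspaceT (@continuous_sndR R)).
  by move=> z [z1 z2]; apply: cC => //; [exact: Cf|exact: Cg].
- move=> t It /=; rewrite subr0 subrr !scale1r !scale0r addr0 add0r.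
  by rewrite pF ?qF.
- move=> s _ /=; rewrite (path_at0 f) (path_at0 g) (path_at1 f) (path_at1 g).
  rewrite -!scalerDl subrK !scale1r -{1}(path_at0 f) -pF// path_at0.
  by rewrite -{1}(path_at1 f) -pF// path_at1.
Qed.

End Paths.

(** * The laws of the path groupoid up to homotopy *)

Section PathGroupoid.
Context {R : realType} {X : topologicalType}.
Local Notation I := (unit_itv R).
Implicit Types a b c : X.

Lemma convex_unit_itv : convex_subset (I : set R^o).
Proof.
move=> a b t /mem_itv01 Ia /mem_itv01 Ib /mem_itv01 It; apply/mem_itv01.
by rewrite /GRing.scale/=; nra.
Qed.

Definition interval_path (u w : R) : pathIn (u : R^o) (w : R^o) := segment _ _.

Lemma interval_pathE (u w t : R) : interval_path u w t = (1 - t) * u + t * w.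
Proof. by []. Qed.

(** The case of [convex_homotopic] where the convex set is the unit interval. Each groupoid law
    below has two sides that factor through one path [h], via piecewise linear parameters with the
    same ends. *)
Lemma reparam_homotopic a b a' b' (h : pathIn a' b') (p q : pathIn a b)
    (u w : R^o) (f g : @pathIn R _ u w) :
  (forall t, I t -> I (f t)) -> (forall t, I t -> I (g t)) ->
  (forall t, I t -> p t = h (f t)) -> (forall t, I t -> q t = h (g t)) ->
  path_homotopic p q.
Proof.
by move=> If Ig ph qh; apply: (@convex_homotopic _ _ R^o I h _ _ _ _ _ _ f g);
  [exact: convex_unit_itv|exact: path_continuous|..].
Qed.

Lemma path_eq_homotopic a b (p q : @pathIn R X a b) :
  (forall t, I t -> p t = q t) -> path_homotopic p q.
Proof.
move=> pq; apply: (@reparam_homotopic _ _ _ _ q p q 0 1 (interval_path 0 1) (interval_path 0 1)).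
1,2: by move=> t /mem_itv01 It; rewrite interval_pathE; apply/mem_itv01; lra.
all: by move=> t It; rewrite interval_pathE mulr0 add0r mulr1 ?pq.
Qed.

Lemma path_homotopic_sym a b (p q : @pathIn R X a b) :
  path_homotopic p q -> path_homotopic q p.
Proof.
move=> [H [cH H01 Hx]]; exists (fun z => H (z.1, 1 - z.2)); split.
- apply: (@square_within _ _ _ _ (fun z => z.1) (fun z => 1 - z.2) cH).
      exact: continuous_fstR.
    by move=> z; apply: cvgB; [exact: cvg_cst|exact: continuous_sndR].
  by move=> z [/mem_itv01 ? /mem_itv01 ?]; split; apply/mem_itv01 => /=; lra.
- by move=> t /H01[? ?] /=; rewrite subr0 subrr.
- by move=> s /mem_itv01 ? /=; apply: Hx; apply/mem_itv01; lra.
Qed.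

Lemma path_homotopic_trans a b (p q r : @pathIn R X a b) :
  path_homotopic p q -> path_homotopic q r -> path_homotopic p r.
Proof.
move=> [H [cH H01 Hx]] [K [cK K01 Kx]].
exists (fun z => if z.2 <= 2^-1 then H (z.1, 2 * z.2) else K (z.1, 2 * z.2 - 1)).
split.
- apply: (@within_paste _ _ _ _ snd).
  + exact: closedII.
  + exact: continuous_sndR.
  + apply: (@square_within _ _ _ _ (fun z => z.1) (fun z => 2 * z.2) cH).
        exact: continuous_fstR.
      exact: (continuous_compsnd continuous_mul2).
    by move=> z [[/mem_itv01 ? /mem_itv01 ?] /= ?]; split; apply/mem_itv01 => /=; lra.
  + apply: (@square_within _ _ _ _ (fun z => z.1) (fun z => 2 * z.2 - 1) cK).
        exact: continuous_fstR.
      exact: (continuous_compsnd continuous_mul2B1).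
    by move=> z [[/mem_itv01 ? /mem_itv01 ?] /= ?]; split; apply/mem_itv01 => /=; lra.
  + move=> z [zI _] ->; rewrite divff// subrr.
    by rewrite (H01 _ zI).2 (K01 _ zI).1.
- move=> t It /=; rewrite invr_ge0 ler0n mulr0 (H01 _ It).1; split => //.
  rewrite ifF; last by apply/negbTE; rewrite -ltNge; lra.
  by have -> : 2 * 1 - 1 = 1 :> R by [lra|ring]; rewrite (K01 _ It).2.
- move=> s /mem_itv01 Is /=; case: leP => s2.
    by apply: Hx; apply/mem_itv01; lra.
  by apply: Kx; apply/mem_itv01; lra.
Qed.

Lemma concat_path_homotopic a b c (p p' : @pathIn R X a b) (q q' : pathIn b c) :
  path_homotopic p p' -> path_homotopic q q' ->
  path_homotopic (concat_path p q) (concat_path p' q').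
Proof.
move=> [H [cH H01 Hx]] [K [cK K01 Kx]].
exists (fun z => if z.1 <= 2^-1 then H (2 * z.1, z.2) else K (2 * z.1 - 1, z.2)).
split.
- apply: (@within_paste _ _ _ _ fst).
  + exact: closedII.
  + exact: continuous_fstR.
  + apply: (@square_within _ _ _ _ (fun z => 2 * z.1) (fun z => z.2) cH).
        exact: (continuous_compfst continuous_mul2).
      exact: continuous_sndR.
    by move=> z [[/mem_itv01 ? /mem_itv01 ?] /= ?]; split; apply/mem_itv01 => /=; lra.
  + apply: (@square_within _ _ _ _ (fun z => 2 * z.1 - 1) (fun z => z.2) cK).
        exact: (continuous_compfst continuous_mul2B1).
      exact: continuous_sndR.
    by move=> z [[/mem_itv01 ? /mem_itv01 ?] /= ?]; split; apply/mem_itv01 => /=; lra.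
  + move=> z [_ zI] ->; rewrite divff// subrr.
    by rewrite (Hx _ zI).2 (Kx _ zI).1.
- move=> t /mem_itv01 It /=; rewrite /concat_fun; case: leP => t2.
    by apply: H01; apply/mem_itv01; lra.
  by apply: K01; apply/mem_itv01; lra.
- move=> s Is /=; rewrite invr_ge0 ler0n mulr0 (Hx _ Is).1; split => //.
  rewrite ifF; last by apply/negbTE; rewrite -ltNge; lra.
  by have -> : 2 * 1 - 1 = 1 :> R by [lra|ring]; rewrite (Kx _ Is).2.
Qed.

Lemma cst_path_continuous a : {within I, continuous (cst a : R -> X)}.
Proof. by apply: continuous_subspaceT => x; exact: cvg_cst. Qed.

Definition cst_path a : pathIn a a := PathIn (@cst_path_continuous a) erefl erefl.

Lemma reverse_path_continuous a b (p : @pathIn R X a b) :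
  {within I, continuous (fun t => p (1 - t))}.
Proof.
apply: path_within.
  apply: continuous_subspaceT => t.
  by apply: cvgB; [exact: cvg_cst|exact: cvg_id].
by move=> t; rewrite !mem_itv01 => ?; lra.
Qed.

Lemma reverse_path_at0 a b (p : @pathIn R X a b) : p (1 - 0) = b.
Proof. by rewrite subr0 path_at1. Qed.

Lemma reverse_path_at1 a b (p : @pathIn R X a b) : p (1 - 1) = a.
Proof. by rewrite subrr path_at0. Qed.

Definition reverse_path a b (p : pathIn a b) : pathIn b a :=
  PathIn (@reverse_path_continuous _ _ p) (reverse_path_at0 p) (reverse_path_at1 p).

Lemma interval_path_unit (u w : R) : I u -> I w ->
  forall t, I t -> I (interval_path u w t).
Proof. by move=> Iu Iw; apply: segment_in => //; exact: convex_unit_itv. Qed.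

Lemma concat_cst_path a b (p : @pathIn R X a b) :
  path_homotopic (concat_path (cst_path a) p) p.
Proof.
have I0 : I 0 by apply/mem_itv01; lra.
have I1 : I 1 by apply/mem_itv01; lra.
apply: (@reparam_homotopic _ _ _ _ p _ _ 0 1
  (concat_path (interval_path 0 0) (interval_path 0 1)) (interval_path 0 1)).
- by apply: concat_path_in; exact: interval_path_unit.
- exact: interval_path_unit.
- apply: concat_fun_comp => t It; rewrite interval_pathE ?mulr0 add0r ?mulr1//.
  by rewrite path_at0.
- by move=> t It; rewrite interval_pathE mulr0 add0r mulr1.
Qed.

Lemma concat_path_cst a b (p : @pathIn R X a b) :
  path_homotopic (concat_path p (cst_path b)) p.
Proof.
have I0 : I 0 by apply/mem_itv01; lra.
have I1 : I 1 by apply/mem_itv01; lra.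
apply: (@reparam_homotopic _ _ _ _ p _ _ 0 1
  (concat_path (interval_path 0 1) (interval_path 1 1)) (interval_path 0 1)).
- by apply: concat_path_in; exact: interval_path_unit.
- exact: interval_path_unit.
- apply: concat_fun_comp => t It; rewrite interval_pathE ?mulr0 ?add0r ?mulr1//.
  by rewrite subrK path_at1.
- by move=> t It; rewrite interval_pathE mulr0 add0r mulr1.
Qed.

Lemma concat_path_reverse a b (p : @pathIn R X a b) :
  path_homotopic (concat_path p (reverse_path p)) (cst_path a).
Proof.
have I0 : I 0 by apply/mem_itv01; lra.
have I1 : I 1 by apply/mem_itv01; lra.
apply: (@reparam_homotopic _ _ _ _ p _ _ 0 0
  (concat_path (interval_path 0 1) (interval_path 1 0)) (interval_path 0 0)).
- by apply: concat_path_in; exact: interval_path_unit.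
- exact: interval_path_unit.
- apply: concat_fun_comp => t It; rewrite interval_pathE ?mulr0 ?add0r ?mulr1//.
  by rewrite addr0.
- by move=> t It; rewrite interval_pathE !mulr0 addr0 path_at0.
Qed.

Lemma reverse_path_concat a b (p : @pathIn R X a b) :
  path_homotopic (concat_path (reverse_path p) p) (cst_path b).
Proof.
have I0 : I 0 by apply/mem_itv01; lra.
have I1 : I 1 by apply/mem_itv01; lra.
apply: (@reparam_homotopic _ _ _ _ p _ _ 1 1
  (concat_path (interval_path 1 0) (interval_path 0 1)) (interval_path 1 1)).
- by apply: concat_path_in; exact: interval_path_unit.
- exact: interval_path_unit.
- apply: concat_fun_comp => t It; rewrite interval_pathE ?mulr0 ?add0r ?mulr1//.
  by rewrite addr0.
- by move=> t It; rewrite interval_pathE !mulr1 subrK path_at1.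
Qed.

Lemma concat_pathA a b c d (p : @pathIn R X a b) (q : pathIn b c) (r : pathIn c d) :
  path_homotopic (concat_path p (concat_path q r))
    (concat_path (concat_path p q) r).
Proof.
have I0 : I 0 by apply/mem_itv01; lra.
have I1 : I 1 by apply/mem_itv01; lra.
have I2 : I 2^-1 by apply/mem_itv01; lra.
have I3 : I (3 / 4) by apply/mem_itv01; lra.
(* In the bracketing [h] the three paths occupy [[0, 1/2]], [[1/2, 3/4]] and [[3/4, 1]]. *)
pose h := concat_path p (concat_path q r).
have hp t : I t -> p t = h (interval_path 0 2^-1 t).
  move=> /mem_itv01 It; rewrite interval_pathE /= /concat_fun mulr0 add0r.
  by case: leP => t2; [congr (p _); lra|exfalso; lra].
have hq t : I t -> q t = h (interval_path 2^-1 (3 / 4) t).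
  move=> /mem_itv01 It; rewrite interval_pathE /= /concat_fun.
  (* At a junction [concat_fun] takes its left branch, so the common end point is treated apart. *)
  case: leP => t2.
    have -> : t = 0 by lra.
    by rewrite path_at0 (_ : 2 * _ = 1) ?path_at1//; lra.
  by case: leP => t4; [congr (q _); lra|exfalso; lra].
have hr t : I t -> r t = h (interval_path (3 / 4) 1 t).
  move=> /mem_itv01 It; rewrite interval_pathE /= /concat_fun.
  case: leP => t2; first by exfalso; lra.
  case: leP => t4; last by congr (r _); lra.
  have -> : t = 0 by lra.
  by rewrite path_at0 (_ : 2 * _ = 1) ?path_at1//; lra.
apply: (@reparam_homotopic _ _ _ _ h _ _ 0 1
  (concat_path (interval_path 0 2^-1) (concat_path (interval_path 2^-1 (3 / 4)) (interval_path (3 / 4) 1)))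
  (concat_path (concat_path (interval_path 0 2^-1) (interval_path 2^-1 (3 / 4))) (interval_path (3 / 4) 1))).
- by do ![apply: concat_path_in]; exact: interval_path_unit.
- by do ![apply: concat_path_in]; exact: interval_path_unit.
- by do ![apply: concat_fun_comp => //].
- by do ![apply: concat_fun_comp => //].
Qed.

End PathGroupoid.

(** Together with the next instance, this lets groupoid computations proceed by rewriting up to
    homotopy. *)
#[local] Instance path_homotopic_equivalence (R : realType) (X : topologicalType)
  (a b : X) : RelationClasses.Equivalence (@path_homotopic R X a b).
Proof.
split; first by move=> p; exact: path_eq_homotopic.
- by move=> p q; exact: path_homotopic_sym.
- by move=> p q r; exact: path_homotopic_trans.
Qed.

#[local] Instance concat_path_proper (R : realType) (X : topologicalType) (a b c : X) :
  Morphisms.Proper (Morphisms.respectful path_homotopic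
      (Morphisms.respectful path_homotopic path_homotopic)) (@concat_path R X a b c).
Proof. by move=> p p' pp' q q' qq'; exact: concat_path_homotopic. Qed.

(** * Holonomy of paths and parallel sections *)

Section Holonomy.
Context {R : realType} {X : topologicalType} (x0 : X).
Variable spoke : forall a : X, @pathIn R X x0 a.
Local Notation I := (unit_itv R).

Definition loop_of_path (p : @pathIn R X x0 x0) : loop x0 :=
  Loop (@path_continuous _ _ _ _ p) (path_at0 p) (path_at1 p).

Definition path_of_loop (p : loop x0) : @pathIn R X x0 x0 :=
  PathIn (@loop_continuous _ _ _ p) (loop_at0 p) (loop_at1 p).

Lemma loop_of_path_homotopic (p q : pathIn x0 x0) :
  path_homotopic p q -> pi1_class (loop_of_path p) = pi1_class (loop_of_path q).
Proof. by move=> pq; apply/pi1_classP. Qed.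

Lemma loop_of_path_concat (p q : @pathIn R X x0 x0) :
  pi1_class (loop_of_path (concat_path p q)) =
  (pi1_class (loop_of_path p) * pi1_class (loop_of_path q))%g.
Proof.
rewrite [RHS]pi1_class_mul; apply/pi1_classP.
by case: (path_eq_homotopic (fun t _ => erefl (concat_path p q t))) => H; exists H.
Qed.

(** Closing a path through the spokes of its ends gives a morphism from the path groupoid to the
    fundamental group: inner spokes cancel in a concatenation. *)
Definition holonomy (a b : X) (p : pathIn a b) : pi1 R x0 :=
  pi1_class (loop_of_path
    (concat_path (spoke a) (concat_path p (reverse_path (spoke b))))).

Lemma holonomy_homotopic a b (p q : pathIn a b) :
  path_homotopic p q -> holonomy p = holonomy q.
Proof.
by move=> pq; apply: loop_of_path_homotopic; rewrite pq; reflexivity.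
Qed.

Lemma holonomy_concat a b c (p : pathIn a b) (q : pathIn b c) :
  holonomy (concat_path p q) = (holonomy p * holonomy q)%g.
Proof.
rewrite -loop_of_path_concat; apply: loop_of_path_homotopic; symmetry.
rewrite -concat_pathA -(concat_pathA p (reverse_path _)).
rewrite (concat_pathA (reverse_path (spoke b)) (spoke b)).
by rewrite reverse_path_concat concat_cst_path (concat_pathA p); reflexivity.
Qed.

Lemma holonomy_cst a : holonomy (cst_path a) = 1%g.
Proof.
transitivity (pi1_class (loop_of_path (cst_path x0))).
  apply: loop_of_path_homotopic.
  by rewrite concat_cst_path concat_path_reverse; reflexivity.
apply/pi1_classP.
have [H HH] : path_homotopic (cst_path x0 : @pathIn R X _ _) (cst_path x0).
  exact: path_eq_homotopic.
by exists H.
Qed.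

(** The spoke at [x0] may be an arbitrary loop, so a representative of [g] is first conjugated by
    it. *)
Lemma holonomy_surjective g : exists p : pathIn x0 x0, holonomy p = g.
Proof.
pose p := path_of_loop (pi1_repr g).
pose c := spoke x0.
exists (concat_path (reverse_path c) (concat_path p c)).
rewrite -[RHS]pi1_reprK.
have -> : pi1_repr g = loop_of_path p by rewrite /p; case: (pi1_repr g).
apply: loop_of_path_homotopic; rewrite -/c.
rewrite -!concat_pathA concat_path_reverse concat_path_cst (concat_pathA c).
by rewrite concat_path_reverse concat_cst_path; reflexivity.
Qed.

Section Subpath.
Variables (a b : X) (p : @pathIn R X a b).

Lemma subpath_continuous s t : I s -> I t ->
  {within I, continuous (fun u => p (interval_path s t u))}.
Proof.
move=> Is It; apply: path_within; first exact: path_continuous.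
exact: interval_path_unit.
Qed.

Lemma subpath_at0 s t : p (interval_path s t 0) = p s.
Proof. by rewrite path_at0. Qed.

Lemma subpath_at1 s t : p (interval_path s t 1) = p t.
Proof. by rewrite path_at1. Qed.

Definition subpath s t (Is : I s) (It : I t) : pathIn (p s) (p t) :=
  PathIn (subpath_continuous Is It) (subpath_at0 s t) (subpath_at1 s t).

Lemma holonomy_subpath s t u (Is : I s) (It : I t) (Iu : I u) :
  holonomy (subpath Is Iu) =
  (holonomy (subpath Is It) * holonomy (subpath It Iu))%g.
Proof.
rewrite -holonomy_concat; apply: holonomy_homotopic.
apply: (@reparam_homotopic _ _ _ _ _ _ p _ _ s u (interval_path s u)
  (concat_path (interval_path s t) (interval_path t u))) => //.
- exact: interval_path_unit.
- by apply: concat_path_in; exact: interval_path_unit.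
- exact: concat_fun_comp.
Qed.

End Subpath.

(** Continuous induction along the path: local parallelism pushes the set of good parameters beyond
    its supremum, unless that set already contains 1. *)
Lemma flat_section_parallel (H : hilbertSpace R) (rho : unitaryRep (pi1 R x0) H)
    (W : X -> H) :
  (forall a : X, exists2 U : set X, nbhs a U & forall (b c : X) (p : pathIn b c),
     (forall t, I t -> U (p t)) -> rho (holonomy p) (W c) = W b) ->
  forall (a b : X) (p : pathIn a b), rho (holonomy p) (W b) = W a.
Proof.
move=> locW a b p0.
suff key : forall (a b : X) (p : pathIn a b), rho (holonomy p) (W (p 1)) = W (p 0).
  by have := key _ _ p0; rewrite path_at0 path_at1.
move=> {a b p0} a b p.
have I0 : I 0 by apply/mem_itv01; lra.
have I1 : I 1 by apply/mem_itv01; lra.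
suff key : forall It : I 1, rho (holonomy (subpath p I0 It)) (W (p 1)) = W (p 0).
  rewrite -[RHS](key I1); congr (rho _ _); clear.
  case: p I0 I1 => f cf f0 f1 I0 I1; subst a b; apply: holonomy_homotopic.
  apply: path_eq_homotopic => t _; rewrite [RHS]/=.
  by congr (f _); rewrite -[RHS]/((1 - t) * 0 + t * 1) mulr0 add0r mulr1.
pose S := [set t | I t /\ forall It : I t,
  rho (holonomy (subpath p I0 It)) (W (p t)) = W (p 0)].
have S0 : S 0.
  split=> // I0'; rewrite -[RHS](rep1 rho) -(holonomy_cst (p 0)).
  congr (rho _ _); apply: holonomy_homotopic; apply: path_eq_homotopic => t _.
  by rewrite [LHS]/=; congr (p _); rewrite -[LHS]/((1 - t) * 0 + t * 0) !mulr0 addr0.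
have hS : has_sup S.
  by split; [exists 0|exists 1 => t [/mem_itv01 /andP[]]].
have I_sup : I (sup S).
  apply/mem_itv01; rewrite (ub_le_sup _ S0)/=; last by case: hS.
  by apply: ge_sup; [exists 0|move=> t [/mem_itv01 /andP[]]].
have [U nU locU] := locW (p (sup S)).
have [e e0 eU] : exists2 e : R, 0 < e & forall t, I t -> `|sup S - t| < e -> U (p t).
  have /subspace_continuousP /(_ _ I_sup) /(_ _ nU) := @path_continuous _ _ _ _ p.
  rewrite /within /= => /nbhs_ballP[e /= e0 eU].
  by exists e => // t It te; apply: eU.
have [t [It St] te] := sup_adherent e0 hS.
have tS : t <= sup S by apply: ub_le_sup; [case: hS|split].
(* From a [t] in [S] close to the supremum, the subpath to [u] stays where [locW] applies. *)
have step u : I u -> `|sup S - u| < e -> S u.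
  move=> Iu ue; split=> // Iu'.
  rewrite (holonomy_subpath _ _ It) repM locU ?St//.
  move=> v Iv; apply: eU; first exact: interval_path_unit.
  have /mem_itv01 /andP[v0 v1] := Iv.
  rewrite interval_pathE; move: te ue; rewrite !ltr_norml => te /andP[u1 u2].
  have h1 : (1 - v) * (sup S - t) <= (1 - v) * e by nra.
  have h2 : (1 - v) * (sup S - t) >= 0 by nra.
  case: (eqVneq v 0) => [->|v_neq]; first by rewrite subr0 mul1r mul0r addr0; apply/andP; split; lra.
  have v_gt0 : 0 < v by rewrite lt_neqAle eq_sym v_neq.
  have h3 : v * (sup S - u) < v * e by rewrite ltr_pM2l.
  have h4 : v * (- e) < v * (sup S - u) by rewrite ltr_pM2l.
  by apply/andP; split; nra.
have [_ key] : S 1; last exact: key.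
have /mem_itv01 /andP[s0 s1] := I_sup.
(* Half a radius beyond the supremum, capped at 1. Since [u] lies in [S] it cannot exceed the
   supremum, which leaves [u = 1]. *)
pose u := Num.min 1 (sup S + e / 2).
have [u1 u2 uE] : [/\ u <= 1, u <= sup S + e / 2 & u = 1 \/ u = sup S + e / 2].
  by rewrite /u !ge_min !lexx orbT; split=> //; case: leP; [left|right].
have us : sup S <= u by case: uE; lra.
have Su : S u.
  by apply: step; [apply/mem_itv01|rewrite ltr_norml]; apply/andP; split; lra.
have : u <= sup S by apply: ub_le_sup => //; case: hS.
by case: uE Su => [->|]//; lra.
Qed.

End Holonomy.

(** * The geometric realization *)

Section Realization.
Context {R : realType} {n : nat} (Y : {set {set 'I_n}}).
Hypothesis subY : is_subcomplex Y.
Local Notation I := (unit_itv R).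
Local Notation X := (realization R Y).
Variable x0 : X.

Lemma subcomplex_face (s t : {set 'I_n}) :
  s \in Y -> (0 < #|t|)%N -> t \subset s -> t \in Y.
Proof.
move=> sY t0 ts; have /forall_inP /(_ _ sY) /andP[_ /forallP /(_ t)] := subY.
by rewrite t0 ts.
Qed.

Definition vertex_support (a : 'rV[R]_n) : {set 'I_n} := [set i | a ord0 i != 0]%SET.

(** A total map onto the subtype, with the dummy value [x0] off the realization; hence continuity is
    stated within [X]. *)
Definition to_realization (a : 'rV[R]_n) : X := insubd x0 a.

Lemma to_realization_continuous : {within X, continuous to_realization}.
Proof.
apply/subspace_sigL_continuousP.
have -> : sigL X to_realization = id by apply/funext => a; exact: valKd.
by move=> a; exact: cvg_id.
Qed.

Lemma to_realizationK (a : 'rV[R]_n) : X a -> val (to_realization a) = a.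
Proof. by move=> Xa; apply: insubdK; exact: mem_set. Qed.

Lemma realization_val (a : X) : X (val a).
Proof. exact: set_mem (valP a). Qed.

Lemma support_realization (a : X) : vertex_support (val a) \in Y.
Proof. by case: (realization_val a). Qed.

Lemma support_gt0 (a : X) : (0 < #|vertex_support (val a)|)%N.
Proof.
have /forall_inP /(_ _ (support_realization a)) /andP[] // := subY.
Qed.

(** The closed face on [s]. Unlike the realization it is convex, so straight segments may be drawn
    in it. *)
Definition face_hull (s : {set 'I_n}) : set 'rV[R]_n :=
  [set a : 'rV[R]_n | [/\ forall i, 0 <= a ord0 i, \sum_(i < n) a ord0 i = 1 &
    vertex_support a \subset s]].

Lemma face_hullW (s t : {set 'I_n}) : s \subset t -> face_hull s `<=` face_hull t.
Proof. by move=> st a [? ? sa]; split => //; exact: fintype.subset_trans sa st. Qed.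

Lemma face_hull_realization s : s \in Y -> face_hull s `<=` X.
Proof.
move=> sY a [a0 a1 sa]; split => //; apply: subcomplex_face sa => //.
rewrite lt0n; apply/eqP => /cards0_eq sa0.
have : (1 : R) != 0 by apply: oner_neq0.
rewrite -a1 big1 ?eqxx// => i _; apply: contra_eq isT => ai.
by have := finset.in_set0 i; rewrite -sa0 inE ai.
Qed.

Lemma realization_face_hull (a : X) : face_hull (vertex_support (val a)) (val a).
Proof. by have [] := realization_val a. Qed.

Lemma convex_face_hull s : convex_subset (face_hull s).
Proof.
move=> a b t [a0 a1 sa] [b0 b1 sb] /mem_itv01 It; split.
- by move=> i; rewrite !mxE; have := a0 i; have := b0 i; nra.
- under eq_bigr do rewrite !mxE.
  by rewrite big_split/= -!mulr_sumr a1 b1; ring.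
- apply/fintype.subsetP => i; rewrite inE !mxE => ab.
  case: (boolP (i \in s)) => // nis.
  have ai : a ord0 i = 0.
    by apply/eqP; apply: contraNT nis => ai; apply: (fintype.subsetP sa); rewrite inE.
  have bi : b ord0 i = 0.
    by apply/eqP; apply: contraNT nis => bi; apply: (fintype.subsetP sb); rewrite inE.
  by move: ab; rewrite ai bi !mulr0 addr0 eqxx.
Qed.

Lemma lift_continuous (a b : 'rV[R]_n) (f : @pathIn R _ a b) :
  (forall t, I t -> X (f t)) ->
  {within I, continuous (fun t => to_realization (f t))}.
Proof.
move=> Xf; apply: (@within_comp _ _ _ _ X f to_realization) => //.
  exact: path_continuous.
exact: to_realization_continuous.
Qed.

Lemma to_realization_at0 (a b : X) (f : @pathIn R _ (val a) (val b)) :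
  to_realization (f 0) = a.
Proof. by rewrite path_at0; exact: valKd. Qed.

Lemma to_realization_at1 (a b : X) (f : @pathIn R _ (val a) (val b)) :
  to_realization (f 1) = b.
Proof. by rewrite path_at1; exact: valKd. Qed.

Definition lift_path (a b : X) (f : @pathIn R _ (val a) (val b))
    (Xf : forall t, I t -> X (f t)) : pathIn a b :=
  PathIn (lift_continuous Xf) (to_realization_at0 f) (to_realization_at1 f).

Definition common (a b : X) : {set 'I_n} :=
  (vertex_support (val a) :|: vertex_support (val b))%SET.

Lemma common_face (s : {set 'I_n}) (a b : X) : s \in Y ->
  vertex_support (val a) \subset s -> vertex_support (val b) \subset s -> common a b \in Y.
Proof.
move=> sY sa sb; apply: (subcomplex_face sY); last by rewrite finset.subUset sa.
apply: leq_trans (support_gt0 a) _; apply: subset_leq_card; exact: finset.subsetUl.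
Qed.

Lemma face_segment_in (a b : X) : common a b \in Y ->
  forall t, I t -> X (segment (val a) (val b) t).
Proof.
move=> abY; have abX := face_hull_realization abY.
move=> t It; apply: abX; apply: segment_in => //; first exact: convex_face_hull.
  by apply: (face_hullW _ (realization_face_hull a)); exact: finset.subsetUl.
by apply: (face_hullW _ (realization_face_hull b)); exact: finset.subsetUr.
Qed.

Definition face_segment (a b : X) (abY : common a b \in Y) : pathIn a b :=
  lift_path (face_segment_in abY).

Variable spoke : forall a : X, @pathIn R X x0 a.

(* [1] when [a] and [b] lie on no common simplex. *)
Definition transport (a b : X) : pi1 R x0 :=
  match @idP (common a b \in Y) with
  | ReflectT abY => holonomy spoke (face_segment abY)
  | ReflectF _ => 1%g
  end.

Lemma transport_segment (a b : X) (abY : common a b \in Y) :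
  transport a b = holonomy spoke (face_segment abY).
Proof.
rewrite /transport; case: {-}_ / idP => [abY'|//].
by rewrite (bool_irrelevance abY abY').
Qed.

(** The broken line and the direct segment lie in one closed face, which is convex, so they are
    homotopic. This makes transport along edges a cocycle on triangles. *)
Lemma transport_mul (s : {set 'I_n}) (a b c : X) : s \in Y ->
  vertex_support (val a) \subset s -> vertex_support (val b) \subset s ->
  vertex_support (val c) \subset s -> (transport a b * transport b c)%g = transport a c.
Proof.
move=> sY sa sb sc.
have cY (x y : X) := @common_face s x y sY.
have hs (x : X) : vertex_support (val x) \subset s -> face_hull s (val x).
  by move=> sx; exact: (face_hullW sx (realization_face_hull x)).
rewrite (transport_segment (cY _ _ sa sb)) (transport_segment (cY _ _ sb sc)).
rewrite (transport_segment (cY _ _ sa sc)) -holonomy_concat.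
apply: holonomy_homotopic.
apply: (@convex_homotopic _ _ _ (face_hull s) to_realization _ _ _ _ (val a) (val c)
  (concat_path (segment (val a) (val b)) (segment (val b) (val c)))
  (segment (val a) (val c))).
- exact: convex_face_hull.
- apply: continuous_subspaceW to_realization_continuous.
  exact: face_hull_realization.
- by apply: concat_path_in; apply: segment_in; try exact: convex_face_hull; exact: hs.
- by apply: segment_in; try exact: convex_face_hull; exact: hs.
- exact: concat_fun_comp.
- by [].
Qed.

Lemma transport_refl (a : X) : transport a a = 1%g.
Proof.
have := @transport_mul _ a a a (support_realization a) (subxx _) (subxx _) (subxx _).
by rewrite -{3}[transport a a]mulg1 => /mulgI.
Qed.

Lemma transport_inv (a b : X) : common a b \in Y ->
  transport b a = (transport a b)^-1%g.
Proof.
move=> abY; apply: (mulgI (transport a b)); rewrite mulgV.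
rewrite (@transport_mul (common a b)) ?transport_refl//.
all: rewrite /common ?finset.subsetUl ?finset.subsetUr//.
Qed.

Definition vertex_point (v : 'I_n) : X := to_realization (delta_mx ord0 v).

Lemma delta_face_hull (v : 'I_n) : face_hull [set v]%SET (delta_mx ord0 v).
Proof.
split.
- by move=> i; rewrite mxE.
- rewrite (bigD1 v)//= big1 => [|i iv]; rewrite mxE ?eqxx/= ?addr0//.
  by rewrite (negbTE iv).
- by apply/fintype.subsetP => i; rewrite !inE mxE eqxx/=; case: (i =P v) => //=; rewrite eqxx.
Qed.

Lemma vertex_pointE (v : 'I_n) : [set v]%SET \in Y ->
  val (vertex_point v) = delta_mx ord0 v.
Proof.
by move=> vY; apply: to_realizationK; exact: (face_hull_realization vY (delta_face_hull v)).
Qed.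

Lemma support_vertex_point (v : 'I_n) : [set v]%SET \in Y ->
  vertex_support (val (vertex_point v)) \subset [set v]%SET.
Proof. by move=> vY; rewrite vertex_pointE//; have [] := delta_face_hull v. Qed.

Lemma val_continuous : continuous (val : X -> 'rV[R]_n).
Proof. exact: initial_continuous. Qed.

Lemma support_set1 (a : X) (v : 'I_n) : v \in vertex_support (val a) -> [set v]%SET \in Y.
Proof.
move=> va; apply: (subcomplex_face (support_realization a)); rewrite ?cards1//.
by rewrite finset.sub1set.
Qed.

(** An open star need not be convex, so convexity is used in the parameter square instead: each
    point of the path slides straight to [v] inside its own carrier, which has [v] as a vertex. *)
Lemma star_homotopic (v : 'I_n) (b c : X) (p : @pathIn R X b c)
    (bvY : common b (vertex_point v) \in Y) (vcY : common (vertex_point v) c \in Y) :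
  (forall t, I t -> v \in vertex_support (val (p t))) ->
  path_homotopic p (concat_path (face_segment bvY)
    (concat_path (cst_path (vertex_point v)) (face_segment vcY))).
Proof.
move=> pv.
have I0 : I 0 by apply/mem_itv01; lra.
have I1 : I 1 by apply/mem_itv01; lra.
have vY := support_set1 (pv _ I0).
pose f (z : R * R) := (1 - z.2) *: val (p z.1) + z.2 *: (delta_mx ord0 v : 'rV[R]_n).
pose sq (x y z w : R) := @segment R (R^o * R^o)%type (x, y) (z, w).
have sqE x y z w t : sq x y z w t = ((1 - t) * x + t * z, (1 - t) * y + t * w) by [].
have convII : convex_subset (I `*` I : set (R^o * R^o)%type).
  move=> x y t [x1 x2] [y1 y2] It; split; exact: convex_unit_itv.
(* The bottom side of the square carries [p]; the other three sides carry the segment to [v], the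
   constant path at [v] and the segment from [v]. *)
apply: (@convex_homotopic _ _ (R^o * R^o)%type (I `*` I) (to_realization \o f)
  _ _ _ _ (0, 0) (1, 0) (sq 0 0 1 0)
  (concat_path (sq 0 0 0 1) (concat_path (sq 0 1 1 1) (sq 1 1 1 0)))).
- exact: convII.
- apply: (@within_comp _ _ _ (I `*` I) X f to_realization).
  + move=> z; apply: cvgD.
      apply: cvgZ.
        apply: cvgB; first exact: cvg_cst.
        exact: (continuous_subspaceT (@continuous_sndR R)).
      apply: (@within_comp _ _ _ (I `*` I) setT (fun z : R * R => p z.1) val) => //.
        apply: path_within; first exact/continuous_subspaceT/continuous_fstR.
        by move=> y [].
      exact/continuous_subspaceT/val_continuous.
    apply: cvgZ; last exact: cvg_cst.
    exact: (continuous_subspaceT (@continuous_sndR R)).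
  + exact: to_realization_continuous.
  + move=> z [z1 z2]; have := face_hull_realization (support_realization (p z.1)).
    apply; apply: convex_face_hull => //; first exact: realization_face_hull.
    by apply: face_hullW (delta_face_hull v); rewrite finset.sub1set pv.
- by apply: segment_in.
- by do ![apply: concat_path_in]; apply: segment_in.
- move=> t It; rewrite sqE /= /f /= !mulr0 addr0 add0r mulr1 subr0 scale1r scale0r addr0.
  by rewrite /to_realization valKd.
- apply: concat_fun_comp; last apply: concat_fun_comp.
  + move=> t It; rewrite sqE /= /f /= !mulr0 addr0 add0r mulr1 path_at0.
    by rewrite vertex_pointE.
  + move=> t It; rewrite sqE /= /f /= !mulr1 !mulr0 add0r subrK subrr scale0r scale1r.
    by rewrite add0r.
  + move=> t It; rewrite sqE /= /f /= !mulr1 !mulr0 addr0 subrK path_at1.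
    by rewrite vertex_pointE// subKr addrC.
Qed.

(** * From flat cochains on vertices to invariant vectors *)

Section FlatSection.
Variables (H : hilbertSpace R) (rho : unitaryRep (pi1 R x0) H) (f : 'I_n -> H).
Hypothesis flat_f : forall u v, [set u; v]%SET \in Y ->
  rho (transport (vertex_point u) (vertex_point v)) (f v) = f u.

(** Inside the carrier of [a] transports compose, so passing from [u] to [v] costs exactly the
    transport under which [f] is flat. *)
Lemma flat_support (a : X) (u v : 'I_n) :
  u \in vertex_support (val a) -> v \in vertex_support (val a) ->
  rho (transport a (vertex_point u)) (f u) = rho (transport a (vertex_point v)) (f v).
Proof.
move=> ua va.
have sY := support_realization a.
have vs w : w \in vertex_support (val a) -> vertex_support (val (vertex_point w)) \subset vertex_support (val a).
  move=> wa; apply: fintype.subset_trans (support_vertex_point (support_set1 wa)) _.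
  by rewrite finset.sub1set.
rewrite -(flat_f (u := u) (v := v)); last first.
  apply: (subcomplex_face sY); last by rewrite finset.subUset !finset.sub1set ua.
  by rewrite cards2; case: eqP.
by rewrite -repM (transport_mul sY) ?vs.
Qed.

Definition support_vertex (a : X) : 'I_n :=
  enum_val (cast_ord (erefl _) (Ordinal (support_gt0 a))).

Lemma support_vertexP (a : X) : support_vertex a \in vertex_support (val a).
Proof. exact: enum_valP. Qed.

(* The section [W] extends the flat cochain [f] from the vertices to all points;
   it is parallel within each open star, hence along every path. *)
Lemma flat_section_invariant :
  let w := rho (transport x0 (vertex_point (support_vertex x0))) (f (support_vertex x0)) in
  forall g, rho g w = w.
Proof.
pose W (a : X) := rho (transport a (vertex_point (support_vertex a))) (f (support_vertex a)).
move=> /= g; have [p <-] := holonomy_surjective spoke g.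
apply: (@flat_section_parallel _ _ _ spoke _ rho W) => a.
have va := support_vertexP a; set v := support_vertex a in va.
(* The open star of [v]: it is open because it is where one coordinate does not vanish. *)
exists [set b : X | v \in vertex_support (val b)].
  have /= : continuous (fun b : X => val b ord0 v).
    move=> b; apply: (@continuous_comp X 'rV[R]_n R val (fun M => M ord0 v)).
      exact: val_continuous.
    exact: coord_continuous.
  have -> : [set b : X | v \in vertex_support (val b)] =
      (fun b : X => val b ord0 v) @^-1` [set y | y != 0].
    by apply/seteqP; split=> b /=; rewrite inE.
  move=> /(_ a); apply; apply: open_nbhs_nbhs; split; first exact: open_neq.
  by move: va; rewrite inE.
move=> b c q /= qv.
have I0 : I 0 by apply/mem_itv01; lra.
have I1 : I 1 by apply/mem_itv01; lra.
have vb : v \in vertex_support (val b) by have := qv 0 I0; rewrite path_at0.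
have vc : v \in vertex_support (val c) by have := qv 1 I1; rewrite path_at1.
have cv (d : X) : v \in vertex_support (val d) ->
    [/\ common d (vertex_point v) \in Y & common (vertex_point v) d \in Y].
  move=> vd.
  have h : common d (vertex_point v) \in Y.
    apply: (subcomplex_face (support_realization d)).
      apply: leq_trans (support_gt0 d) _; apply: subset_leq_card; exact: finset.subsetUl.
    rewrite finset.subUset subxx/=.
    apply: fintype.subset_trans (support_vertex_point (support_set1 vd)) _.
    by rewrite finset.sub1set.
  by split => //; rewrite /common finset.setUC.
have [bv _] := cv b vb; have [_ vcY] := cv c vc.
rewrite (holonomy_homotopic spoke (star_homotopic bv vcY qv)) !holonomy_concat.
rewrite holonomy_cst mul1g -!transport_segment repM.
rewrite /W (flat_support (support_vertexP c) vc) -[rho (transport _ c) _]repM.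
have vY := support_set1 vc.
rewrite (@transport_mul (vertex_support (val c))) ?support_realization//; first last.
1,2: by apply: fintype.subset_trans (support_vertex_point vY) _; rewrite finset.sub1set.
by rewrite transport_refl rep1; apply: flat_support => //; exact: support_vertexP.
Qed.

End FlatSection.

Lemma realization_path_connected :
  (forall u v, [set u]%SET \in Y -> [set v]%SET \in Y ->
     exists m, [set u; m]%SET \in Y /\ [set m; v]%SET \in Y) ->
  forall a b : X, $|@pathIn R X a b|.
Proof.
move=> connY a b.
pose u := support_vertex a; pose v := support_vertex b.
have ua : u \in vertex_support (val a) := support_vertexP a.
have vb : v \in vertex_support (val b) := support_vertexP b.
have uY := support_set1 ua; have vY := support_set1 vb.
have [m [umY mvY]] := connY u v uY vY.
have mY : [set m]%SET \in Y.
  by apply: (subcomplex_face umY); rewrite ?cards1// finset.sub1set !inE eqxx orbT.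
have sv w (s : {set 'I_n}) : [set w]%SET \in Y -> w \in s ->
    vertex_support (val (vertex_point w)) \subset s.
  by move=> wY ws; apply: fintype.subset_trans (support_vertex_point wY) _; rewrite finset.sub1set.
have e1 := common_face (support_realization a) (subxx _) (sv u _ uY ua).
have e2 : common (vertex_point u) (vertex_point m) \in Y.
  by apply: (common_face umY); apply: sv => //; rewrite !inE eqxx ?orbT.
have e3 : common (vertex_point m) (vertex_point v) \in Y.
  by apply: (common_face mvY); apply: sv => //; rewrite !inE eqxx ?orbT.
have e4 := common_face (support_realization b) (sv v _ vY vb) (subxx _).
apply: squash; exact: (concat_path (face_segment e1) (concat_path (face_segment e2)
  (concat_path (face_segment e3) (face_segment e4)))).
Qed.

End Realization.

(** * Energy of twisted cochains *)

Section RealInner.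
Context {R : realType} (H : hilbertSpace R).
Local Open Scope complex_scope.
Implicit Types u v w : H.

(** Real parts turn [H] into a real inner product space with the same norm. Only energies are
    compared below, so real scalars suffice. *)
Definition rnorm v : R := complex.Re (`|v| : R[i]).
Definition rinner u v : R := complex.Re (inner H u v).

Lemma rnormE v : `|v| = (rnorm v)%:C.
Proof. by rewrite /rnorm RRe_real// ger0_real. Qed.

Lemma rnorm_ge0 v : 0 <= rnorm v.
Proof. by rewrite -ler0c -rnormE. Qed.

Lemma rnormD u v : rnorm (u + v) <= rnorm u + rnorm v.
Proof. by rewrite -lecR rmorphD/= -!rnormE ler_normD. Qed.

Lemma rnormN v : rnorm (- v) = rnorm v.
Proof. by rewrite /rnorm normrN. Qed.

Lemma rnormB u v : rnorm (u - v) = rnorm (v - u).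
Proof. by rewrite -rnormN opprB. Qed.

Lemma rnorm0 : rnorm 0 = 0.
Proof. by rewrite /rnorm normr0. Qed.

Lemma rnorm_eq0 v : rnorm v = 0 -> v = 0.
Proof. by move=> v0; apply/normr0_eq0; rewrite rnormE v0. Qed.

Lemma rinnerC u v : rinner u v = rinner v u.
Proof.
by rewrite /rinner hermC/= expr0 mul1r; case: (inner H v u).
Qed.

Lemma rinnerDl u v w : rinner (u + v) w = rinner u w + rinner v w.
Proof. by rewrite /rinner linearDl raddfD. Qed.

Lemma rinnerNl u w : rinner (- u) w = - rinner u w.
Proof. by rewrite /rinner linearNl raddfN. Qed.

Lemma rinnerZl (a : R) u v : rinner (a%:C *: u) v = a * rinner u v.
Proof.
rewrite /rinner linearZl_LR/=; case: (inner H u v) => x y /=.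
by rewrite mul0r subr0.
Qed.

Lemma rinnerBl u v w : rinner (u - v) w = rinner u w - rinner v w.
Proof. by rewrite rinnerDl rinnerNl. Qed.

Lemma rinnerDr u v w : rinner u (v + w) = rinner u v + rinner u w.
Proof. by rewrite rinnerC rinnerDl !(rinnerC u). Qed.

Lemma rinnerBr u v w : rinner u (v - w) = rinner u v - rinner u w.
Proof. by rewrite rinnerC rinnerBl !(rinnerC u). Qed.

Lemma rinnerZr (a : R) u v : rinner u (a%:C *: v) = a * rinner u v.
Proof. by rewrite rinnerC rinnerZl rinnerC. Qed.

Lemma rinner0l u : rinner 0 u = 0.
Proof. by rewrite -(subrr 0) rinnerBl subrr. Qed.

Lemma rinner_suml (J : Type) (r : seq J) (P : pred J) (F : J -> H) v :
  rinner (\sum_(i <- r | P i) F i) v = \sum_(i <- r | P i) rinner (F i) v.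
Proof.
by apply: (big_morph (fun u => rinner u v)) => [x y|]; rewrite ?rinnerDl ?rinner0l.
Qed.

Lemma rinner_sumr (J : Type) (r : seq J) (P : pred J) (F : J -> H) v :
  rinner v (\sum_(i <- r | P i) F i) = \sum_(i <- r | P i) rinner v (F i).
Proof. by rewrite rinnerC rinner_suml; apply: eq_bigr => i _; rewrite rinnerC. Qed.

Lemma rinner_norm v : rinner v v = rnorm v ^+ 2.
Proof. by rewrite /rinner innerE rnormE -rmorphXn. Qed.

Lemma rnorm_sqrB u v :
  rnorm (u - v) ^+ 2 = rnorm u ^+ 2 - 2 * rinner u v + rnorm v ^+ 2.
Proof.
by rewrite -!rinner_norm rinnerBl !rinnerBr (rinnerC v u); ring.
Qed.

Lemma rnorm_sqrD u v :
  rnorm (u + v) ^+ 2 = rnorm u ^+ 2 + 2 * rinner u v + rnorm v ^+ 2.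
Proof.
by rewrite -!rinner_norm rinnerDl !rinnerDr (rinnerC v u); ring.
Qed.

Lemma rnormZ (a : R) v : rnorm (a%:C *: v) = `|a| * rnorm v.
Proof.
apply/eqP; rewrite -(@eqrXn2 _ 2)// ?mulr_ge0 ?rnorm_ge0//.
by rewrite exprMn real_normK ?num_real// -!rinner_norm rinnerZl rinnerZr mulrA expr2.
Qed.

Lemma rinner_cauchy_schwarz (J : finType) (f g : J -> H) :
  (\sum_i rinner (f i) (g i)) ^+ 2 <=
  (\sum_i rnorm (f i) ^+ 2) * (\sum_i rnorm (g i) ^+ 2).
Proof.
set a := \sum_i rnorm (f i) ^+ 2; set b := \sum_i rnorm (g i) ^+ 2.
set c := \sum_i rinner (f i) (g i).
have a0 : 0 <= a by apply: sumr_ge0 => i _; exact: sqr_ge0.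
have b0 : 0 <= b by apply: sumr_ge0 => i _; exact: sqr_ge0.
(* Square norm of the combination [s f + t g]. The choice [s = - c], [t = a] gives
   [a (a b - c ^ 2) >= 0]; the two later choices settle the case [a = 0]. *)
have pos s t : 0 <= s ^+ 2 * a + 2 * s * t * c + t ^+ 2 * b.
  have -> : s ^+ 2 * a + 2 * s * t * c + t ^+ 2 * b =
      \sum_i rnorm (s%:C *: f i + t%:C *: g i) ^+ 2.
    rewrite !mulr_sumr -!big_split/=; apply: eq_bigr => i _.
    by rewrite rnorm_sqrD !rnormZ rinnerZl rinnerZr !exprMn !real_normK ?num_real//; ring.
  by apply: sumr_ge0 => i _; exact: sqr_ge0.
case: (ltrP 0 a) => [a_gt0|a_le0].
  rewrite -subr_ge0 -(pmulr_rge0 _ a_gt0); apply: le_trans (pos (- c) a) _.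
  by rewrite le_eqVlt; apply/orP; left; apply/eqP; ring.
have a_eq0 : a = 0 by lra.
case: (ltrP 0 b) => [b_gt0|b_le0].
  rewrite -subr_ge0 -(pmulr_rge0 _ b_gt0); apply: le_trans (pos b (- c)) _.
  by rewrite le_eqVlt; apply/orP; left; apply/eqP; ring.
have b_eq0 : b = 0 by lra.
by have := pos (- c) 1; rewrite a_eq0 b_eq0; lra.
Qed.

Lemma geometric_cauchy (s : nat -> H) (C r : R) : 0 <= C -> 0 <= r < 1 ->
  (forall t, rnorm (s t.+1 - s t) <= C * r ^+ t) ->
  exists l : H, forall t, rnorm (l - s t) <= C / (1 - r) * r ^+ t.
Proof.
move=> C0 /andP[r0 r1] sC.
have r1' : 0 < 1 - r by lra.
have part t k : rnorm (s (t + k)%N - s t) <= C / (1 - r) * r ^+ t.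
  (* The extra factor [1 - r ^+ k] is the partial sum of the geometric series; it makes the
     induction on [k] close. *)
  suff h : rnorm (s (t + k)%N - s t) <= C / (1 - r) * r ^+ t * (1 - r ^+ k).
    apply: (le_trans h); apply: ler_piMr.
      by rewrite mulr_ge0 ?exprn_ge0// divr_ge0// ltW.
    by rewrite lerBlDr lerDl exprn_ge0.
  elim: k => [|k IH]; first by rewrite addn0 subrr rnorm0 expr0 subrr mulr0.
  have -> : s (t + k.+1)%N - s t = (s (t + k.+1)%N - s (t + k)%N) + (s (t + k)%N - s t).
    by rewrite addrA subrK.
  apply: le_trans (rnormD _ _) _; apply: le_trans (lerD (lexx _) IH) _.
  rewrite addnS; apply: le_trans (lerD (sC _) (lexx _)) _.
  rewrite exprD exprS le_eqVlt; apply/orP; left; apply/eqP.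
  by field; rewrite gt_eqF.
have small (e : R) : 0 < e -> exists t, C / (1 - r) * r ^+ t < e.
  move=> e0.
  have : (C / (1 - r) * r ^+ t) @[t --> \oo] --> (0 : R).
    rewrite -[X in _ --> X](mulr0 (C / (1 - r))); apply: cvgMr.
    by apply: cvg_expr; rewrite ger0_norm.
  move=> /(_ [set x | x < e]) /=.
  case=> [|N _ /(_ N) h]; first exact: (lt_nbhsl (e0 : (0 : R) < e)).
  by exists N; apply: h => /=.
have cs : cvg (s @ \oo).
  apply/cauchy_cvgP; apply: cauchy_exP => e e0.
  have eE : e = (complex.Re e)%:C by rewrite RRe_real// gtr0_real.
  have [t te] : exists t, C / (1 - r) * r ^+ t < complex.Re e.
    by apply: small; rewrite -ltcR -eE.
  exists (s t), t => // m /= tm.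
  rewrite -ball_normE /=.
  rewrite eE rnormE ltcR rnormB -(subnKC tm); exact: le_lt_trans (part _ _) te.
exists (lim (s @ \oo)) => t.
apply/ler_addgt0Pr => e e0.
have eC : 0 < e%:C by rewrite ltcR.
have /cvg_ballP /(_ _ eC) [N _ hN] := cs.
have /= := hN (N + t)%N (leq_addr _ _).
rewrite -ball_normE /= rnormE ltcR => h.
have -> : lim (s @ \oo) - s t = (lim (s @ \oo) - s (N + t)%N) + (s (N + t)%N - s t).
  by rewrite addrA subrK.
apply: le_trans (rnormD _ _) _.
by have := part t N; rewrite addnC; lra.
Qed.

End RealInner.

(** Cauchy-Schwarz, from the nonnegativity of the sum of all [(F i - F j) ^ 2]; the crude factor
    [#|J|] is affordable. *)
Lemma sqr_sum_le (R : realFieldType) (J : finType) (P : pred J) (F : J -> R) :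
  (\sum_(i | P i) F i) ^+ 2 <= #|J|%:R * \sum_(i | P i) F i ^+ 2.
Proof.
pose k : R := \sum_(i | P i) 1.
have kJ : k <= #|J|%:R.
  by rewrite /k sumr_const ler_nat; exact: max_card.
set a := \sum_(i | P i) F i; set b := \sum_(i | P i) F i ^+ 2.
have b0 : 0 <= b by apply: sumr_ge0 => i _; exact: sqr_ge0.
have : 0 <= \sum_(i | P i) \sum_(j | P j) (F i - F j) ^+ 2.
  by do 2![apply: sumr_ge0 => ? _]; exact: sqr_ge0.
have -> : \sum_(i | P i) \sum_(j | P j) (F i - F j) ^+ 2 = 2 * (k * b - a ^+ 2).
  transitivity (\sum_(i | P i) (F i ^+ 2 * k - 2 * F i * a + b)).
    apply: eq_bigr => i _; rewrite /k /a /b !mulr_sumr -sumrN -!big_split/=.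
    by apply: eq_bigr => j _; ring.
  rewrite !big_split/= sumrN -!mulr_suml -mulr_sumr -/a -/b.
  have -> : \sum_(i | P i) b = k * b by rewrite /k mulr_suml; under [RHS]eq_bigr do rewrite mul1r.
  by ring.
by have : k * b <= #|J|%:R * b by [rewrite ler_wpM2r]; lra.
Qed.

(** * Garland's inequality and the gradient descent of the energy *)

Section Garland.
Context {R : realType} {V : finType} {G : groupType}.
Variables (A : rel V) (T : V -> V -> V -> bool) (e : V -> V -> G) (c eps q : R).
Hypothesis A_sym : symmetric A.
Hypothesis T12 : forall u v w, T u v w = T v u w.
Hypothesis T23 : forall u v w, T u v w = T u w v.
Hypothesis e_inv : forall u v, A u v -> e v u = (e u v)^-1%g.
Hypothesis e_mul : forall u v w, T u v w -> (e u v * e v w)%g = e u w.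
Hypothesis T_deg : forall v w, A v w -> c <= \sum_u (T u v w)%:R.
Hypothesis eps_c : 2 * eps < c.

Section Cochains.
Context (H : hilbertSpace R) (rho : unitaryRep G H).
Hypothesis T_spec : forall u (x : V -> H),
  \sum_v \sum_w (T u v w)%:R * rinner (x v) (x w) <=
  eps * (\sum_(v | A u v) rnorm (x v) ^+ 2) +
  q * rnorm (\sum_(v | A u v) x v) ^+ 2.

Lemma rinner_rep g u v : rinner (rho g u) (rho g v) = rinner u v.
Proof. by rewrite /rinner rep_inner. Qed.

Lemma rnorm_rep g v : rnorm (rho g v) = rnorm v.
Proof.
by apply/eqP; rewrite -(@eqrXn2 _ 2) ?rnorm_ge0// -!rinner_norm rinner_rep.
Qed.

Lemma repB g u v : rho g (u - v) = rho g u - rho g v.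
Proof. exact: linearB. Qed.

Lemma repZ g (a : R[i]) v : rho g (a *: v) = a *: rho g v.
Proof. exact: linearZ. Qed.

Lemma repV g v : rho g^-1%g (rho g v) = v.
Proof. by rewrite -repM mulVg rep1. Qed.

Implicit Types f h : V -> H.

Definition cobound f u v : H := f u - rho (e u v) (f v).
(** Each edge is counted in both orientations, so the gradient of the energy is four times
    [laplacian]. *)
Definition energy f : R := \sum_u \sum_(v | A u v) rnorm (cobound f u v) ^+ 2.
Definition laplacian f u : H := \sum_(v | A u v) cobound f u v.
Definition sqnorm f : R := \sum_u rnorm (f u) ^+ 2.

Lemma cobound_opp f u v : A u v -> cobound f v u = - rho (e v u) (cobound f u v).
Proof.
move=> uv; rewrite /cobound repB e_inv// repV.
by rewrite opprB.
Qed.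

Lemma cobound_triangle f u v w : T u v w ->
  cobound f u v - cobound f u w = - rho (e u v) (cobound f v w).
Proof.
move=> uvw; rewrite /cobound repB -repM e_mul//.
by rewrite opprB opprB [LHS]addrC addrA subrK.
Qed.

Lemma energy_ge0 f : 0 <= energy f.
Proof. by do 2![apply: sumr_ge0 => ? _]; exact: sqr_ge0. Qed.

(* [W] below sums [|d f|^2] over the edge opposite to [u] in the triangles at
   [u]; as [d f] is a cocycle it is also the sum over [u] of the Dirichlet forms
   of the restrictions of [d f] to the links. *)
Lemma garland f : (c - 2 * eps) * energy f <= 2 * q * sqnorm (laplacian f).
Proof.
pose phi := cobound f.
pose W := \sum_u \sum_v \sum_w (T u v w)%:R * rnorm (phi v w) ^+ 2.
have cW : c * energy f <= W.
  rewrite /W exchange_big/= mulr_sumr; apply: ler_sum => v _.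
  rewrite exchange_big/= mulr_sumr [leLHS]big_mkcond; apply: ler_sum => w _.
  rewrite -mulr_suml; case: ifP => vw; first by rewrite ler_wpM2r ?sqr_ge0 ?T_deg.
  by rewrite mulr_ge0 ?sqr_ge0// sumr_ge0.
have W1 : W = \sum_u \sum_v \sum_w (T u v w)%:R * rnorm (phi u v) ^+ 2.
  rewrite /W exchange_big/=; apply: eq_bigr => u _.
  rewrite exchange_big/=; apply: eq_bigr => v _; apply: eq_bigr => w _.
  by rewrite T12 T23.
have W2 : W = \sum_u \sum_v \sum_w (T u v w)%:R * rnorm (phi u w) ^+ 2.
  rewrite W1; apply: eq_bigr => u _; rewrite exchange_big/=.
  by apply: eq_bigr => v _; apply: eq_bigr => w _; rewrite T23.
pose Z := \sum_u \sum_v \sum_w (T u v w)%:R * rinner (phi u v) (phi u w).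
(* By the cocycle identity the edge opposite to [u] is, up to sign and a unitary, the difference of
   the two edges at [u]. Expanding the square gives [W = 2 Z]. *)
have W3 : W = W + W - 2 * Z.
  rewrite {2}W1 {2}W2 mulr_sumr -sumrN -!big_split; apply: eq_bigr => u _ /=.
  rewrite mulr_sumr -sumrN -!big_split; apply: eq_bigr => v _ /=.
  rewrite mulr_sumr -sumrN -!big_split; apply: eq_bigr => w _ /=.
  have [uvw|] := boolP (T u v w); last by rewrite !mul0r mulr0 subr0 addr0.
  rewrite !mul1r -[in LHS](rnorm_rep (e u v)) -rnormN -cobound_triangle// rnorm_sqrB.
  by rewrite /phi; ring.
(* [T_spec] is applied with [x] the coboundary at [u], whose sum over the neighbours is the
   Laplacian. Then [c E <= W = 2 Z] yields the claim, [E] being the energy. *)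
have Zle : Z <= eps * energy f + q * sqnorm (laplacian f).
  rewrite /Z /energy /sqnorm !mulr_sumr -big_split/=; apply: ler_sum => u _.
  exact: T_spec.
by lra.
Qed.

Lemma energy_step f (tau : R) :
  energy (fun u => f u - (tau)%:C%C *: laplacian f u) =
  energy f - 4 * tau * sqnorm (laplacian f) + tau ^+ 2 * energy (laplacian f).
Proof.
(* Polarization of the energy against [f]. Both orientations of an edge contribute equally, whence
   the factor 2 in [PE]. *)
pose P h := \sum_u \sum_(v | A u v) rinner (cobound f u v) (cobound h u v).
have PE h : P h = 2 * \sum_u rinner (laplacian f u) (h u).
  have -> : P h = \sum_u rinner (laplacian f u) (h u) +
      \sum_u \sum_(v | A u v) rinner (cobound f u v) (- rho (e u v) (h v)).
    rewrite -big_split/=; apply: eq_bigr => u _.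
    by rewrite rinner_suml -big_split/=; apply: eq_bigr => v _; rewrite -rinnerDr.
  suff -> : \sum_u \sum_(v | A u v) rinner (cobound f u v) (- rho (e u v) (h v)) =
    \sum_u rinner (laplacian f u) (h u) by ring.
  rewrite (exchange_big_dep xpredT)//=; apply: eq_bigr => u _.
  rewrite rinner_suml; apply: eq_big => [v|v vu]; first exact: A_sym.
  have uv : A u v by rewrite A_sym.
  by rewrite (cobound_opp f uv) rinnerNl rinnerC rinnerNl opprK rinner_rep rinnerC.
have -> : sqnorm (laplacian f) = P (laplacian f) / 2.
  rewrite PE /sqnorm mulrAC divff// mul1r.
  by apply: eq_bigr => u _; rewrite rinner_norm.
have -> : 4 * tau * (P (laplacian f) / 2) = 2 * tau * P (laplacian f) by field.
rewrite /P /energy !mulr_sumr -sumrN -!big_split/=.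
apply: eq_bigr => u _.
rewrite !mulr_sumr -sumrN -!big_split/=; apply: eq_bigr => v _.
have -> : cobound (fun u => f u - tau%:C%C *: laplacian f u) u v =
   cobound f u v - tau%:C%C *: cobound (laplacian f) u v.
  by rewrite /cobound repB repZ scalerBr !opprD !opprK addrACA.
rewrite rnorm_sqrB rinnerZr rnormZ exprMn real_normK ?num_real//.
by ring.
Qed.

Lemma rnorm_sum (J : finType) (P : pred J) (F : J -> H) :
  rnorm (\sum_(i | P i) F i) <= \sum_(i | P i) rnorm (F i).
Proof.
elim/big_ind2 : _ => [|x a y b xa yb|//]; first by rewrite rnorm0.
by apply: le_trans (rnormD _ _) _; exact: lerD.
Qed.

Lemma rnorm_sqrB_le (u v : H) : rnorm (u - v) ^+ 2 <= 2 * (rnorm u ^+ 2 + rnorm v ^+ 2).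
Proof.
have := sqr_ge0 (rnorm (u + v)); rewrite rnorm_sqrB rnorm_sqrD; lra.
Qed.

Let N : R := #|V|%:R.

Lemma energy_le f : energy f <= 4 * N * sqnorm f.
Proof.
apply: (@le_trans _ _ (\sum_u \sum_v 2 * (rnorm (f u) ^+ 2 + rnorm (f v) ^+ 2))).
  apply: ler_sum => u _; rewrite big_mkcond/=; apply: ler_sum => v _.
  case: ifP => _; last by rewrite mulr_ge0// addr_ge0 ?sqr_ge0.
  by rewrite -(rnorm_rep (e u v) (f v)) rnorm_sqrB_le.
have cstE (a : R) : \sum_(v : V) a = N * a by rewrite sumr_const /N mulr_natl.
under eq_bigr do rewrite -mulr_sumr big_split/= cstE.
rewrite -mulr_sumr big_split/= cstE -mulr_sumr -/(sqnorm f).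
by rewrite le_eqVlt; apply/orP; left; apply/eqP; ring.
Qed.

Lemma rnorm_laplacian_le f u : rnorm (laplacian f u) ^+ 2 <= N * energy f.
Proof.
apply: (@le_trans _ _ (N * \sum_(v | A u v) rnorm (cobound f u v) ^+ 2)).
  apply: le_trans (sqr_sum_le _ _).
  by rewrite ler_pXn2r ?nnegrE ?sumr_ge0 ?rnorm_ge0 ?rnorm_sum// => *; exact: rnorm_ge0.
rewrite ler_wpM2l ?/N// /energy [leRHS](bigD1 u)//= lerDl.
by do 2![apply: sumr_ge0 => ? _]; exact: sqr_ge0.
Qed.

End Cochains.

(** [N1] is positive even without vertices. [K] is the constant bounding the energy by the square
    norm of the Laplacian, raised to at least 1 so that [r] is the root of a nonnegative number;
    [r ^+ 2] is the decay factor of the energy in one step. *)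
Let N1 : R := #|V|%:R + 1.
Let K : R := Num.max 1 (2 * q / (c - 2 * eps)).
Let r : R := Num.sqrt (1 - (N1 * K)^-1).

(** Total length of the descent at a vertex for initial energy 1: a geometric series of ratio
    [r]. *)
Definition flow_constant : R := (2 * N1)^-1 * Num.sqrt N1 / (1 - r).

Let N1_ge1 : 1 <= N1. Proof. by rewrite /N1 lerDr. Qed.
Let K_ge1 : 1 <= K. Proof. by rewrite /K le_max lexx. Qed.
Let NK_ge1 : 1 <= N1 * K. Proof. by have := N1_ge1; have := K_ge1; nra. Qed.

Let NK_inv : 0 < (N1 * K)^-1 <= 1.
Proof.
rewrite invr_gt0 (lt_le_trans ltr01 NK_ge1)/=.
by rewrite invf_le1// (lt_le_trans ltr01 NK_ge1).
Qed.

Let r01 : 0 <= r < 1.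
Proof.
have /andP[h0 h1] := NK_inv.
rewrite sqrtr_ge0/= -sqrtr1 ltr_sqrt//; lra.
Qed.

Lemma flow_constant_gt0 : 0 < flow_constant.
Proof.
have /andP[_ r1] := r01; have := N1_ge1 => h.
rewrite /flow_constant divr_gt0 ?subr_gt0// mulr_gt0 ?sqrtr_gt0 ?invr_gt0//; lra.
Qed.

(* Gradient descent for the energy: by Garland's estimate the energy decays
   geometrically, so the iterates converge, and the limit has no energy. *)
Lemma flat_limit (H : hilbertSpace R) (rho : unitaryRep G H) :
  (forall u (x : V -> H),
    \sum_v \sum_w (T u v w)%:R * rinner (x v) (x w) <=
    eps * (\sum_(v | A u v) rnorm (x v) ^+ 2) +
    q * rnorm (\sum_(v | A u v) x v) ^+ 2) ->
  forall f0 : V -> H, exists f : V -> H,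
    (forall u v, A u v -> rho (e u v) (f v) = f u) /\
    forall u, rnorm (f u - f0 u) <= flow_constant * Num.sqrt (energy rho f0).
Proof.
move=> T_spec f0.
have N1_gt0 : 0 < N1 := lt_le_trans ltr01 N1_ge1.
have K_gt0 : 0 < K := lt_le_trans ltr01 K_ge1.
have /andP[r_ge0 r_lt1] := r01.
(* After one step the Laplacian term has coefficient at most [4 * N1 * tau ^+ 2 - 4 * tau]; this
   [tau] minimizes it, with value [- 1 / N1]. *)
pose tau := (2 * N1)^-1.
pose step (f : V -> H) u := f u - tau%:C%C *: laplacian rho f u.
pose F t := iter t step f0.
have tau_ge0 : 0 <= tau by rewrite invr_ge0; lra.
have E_K f : energy rho f <= K * sqnorm (laplacian rho f).
  have D0 : 0 <= sqnorm (laplacian rho f) by apply: sumr_ge0 => u _; exact: sqr_ge0.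
  have cpos : 0 < c - 2 * eps by rewrite subr_gt0.
  apply: (@le_trans _ _ (2 * q / (c - 2 * eps) * sqnorm (laplacian rho f))).
    by rewrite mulrAC ler_pdivlMr// mulrC; exact: garland T_spec f.
  by rewrite ler_wpM2r// /K le_max lexx orbT.
have decay f : energy rho (step f) <= r ^+ 2 * energy rho f.
  have D0 : 0 <= sqnorm (laplacian rho f) by apply: sumr_ge0 => u _; exact: sqr_ge0.
  rewrite energy_step.
  have h1 : tau ^+ 2 * energy rho (laplacian rho f) <=
      tau ^+ 2 * (4 * N1 * sqnorm (laplacian rho f)).
    rewrite ler_wpM2l ?sqr_ge0//; apply: le_trans (energy_le rho _) _.
    by rewrite ler_wpM2r// ler_wpM2l// /N1 lerDl.
  have h2 : tau ^+ 2 * (4 * N1 * sqnorm (laplacian rho f)) =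
      2 * tau * sqnorm (laplacian rho f).
    by rewrite /tau; field; rewrite gt_eqF.
  have h3 : 2 * tau * sqnorm (laplacian rho f) = sqnorm (laplacian rho f) / N1.
    by rewrite /tau; field; rewrite gt_eqF.
  have h4 : (N1 * K)^-1 * energy rho f <= sqnorm (laplacian rho f) / N1.
    have -> : sqnorm (laplacian rho f) / N1 =
        (N1 * K)^-1 * (K * sqnorm (laplacian rho f)).
      by field; rewrite !gt_eqF.
    by rewrite ler_wpM2l// invr_ge0 mulr_ge0 ?ltW.
  rewrite sqr_sqrtr; last by have /andP[] := NK_inv; lra.
  lra.
have decayN t : energy rho (F t) <= (r ^+ t * Num.sqrt (energy rho f0)) ^+ 2.
  elim: t => [|t IH]; first by rewrite expr0 mul1r sqr_sqrtr ?energy_ge0.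
  rewrite [r ^+ _]exprS -mulrA [leRHS]exprMn; apply: le_trans (decay _) _.
  by rewrite ler_wpM2l ?sqr_ge0.
have diff t u : rnorm (F t.+1 u - F t u) <=
    tau * Num.sqrt N1 * Num.sqrt (energy rho f0) * r ^+ t.
  have -> : F t.+1 u - F t u = - (tau%:C%C *: laplacian rho (F t) u).
    by rewrite /F iterS /step addrAC subrr add0r.
  rewrite rnormN rnormZ ger0_norm// -!mulrA ler_wpM2l//.
  rewrite -ler_sqr ?nnegrE ?rnorm_ge0 ?mulr_ge0 ?sqrtr_ge0 ?exprn_ge0//.
  apply: le_trans (rnorm_laplacian_le rho _ _) _.
  rewrite exprMn sqr_sqrtr ?(ltW N1_gt0)//.
  apply: ler_pM => //; first exact: energy_ge0.
    by rewrite /N1 lerDl.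
  by rewrite mulrC; exact: decayN.
pose C := tau * Num.sqrt N1 * Num.sqrt (energy rho f0).
have C_ge0 : 0 <= C by rewrite !mulr_ge0 ?sqrtr_ge0.
have lims u : exists l : H, forall t, rnorm (l - F t u) <= C / (1 - r) * r ^+ t.
  by apply: geometric_cauchy => // t; exact: diff.
have [f fP] := choice lims.
exists f; split => [u v uv|u]; last first.
  have := fP u 0; rewrite expr0 mulr1 => /le_trans; apply.
  by rewrite /C /flow_constant -/tau le_eqVlt; apply/orP; left; apply/eqP; ring.
apply/esym/eqP; rewrite -subr_eq0; apply/eqP/rnorm_eq0.
pose C' := 2 * (C / (1 - r)) + Num.sqrt (energy rho f0).
have C'_ge0 : 0 <= C'.
  by rewrite addr_ge0 ?sqrtr_ge0// mulr_ge0// divr_ge0// subr_ge0 ltW.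
(* The coboundary of the limit is compared with that of the iterate [F t], for every [t]; all three
   errors decay like [r ^+ t]. *)
have small t : rnorm (f u - rho (e u v) (f v)) <= C' * r ^+ t.
  have -> : f u - rho (e u v) (f v) = (f u - F t u) + cobound rho (F t) u v
      + rho (e u v) (F t v - f v).
    by rewrite repB /cobound !addrA subrK subrK.
  apply: le_trans (rnormD _ _) _; rewrite rnorm_rep rnormB.
  apply: (@le_trans _ _ (rnorm (f u - F t u) + rnorm (cobound rho (F t) u v)
     + rnorm (f v - F t v))); first by rewrite lerD2r rnormD.
  have h1 := fP u t; have h2 := fP v t.
  have h3 : rnorm (cobound rho (F t) u v) <= r ^+ t * Num.sqrt (energy rho f0).
    rewrite -ler_sqr ?nnegrE ?rnorm_ge0 ?mulr_ge0 ?sqrtr_ge0 ?exprn_ge0//.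
    apply: le_trans (decayN t); rewrite /energy (bigD1 u)//= (bigD1 v)//= -addrA lerDl.
    by rewrite addr_ge0// ?sumr_ge0// => *; rewrite ?sumr_ge0// => *; exact: sqr_ge0.
  by rewrite /C'; lra.
apply/eqP; rewrite eq_le rnorm_ge0 andbT; apply/ler_addgt0Pr => d d0; rewrite add0r.
have : (C' * r ^+ t) @[t --> \oo] --> (0 : R).
  rewrite -[X in _ --> X](mulr0 C'); apply: cvgMr.
  by apply: cvg_expr; rewrite ger0_norm.
move=> /(_ [set x | x < d]) [|M _ /(_ M (leqnn _)) /= h].
  exact: (lt_nbhsl (d0 : (0 : R) < d)).
exact: le_trans (small M) (ltW h).
Qed.

End Garland.

(** * Property (T) from the links of a complex *)

Section Criterion.
Context {R : realType} {n : nat} (Y : {set {set 'I_n}}).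

(** [[set u; v]] degenerates to a vertex when [u = v], hence the explicit inequality here and in
    [triangle]. *)
Definition skeleton_edge : rel 'I_n := fun u v => (u != v) && ([set u; v]%SET \in Y).

Definition triangle (u v w : 'I_n) : bool :=
  [&& u != v, u != w, v != w & [set u; v; w]%SET \in Y].

Lemma skeleton_edge_sym : symmetric skeleton_edge.
Proof. by move=> u v; rewrite /skeleton_edge eq_sym finset.setUC. Qed.

Lemma triangle_swap12 u v w : triangle u v w = triangle v u w.
Proof.
rewrite /triangle [v == u]eq_sym (finset.setUC [set v]).
by congr (_ && _); rewrite andbCA.
Qed.

Lemma triangle_swap23 u v w : triangle u v w = triangle u w v.
Proof.
by rewrite /triangle [w == v]eq_sym -!finset.setUA (finset.setUC [set v]) andbCA.
Qed.

Hypothesis subY : is_subcomplex Y.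
Hypothesis connY : forall u v, [set u]%SET \in Y -> [set v]%SET \in Y ->
  exists m, [set u; m]%SET \in Y /\ [set m; v]%SET \in Y.

Lemma triangle_edge u v w : triangle u v w -> skeleton_edge u v.
Proof.
case/and4P => uv _ _ uvw; rewrite /skeleton_edge uv/=.
apply: (subcomplex_face subY uvw); first by rewrite cards2.
exact: finset.subsetUl.
Qed.

Variables (c eps q : R).
Hypothesis deg_Y : forall v w, skeleton_edge v w -> c <= \sum_u (triangle u v w)%:R.
Hypothesis eps_c : 2 * eps < c.
Hypothesis spec_Y : forall (H : hilbertSpace R) u (x : 'I_n -> H),
    \sum_v \sum_w (triangle u v w)%:R * rinner (x v) (x w) <=
    eps * (\sum_(v | skeleton_edge u v) rnorm (x v) ^+ 2) +
    q * rnorm (\sum_(v | skeleton_edge u v) x v) ^+ 2.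

(** The Kazhdan set consists of the transports between vertices. The tolerance makes the descent
    move an almost invariant vector by less than its norm, so the flat limit vanishes nowhere. *)
Theorem property_T_of_links (x0 : realization R Y) : property_T R (pi1 R x0).
Proof.
pose spoke (a : realization R Y) : @pathIn R _ x0 a :=
  unsquash (realization_path_connected subY x0 connY x0 a).
pose pt v : realization R Y := vertex_point x0 v.
pose e u v : pi1 R x0 := transport subY spoke (pt u) (pt v).
have supp_pt u (s : {set 'I_n}) : s \in Y -> u \in s -> vertex_support (val (pt u)) \subset s.
  move=> sY us.
  have uY : [set u]%SET \in Y.
    by apply: (subcomplex_face subY sY); rewrite ?cards1 ?finset.sub1set.
  apply: fintype.subset_trans (support_vertex_point subY x0 uY) _.
  by rewrite finset.sub1set.
have e_inv u v : skeleton_edge u v -> e v u = (e u v)^-1%g.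
  case/andP => uv uvY; apply: transport_inv; apply: (common_face subY uvY).
    by apply: supp_pt => //; rewrite !inE eqxx.
  by apply: supp_pt => //; rewrite !inE eqxx orbT.
have e_mul u v w : triangle u v w -> (e u v * e v w)%g = e u w.
  case/and4P => _ _ _ uvw; apply: (transport_mul _ _ uvw).
  - by apply: supp_pt => //; rewrite !inE eqxx.
  - by apply: supp_pt => //; rewrite !inE eqxx orbT.
  - by apply: supp_pt => //; rewrite !inE eqxx orbT.
pose L := @flow_constant R 'I_n c eps q.
have L_gt0 : 0 < L by exact: flow_constant_gt0.
(* The energy root is at most [n * d] times the norm of [xi]; taking [n.+1] here keeps the
   displacement strictly below that norm. *)
pose d : R := (L * n.+1%:R)^-1.
have d_gt0 : 0 < d by rewrite invr_gt0 mulr_gt0.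
exists [seq e uv.1 uv.2 | uv : 'I_n * 'I_n], d; split => // H rho [xi xi_neq0 xiP].
have xi_gt0 : 0 < rnorm xi.
  by rewrite lt_neqAle rnorm_ge0 andbT eq_sym; apply: contra xi_neq0 => /eqP/rnorm_eq0 ->.
have xi_e u v : rnorm (xi - rho (e u v) xi) <= d * rnorm xi.
  rewrite rnormB -lecR rmorphM/= -!rnormE; apply/ltW/xiP.
  by apply/mapP; exists (u, v); rewrite ?mem_enum.
have [f [flat_f close_f]] := flat_limit skeleton_edge_sym triangle_swap12 triangle_swap23
  e_inv e_mul deg_Y eps_c rho (spec_Y (H := H)) (fun=> xi).
have E_le : Num.sqrt (energy skeleton_edge e rho (fun=> xi)) <= n%:R * (d * rnorm xi).
  have h0 : 0 <= d * rnorm xi by rewrite mulr_ge0 ?rnorm_ge0// ltW.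
  apply: (@le_trans _ _ (Num.sqrt ((n%:R * (d * rnorm xi)) ^+ 2))); last first.
    by rewrite sqrtr_sqr ger0_norm// mulr_ge0.
  rewrite ler_sqrt ?sqr_ge0// /energy.
  apply: (@le_trans _ _ (\sum_(u < n) \sum_(v < n) (d * rnorm xi) ^+ 2)).
    apply: ler_sum => u _; rewrite big_mkcond; apply: ler_sum => v _.
    case: ifP => _; last exact: sqr_ge0.
    by rewrite ler_sqr ?nnegrE ?rnorm_ge0//; exact: xi_e.
  by rewrite !sumr_const !card_ord -mulrnA -[leLHS]mulr_natl natrM [leRHS]exprMn expr2.
have f_neq0 u : f u != 0.
  apply/eqP => fu0; have := close_f u; rewrite fu0 rnormB subr0 leNgt => /negP; apply.
  apply: le_lt_trans (ler_wpM2l (ltW L_gt0) E_le) _.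
  have -> : L * (n%:R * (d * rnorm xi)) = n%:R / n.+1%:R * rnorm xi.
    have : n.+1%:R != 0 :> R by rewrite pnatr_eq0.
    by rewrite /d; move: n.+1%:R => m m0; field; rewrite m0 gt_eqF.
  by rewrite -[ltRHS]mul1r ltr_pM2r// ltr_pdivrMr// mul1r ltr_nat.
(* [flat_section_invariant] also asks for flatness on degenerate edges [u = v], where the transport
   is trivial. *)
have flat_f' u v : [set u; v]%SET \in Y -> rho (e u v) (f v) = f u.
  move=> uv; have [<-|u_neq_v] := eqVneq u v; last by apply: flat_f; rewrite /skeleton_edge u_neq_v.
  by rewrite /e transport_refl rep1.
exists (rho (transport subY spoke x0 (pt (support_vertex subY x0)))
  (f (support_vertex subY x0))).
  apply: contra (f_neq0 (support_vertex subY x0)) => /eqP h.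
  by rewrite -(repV rho (transport subY spoke x0 (pt (support_vertex subY x0)))
    (f _)) h raddf0.
exact: flat_section_invariant flat_f'.
Qed.

End Criterion.

(** * The random complex as a product measure *)

Section RandomSubset.
Context {R : realType} {T : finType} (P : T -> R).

Definition selection_weight (w : {ffun T -> bool}) : R :=
  \prod_x (if w x then P x else 1 - P x).

Definition expect (F : {ffun T -> bool} -> R) : R :=
  \sum_w selection_weight w * F w.

Lemma expect_sum (J : Type) (s : seq J) (Q : pred J) (F : J -> {ffun T -> bool} -> R) :
  expect (fun w => \sum_(j <- s | Q j) F j w) = \sum_(j <- s | Q j) expect (F j).
Proof. by rewrite /expect exchange_big; apply: eq_bigr => w _; rewrite mulr_sumr. Qed.

Lemma expectD F G : expect (fun w => F w + G w) = expect F + expect G.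
Proof. by rewrite /expect -big_split; apply: eq_bigr => w _; rewrite mulrDr. Qed.

Lemma expectZ (a : R) F : expect (fun w => a * F w) = a * expect F.
Proof. by rewrite /expect mulr_sumr; apply: eq_bigr => w _; rewrite mulrCA. Qed.

Lemma expect_ext F G : F =1 G -> expect F = expect G.
Proof. by move=> FG; apply: eq_bigr => w _; rewrite FG. Qed.

Lemma expect_prod (h : T -> bool -> R) :
  expect (fun w => \prod_x h x (w x)) =
  \prod_x (P x * h x true + (1 - P x) * h x false).
Proof.
pose g x (b : bool) := (if b then P x else 1 - P x) * h x b.
transitivity (\prod_x \sum_b g x b); last by apply: eq_bigr => x _; rewrite big_bool.
rewrite bigA_distr_bigA; apply: eq_bigr => w _.
by rewrite /selection_weight -big_split.
Qed.

Lemma expect_monomial (A : {set T}) :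
  expect (fun w => \prod_(x in A) (w x)%:R) = \prod_(x in A) P x.
Proof.
transitivity (expect (fun w => \prod_x (if x \in A then (w x)%:R else 1))).
  by apply: expect_ext => w; rewrite big_mkcond.
rewrite (expect_prod (fun x (b : bool) => if x \in A then b%:R else 1)) [RHS]big_mkcond.
by apply: eq_bigr => x _; case: ifP => _ /=; rewrite !mulr1 ?mulr0; ring.
Qed.

Lemma expect_cst (a : R) : expect (fun=> a) = a.
Proof.
rewrite -[RHS]mulr1 -[RHS]/(a * 1).
have -> : (1 : R) = \prod_(x in finset.set0) P x by rewrite big_set0.
rewrite -expect_monomial -expectZ; apply: expect_ext => w.
by rewrite big_set0 mulr1.
Qed.

(** Induction on [s]: expanding the first factor either drops it or adds its block to [A]. The set
    [A] is present to make this induction possible, and disjointness lets the two monomials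
    merge. *)
Lemma expect_blocks_monomial (J : eqType) (s : seq J) (B : J -> {set T}) (a c : J -> R)
    (A : {set T}) : uniq s ->
  (forall j k x, j \in s -> k \in s -> x \in B j -> x \in B k -> j = k) ->
  (forall j x, j \in s -> x \in B j -> x \notin A) ->
  expect (fun w => (\prod_(j <- s) (a j + c j * \prod_(x in B j) (w x)%:R)) *
    \prod_(x in A) (w x)%:R) =
  (\prod_(j <- s) (a j + c j * \prod_(x in B j) P x)) * \prod_(x in A) P x.
Proof.
elim: s A => [|j s IH] A /=.
  by move=> _ _ _; rewrite big_nil mul1r -expect_monomial; apply: expect_ext => w; rewrite big_nil mul1r.
move=> /andP[js us] dB dA.
have prodU (f : T -> R) : (\prod_(x in B j) f x) * \prod_(x in A) f x =
    \prod_(x in (B j :|: A)%SET) f x.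
  have dx x : x \in B j -> x \notin A by apply: dA; rewrite mem_head.
  rewrite [RHS](big_setID (B j))/=; congr (_ * _); apply: eq_bigl => x; rewrite !inE.
    by case: (x \in B j); rewrite ?andbF.
  by case: (boolP (x \in B j)) => //= /dx/negbTE.
transitivity (a j * expect (fun w => (\prod_(k <- s) (a k + c k * \prod_(x in B k) (w x)%:R)) *
    \prod_(x in A) (w x)%:R) +
  c j * expect (fun w => (\prod_(k <- s) (a k + c k * \prod_(x in B k) (w x)%:R)) *
    \prod_(x in (B j :|: A)%SET) (w x)%:R)).
  rewrite -!expectZ -expectD; apply: expect_ext => w.
  by rewrite big_cons -prodU; ring.
rewrite !IH//; first by rewrite big_cons -prodU; ring.
- by move=> k l x ks ls; apply: dB; rewrite inE ?ks ?ls orbT.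
- move=> k x ks xk; rewrite inE negb_or (dA k) ?inE ?ks ?orbT// andbT.
  apply: contraNN js => xj; suff -> : j = k by [].
  by apply: (dB j k x); rewrite ?mem_head ?inE ?ks ?orbT.
- by move=> k l x ks ls; apply: dB; rewrite inE ?ks ?ls orbT.
- by move=> k x ks; apply: dA; rewrite inE ks orbT.
Qed.

(** Independence over disjoint blocks. Affine factors are general enough, since every function of a
    0-1 variable is affine. *)
Lemma expect_blocks (J : finType) (D : {set J}) (B : J -> {set T}) (a c : J -> R) :
  (forall j k x, j \in D -> k \in D -> x \in B j -> x \in B k -> j = k) ->
  expect (fun w => \prod_(j in D) (a j + c j * \prod_(x in B j) (w x)%:R)) =
  \prod_(j in D) (a j + c j * \prod_(x in B j) P x).
Proof.
move=> dB.
have := @expect_blocks_monomial _ (enum D) B a c finset.set0 (enum_uniq _).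
rewrite big_set0 mulr1 -big_enum/= => <-.
- by apply: expect_ext => w; rewrite big_set0 mulr1 -big_enum.
- by move=> j k x; rewrite !mem_enum; exact: dB.
- by move=> j x _ _; rewrite finset.in_set0.
Qed.

Hypothesis P01 : forall x, 0 <= P x <= 1.

Lemma selection_weight_ge0 w : 0 <= selection_weight w.
Proof. by apply: prodr_ge0 => x _; have := P01 x; case: ifP => _; lra. Qed.

(** Markov's inequality at level 1, for a penalty [F] that is at least 1 on every bad selection. *)
Lemma expect_ge1 (F : {ffun T -> bool} -> R) (bad : pred {ffun T -> bool}) :
  (forall w, 0 <= F w) -> (forall w, bad w -> 1 <= F w) ->
  \sum_(w | bad w) selection_weight w <= expect F.
Proof.
move=> F0 F1; rewrite big_mkcond; apply: ler_sum => w _; case: ifP => [bw|_].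
  by rewrite ler_peMr ?selection_weight_ge0 ?F1.
by rewrite mulr_ge0 ?selection_weight_ge0.
Qed.

End RandomSubset.

Section RandomComplexes.
Context {R : realType} (r n : nat) (p : 'I_r.+1 -> R).

Implicit Types w : {ffun {set 'I_n} -> bool}.

(* Only the values on nonempty simplexes of dimension at most [r] matter: the
   other coordinates of a selection do not affect [selected_complex]. *)
Definition simplex_prob (s : {set 'I_n}) : R := p (inord #|s|.-1).

Definition selected_complex w : {set {set 'I_n}} :=
  [set s : {set 'I_n} | (0 < #|s| <= r.+1)%N &&
     [forall t : {set 'I_n}, (0 < #|t|)%N && (t \subset s) ==> w t]]%SET.

Lemma selected_complexP w (s : {set 'I_n}) : reflect
  ((0 < #|s| <= r.+1)%N /\ forall t : {set 'I_n}, (0 < #|t|)%N -> t \subset s -> w t)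
  (s \in selected_complex w).
Proof.
rewrite inE; apply: (iffP andP) => -[s_r sw]; split => //.
  by move=> t t0 ts; have /forallP/(_ t)/implyP := sw; apply; rewrite t0.
by apply/forallP => t; apply/implyP => /andP[]; exact: sw.
Qed.

Lemma selected_complex_sub w : is_subcomplex (selected_complex w).
Proof.
apply/forall_inP => s /selected_complexP[/andP[s0 sr] sw]; rewrite s0/=.
apply/forallP => t; apply/implyP => /andP[t0 ts]; apply/selected_complexP.
rewrite t0 (leq_trans (subset_leq_card ts))//; split => // u u0 ut.
by apply: sw => //; exact: fintype.subset_trans ts.
Qed.

Lemma selected_complex_Omega w : selected_complex w \in Omega r n.
Proof.
rewrite inE selected_complex_sub; apply/forall_inP => s.
by case/selected_complexP => /andP[].
Qed.

Definition external (Y : {set {set 'I_n}}) : {set {set 'I_n}} :=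
  [set s : {set 'I_n} | [&& (0 < #|s| <= r.+1)%N, s \notin Y &
     [forall t : {set 'I_n}, (0 < #|t|)%N && (t \proper s) ==> (t \in Y)]]]%SET.

(** A minimal simplex of the selected complex outside [Y] would be external to [Y]. So only the
    simplexes of [Y] and its external faces constrain the selection, which explains the two families
    of exponents in the measure. *)
Lemma selected_complex_eq (Y : {set {set 'I_n}}) w : Y \in Omega r n ->
  (selected_complex w == Y) =
  [forall s, if s \in Y then w s else if s \in external Y then ~~ w s else true].
Proof.
rewrite inE => /andP[subY /forall_inP dimY].
apply/eqP/forallP => [<- s|wY].
  case: ifPn => [/selected_complexP[/andP[s0 _]]|sY]; first by apply; rewrite ?subxx.
  case: ifP => //; rewrite inE => /and3P[s_r _ /forallP sP].
  apply: contra sY => ws; apply/selected_complexP; split => // t t0.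
  rewrite subEproper => /orP[/eqP -> //|ts].
  have /implyP := sP t; rewrite t0 => /(_ ts) /selected_complexP[_]; exact.
apply/eqP; rewrite finset.eqEsubset; apply/andP; split; apply/fintype.subsetP => s.
  have [m] := ubnP #|s|; elim: m => // m IH in s *; rewrite ltnS => sm sw.
  have /selected_complexP[s_r wt] := sw.
  case: (boolP (s \in Y)) => // sY.
  have sE : s \in external Y.
    rewrite inE s_r sY/=; apply/forallP => t; apply/implyP => /andP[t0 ts].
    apply: IH; first exact: leq_trans (proper_card ts) sm.
    have /forall_inP /(_ _ sw) /andP[_ /forallP /(_ t)] := selected_complex_sub w.
    by rewrite t0 proper_sub.
  have := wY s; rewrite (negbTE sY) sE wt//.
  by case/andP: s_r.
move=> sY; have /forall_inP /(_ _ sY) /andP[s0 /forallP sub_s] := subY.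
apply/selected_complexP; rewrite s0 dimY//; split => // t t0 ts.
by have /implyP := sub_s t; rewrite t0 => /(_ ts) tY; have := wY t; rewrite tY.
Qed.

Lemma prod_by_dim (A : {set {set 'I_n}}) (h : 'I_r.+1 -> R) :
  (forall s, s \in A -> (0 < #|s| <= r.+1)%N) ->
  \prod_(s in A) h (inord #|s|.-1) =
  \prod_(i < r.+1) h i ^+ #|[set s in A | #|s| == i.+1]%SET|.
Proof.
move=> dimA; rewrite (partition_big (fun s : {set 'I_n} => inord #|s|.-1 : 'I_r.+1) xpredT)//=.
apply: eq_bigr => i _.
rewrite (eq_bigr (fun=> h i)) => [|s /andP[_ /eqP ->]//].
rewrite prodr_const; congr (_ ^+ _); apply: eq_card => s; rewrite !inE.
apply: andb_id2l => sA; have /andP[s0 sr] := dimA s sA.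
rewrite -val_eqE/= inordK; last by rewrite prednK.
by rewrite -{2}(prednK s0) eqSS.
Qed.

(** The indicator of a fiber is a product over simplexes, so its expectation factors; each
    unconstrained simplex contributes [P + (1 - P) = 1]. *)
Lemma selection_weight_fiber (Y : {set {set 'I_n}}) : Y \in Omega r n ->
  \sum_(w | selected_complex w == Y) selection_weight simplex_prob w =
  complex_weight p Y.
Proof.
move=> YO; have := YO; rewrite inE => /andP[subY /forall_inP dimY].
pose chi (s : {set 'I_n}) (b : bool) : R :=
  (if s \in Y then b else if s \in external Y then ~~ b else true)%:R.
transitivity (expect simplex_prob (fun w => \prod_s chi s (w s))).
  rewrite big_mkcond; apply: eq_bigr => w _; rewrite selected_complex_eq//.
  case: ifP => [/forallP wP|].
    by rewrite big1 ?mulr1// => s _; rewrite /chi wP.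
  move=> /negbT; rewrite negb_forall => /existsP[s ws].
  by rewrite (bigD1 s)//= {1}/chi (negbTE ws) mul0r mulr0.
rewrite expect_prod.
transitivity ((\prod_(s in Y) simplex_prob s) * \prod_(s in external Y) (1 - simplex_prob s)).
  rewrite [X in _ = X * _]big_mkcond [X in _ = _ * X]big_mkcond -big_split/=.
  apply: eq_bigr => s _; rewrite /chi; case: ifP => sY.
    by rewrite inE sY andbF/= !mulr1 mulr0 addr0.
  by case: ifP => _ /=; rewrite ?mulr1 ?mulr0; ring.
congr (_ * _).
- rewrite /simplex_prob prod_by_dim// => s sY; rewrite dimY// andbT.
  by have /forall_inP /(_ _ sY) /andP[] := subY.
- rewrite /simplex_prob (@prod_by_dim _ (fun i => 1 - p i)); last first.
    by move=> s; rewrite inE => /and3P[].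
  apply: eq_bigr => i _; congr (_ ^+ _); apply: eq_card => s; rewrite !inE.
  have [->|] := eqVneq #|s| i.+1; last by rewrite andbF.
  by rewrite andbT ltn_ord.
Qed.

Lemma complex_probE (Q : {set {set 'I_n}} -> Prop) :
  complex_prob p Q =
  \sum_(w | `[< Q (selected_complex w) >]) selection_weight simplex_prob w.
Proof.
rewrite (partition_big selected_complex (fun Y => (Y \in Omega r n) && `[< Q Y >])); last first.
  by move=> w Qw; rewrite selected_complex_Omega.
apply: eq_bigr => Y /andP[YO QY]; rewrite -selection_weight_fiber//.
apply: eq_bigl => w; case: eqP => [->|]; rewrite ?andbF//.
by rewrite QY.
Qed.

End RandomComplexes.

(** * The trace method *)

Section Walks.
Context {R : comNzRingType} {V : finType}.
Implicit Types (M : V -> V -> R) (v w x : V) (s : seq V).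

Fixpoint kernel_pow M k v w : R :=
  if k is k'.+1 then \sum_x M v x * kernel_pow M k' x w else (v == w)%:R.

Fixpoint walk_prod M v s : R :=
  if s is x :: s' then M v x * walk_prod M x s' else 1.

Lemma big_tuple_cons (k : nat) (F : k.+1.-tuple V -> R) (Q : pred (k.+1.-tuple V)) :
  \sum_(t | Q t) F t =
  \sum_x \sum_(t : k.-tuple V | Q [tuple of x :: t]) F [tuple of x :: t].
Proof.
rewrite pair_big_dep/=.
rewrite (reindex (fun p : V * k.-tuple V => [tuple of p.1 :: p.2]))//.
exists (fun t : k.+1.-tuple V => (thead t, [tuple of behead t])) => [[x t]|t] _ /=.
  by congr (_, _); apply: val_inj.
by rewrite [RHS]tuple_eta.
Qed.

Lemma kernel_pow_walk M k v w :
  kernel_pow M k v w = \sum_(t : k.-tuple V | last v t == w) walk_prod M v t.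
Proof.
elim: k v => [|k IH] v /=.
  rewrite big_mkcond (big_pred1 [tuple]) => [|t]; last by apply/esym/eqP; exact: tuple0.
  by rewrite /=; case: eqP.
rewrite (big_tuple_cons (fun t => walk_prod M v t)); apply: eq_bigr => x _.
by rewrite IH mulr_sumr.
Qed.

Lemma walk_prod_edges M v s :
  walk_prod M v s = \prod_(a <- pairmap pair v s) M a.1 a.2.
Proof. by elim: s v => [|x s IH] v /=; rewrite ?big_nil// big_cons IH. Qed.


Lemma kernel_powD M a b v w :
  kernel_pow M (a + b) v w = \sum_x kernel_pow M a v x * kernel_pow M b x w.
Proof.
elim: a v => [|a IH] v /=.
  rewrite (bigD1 v)//= eqxx mul1r big1 ?addr0// => x xv.
  by rewrite eq_sym (negbTE xv) mul0r.
under eq_bigr do rewrite IH mulr_sumr.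
rewrite exchange_big/=; apply: eq_bigr => x _.
by rewrite mulr_suml; apply: eq_bigr => y _; rewrite mulrA.
Qed.

Lemma kernel_pow1 M v w : kernel_pow M 1 v w = M v w.
Proof.
rewrite /= (bigD1 w)//= eqxx mulr1 big1 ?addr0// => x xw.
by rewrite (negbTE xw) mulr0.
Qed.

Lemma kernel_pow_sym M : (forall v w, M v w = M w v) ->
  forall k v w, kernel_pow M k v w = kernel_pow M k w v.
Proof.
move=> symM; elim=> [|k IH] v w; first by rewrite /= eq_sym.
rewrite -{2}addn1 kernel_powD /=; apply: eq_bigr => x _.
by rewrite IH mulrC -/(kernel_pow M 1 x v) kernel_pow1 symM.
Qed.

Definition walk_edges v s : seq {set V} := pairmap (fun x y => [set x; y]%SET) v s.

Lemma walk_edges_sub v s (e : {set V}) :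
  e \in walk_edges v s -> e \subset [set x in v :: s]%SET.
Proof.
elim: s v => [|x s IH] v //=; rewrite inE => /orP[/eqP ->|/IH/fintype.subsetP es].
  by apply/fintype.subsetP => y; rewrite !inE => /orP[] -> ; rewrite ?orbT.
by apply/fintype.subsetP => y /es; rewrite !inE => ->; rewrite orbT.
Qed.

(** A walk is connected. Adding vertices at the front, a new vertex brings a new edge, because the
    edges of the rest lie among the vertices of the rest. *)
Lemma walk_vertices_le v s :
  (#|[set x in v :: s]%SET| <= #|[set e in walk_edges v s]%SET|.+1)%N.
Proof.
elim: s v => [|x s IH] v /=.
  by rewrite (_ : [set x in [:: v]]%SET = [set v]%SET) ?cards1//; apply/setP => y; rewrite !inE.
have -> : [set y in [:: v, x & s]]%SET = (v |: [set y in x :: s])%SET.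
  by apply/setP => y; rewrite !inE.
have -> : [set e in [set v; x]%SET :: walk_edges x s]%SET =
    ([set v; x] |: [set e in walk_edges x s])%SET.
  by apply/setP => y; rewrite !inE.
have [vs|vs] := boolP (v \in x :: s).
  rewrite (finset.setUidPr _); last by rewrite finset.sub1set inE.
  by apply: leq_trans (IH x) _; rewrite ltnS; apply: subset_leq_card; exact: finset.subsetUr.
have e_new : [set v; x]%SET \notin walk_edges x s.
  apply: contra vs => /walk_edges_sub/fintype.subsetP/(_ v).
  by rewrite !inE eqxx; apply.
by rewrite !cardsU1 [v \in _]inE vs [[set v; x]%SET \in _]inE e_new ltnS; exact: IH.
Qed.

Lemma sum_tuple_in (S : {set V}) (k : nat) :
  \sum_(t : k.-tuple V) (all (mem S) t)%:R = (#|S| ^ k)%:R :> R.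
Proof.
elim: k => [|k IH].
  by rewrite (big_pred1 [tuple])//= => t; apply/esym/eqP; exact: tuple0.
rewrite (big_tuple_cons (fun t => (all (mem S) t)%:R)) /=.
under eq_bigr do under eq_bigr do rewrite -mulnb natrM.
under eq_bigr do rewrite -mulr_sumr IH.
rewrite -mulr_suml expnS natrM; congr (_ * _).
by rewrite -sum1_card natr_sum [RHS]big_mkcond; apply: eq_bigr => x _; case: ifP.
Qed.

End Walks.

Lemma prod_count (R : comNzRingType) (T : finType) (s : seq T) (g : T -> R) :
  \prod_(x <- s) g x = \prod_(x in [set x in s]%SET) g x ^+ count_mem x s.
Proof.
transitivity (\prod_x g x ^+ count_mem x s).
  elim: s => [|y s IH]; first by rewrite big_nil big1.
  rewrite big_cons IH (bigD1 y)//= [RHS](bigD1 y)//= eqxx exprS mulrA.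
  by congr (_ * _); apply: eq_bigr => x xy; rewrite eq_sym (negbTE xy).
rewrite [RHS]big_mkcond; apply: eq_bigr => x _; rewrite inE.
by case: ifPn => // /count_memPn ->.
Qed.

(** * Bounding a quadratic form by the trace of an even power *)

Section TraceBound.
Context {R : realType} {V : finType} (M : V -> V -> R) (H : hilbertSpace R).
Hypothesis M_sym : forall v w, M v w = M w v.
Implicit Types x y z : V -> H.

Definition kernel_apply (x : V -> H) : V -> H :=
  fun v => \sum_w (M v w)%:C%C *: x w.

Let dot x y : R := \sum_v rinner (x v) (y v).

Let dotxx x : dot x x = \sum_v rnorm (x v) ^+ 2.
Proof. by apply: eq_bigr => v _; rewrite rinner_norm. Qed.

Let dot_adj x y : dot (kernel_apply x) y = dot x (kernel_apply y).
Proof.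
rewrite /dot /kernel_apply.
under eq_bigr do rewrite rinner_suml.
under [RHS]eq_bigr do rewrite rinner_sumr.
rewrite exchange_big/=; apply: eq_bigr => w _; apply: eq_bigr => v _.
by rewrite rinnerZl rinnerZr M_sym.
Qed.

Let dot_iter i k x :
  dot (iter (i + k) kernel_apply x) x = dot (iter i kernel_apply x) (iter k kernel_apply x).
Proof.
elim: k i => [|k IH] i; first by rewrite addn0.
by rewrite addnS -addSn IH iterS dot_adj.
Qed.

Lemma iter_kernel_apply k x v :
  iter k kernel_apply x v = \sum_w (kernel_pow M k v w)%:C%C *: x w.
Proof.
elim: k v => [|k IH] v /=.
  rewrite (bigD1 v)//= eqxx scale1r big1 ?addr0// => w wv.
  by rewrite eq_sym (negbTE wv) scale0r.
transitivity (\sum_w \sum_u (M v w)%:C%C *: ((kernel_pow M k w u)%:C%C *: x u)).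
  by apply: eq_bigr => w _; rewrite IH scaler_sumr.
rewrite exchange_big/=; apply: eq_bigr => w _.
rewrite rmorph_sum/= scaler_suml; apply: eq_bigr => u _.
by rewrite scalerA rmorphM.
Qed.

Lemma rnorm_lincomb (a : V -> R) x :
  rnorm (\sum_w (a w)%:C%C *: x w) ^+ 2 <= (\sum_w a w ^+ 2) * \sum_w rnorm (x w) ^+ 2.
Proof.
set y := \sum_w _.
have [->|y_neq0] := eqVneq (rnorm y) 0.
  by rewrite expr0n mulr_ge0 ?sumr_ge0// => w _; exact: sqr_ge0.
have y_gt0 : 0 < rnorm y ^+ 2 by rewrite exprn_even_gt0.
rewrite -(ler_pM2r y_gt0) -expr2 -{1}rinner_norm {1}/y rinner_suml.
under eq_bigr do rewrite rinnerZl -rinnerZr.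
apply: le_trans (rinner_cauchy_schwarz _ _) _.
rewrite le_eqVlt; apply/orP; left; apply/eqP; rewrite mulrC [RHS]mulrAC; congr (_ * _).
rewrite mulr_suml; apply: eq_bigr => w _.
by rewrite rnormZ exprMn real_normK ?num_real.
Qed.

(** Iterated Cauchy-Schwarz replaces diagonalization: with [a k] the form of the [k]-th power,
    [a k ^+ 2 <= N * a (k + k)]. This is why the exponents are powers of 2. *)
Lemma trace_quadratic_form j x :
  `|\sum_v \sum_w M v w * rinner (x v) (x w)| ^+ (2 ^ j.+1) <=
  (\sum_v rnorm (x v) ^+ 2) ^+ (2 ^ j.+1) * \sum_v kernel_pow M (2 ^ j.+1) v v.
Proof.
pose a k := dot (iter k kernel_apply x) x.
pose N := \sum_v rnorm (x v) ^+ 2.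
have N_ge0 : 0 <= N by apply: sumr_ge0 => v _; exact: sqr_ge0.
have -> : \sum_v \sum_w M v w * rinner (x v) (x w) = a 1.
  rewrite /a /dot /= /kernel_apply; apply: eq_bigr => v _.
  by rewrite rinner_suml; apply: eq_bigr => w _; rewrite rinnerZl rinnerC.
have double k : a k ^+ 2 <= N * a (k + k)%N.
  rewrite /a dot_iter mulrC dotxx; exact: rinner_cauchy_schwarz.
have a_ge0 k : 0 <= a (k + k)%N.
  by rewrite /a dot_iter dotxx; apply: sumr_ge0 => v _; exact: sqr_ge0.
(* Each doubling squares the bound and adds one factor [N], hence the exponent [2 ^ i.+1 - 1]. *)
have iterated i : `|a 1| ^+ (2 ^ i.+1) <= N ^+ (2 ^ i.+1).-1 * a (2 ^ i.+1)%N.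
  elim: i => [|i IH].
    by rewrite real_normK ?num_real//; exact: double.
  have E : (2 ^ i.+2 = 2 ^ i.+1 + 2 ^ i.+1)%N by rewrite expnS mul2n addnn.
  have p0 : (0 < 2 ^ i.+1)%N by rewrite expn_gt0.
  rewrite E exprD -expr2.
  apply: (@le_trans _ _ ((N ^+ (2 ^ i.+1).-1 * a (2 ^ i.+1)%N) ^+ 2)).
    by rewrite ler_sqr ?nnegrE ?exprn_ge0// (le_trans _ IH)// exprn_ge0.
  rewrite exprMn; apply: le_trans (ler_wpM2l _ (double _)) _.
    by rewrite sqr_ge0.
  rewrite mulrA -exprM -exprSr.
  rewrite (_ : ((2 ^ i.+1).-1 * 2).+1 = (2 ^ i.+1 + 2 ^ i.+1).-1)%N//.
  by rewrite -[in RHS](prednK p0) addSn addnS muln2 addnn.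
apply: le_trans (iterated j) _.
have p0 : (0 < 2 ^ j.+1)%N by rewrite expn_gt0.
have -> : N ^+ (2 ^ j.+1) = N ^+ (2 ^ j.+1).-1 * N by rewrite -exprSr prednK.
rewrite -mulrA ler_wpM2l ?exprn_ge0//.
(* At an even index [a] is the square norm of a half power applied to [x], and the squared
   Hilbert-Schmidt norm of the half power is the trace of the full one. *)
rewrite expnS mul2n -addnn /a dot_iter dotxx.
rewrite mulr_sumr; apply: ler_sum => v _.
rewrite iter_kernel_apply kernel_powD mulrC.
under [X in X * _]eq_bigr do rewrite (kernel_pow_sym M_sym _ _ v) -expr2.
exact: rnorm_lincomb.
Qed.

End TraceBound.

Lemma sum_count (T : finType) (s : seq T) :
  (\sum_(x in [set x in s]%SET) count_mem x s = size s)%N.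
Proof.
transitivity (\sum_x count_mem x s)%N.
  rewrite big_mkcond; apply: eq_bigr => x _; rewrite inE.
  by case: ifPn => // /count_memPn ->.
elim: s => [|y s IH]; first by rewrite big1.
rewrite /= -IH big_split/= (bigD1 y)//= eqxx big1 ?addn0// => x xy.
by rewrite eq_sym (negbTE xy).
Qed.

(** The expression is the [m]-th centred moment of a Bernoulli variable, in the affine form that
    [expect_blocks] produces. It is dominated by the variance [q (1 - q)]. *)
Lemma centered_bernoulli_moment (R : realFieldType) (q : R) m : 0 <= q <= 1 -> (2 <= m)%N ->
  `|(- q) ^+ m + ((1 - q) ^+ m - (- q) ^+ m) * q| <= q.
Proof.
move=> /andP[q0 q1] m2.
have q2 : 0 <= 1 - q by rewrite subr_ge0.
have -> : (- q) ^+ m + ((1 - q) ^+ m - (- q) ^+ m) * q =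
  (- q) ^+ m * (1 - q) + (1 - q) ^+ m * q by ring.
apply: le_trans (ler_normD _ _) _; rewrite !normrM !normrX normrN.
rewrite (ger0_norm q0) (ger0_norm q2).
have e1 : q ^+ m <= q ^+ 2 by rewrite ler_wiXn2l.
have e2 : (1 - q) ^+ m <= (1 - q) ^+ 2 by rewrite ler_wiXn2l//; lra.
have e3 : q ^+ m * (1 - q) <= q ^+ 2 * (1 - q) by rewrite ler_wpM2r// subr_ge0.
have e4 : (1 - q) ^+ m * q <= (1 - q) ^+ 2 * q by rewrite ler_wpM2r.
have e5 : q ^+ 2 * (1 - q) + (1 - q) ^+ 2 * q = q - q ^+ 2 by ring.
have e6 := sqr_ge0 q.
by apply: le_trans (lerD e3 e4) _; rewrite e5 lerBlDr lerDl.
Qed.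

(* [pi i] is the probability of an i-simplex, so that [b] and [q] are the vertex
   and edge probabilities of the link of [u]. *)
Section LinkMatrix.
Context {R : realType} {n : nat} (pi : nat -> R) (u : 'I_n).
Hypothesis pi01 : forall i, 0 <= pi i <= 1.
Implicit Types (w : {ffun {set 'I_n} -> bool}) (e : {set 'I_n}) (x y v : 'I_n).

Let P (s : {set 'I_n}) : R := pi #|s|.-1.
Let b := pi 0 * pi 1.
Let q := pi 1 * pi 2.

(* The simplexes which have to be selected, besides the faces of smaller
   dimension, for [e] to be a simplex of the link of [u]. *)
Definition cone_block e : {set {set 'I_n}} := [set e; u |: e]%SET.

Definition cone_selected w e : R := \prod_(s in cone_block e) (w s)%:R.

(** Only edges are centred. The vertex indicators stay as factors, so that a walk is charged [b] for
    every vertex it visits. *)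
Definition link_matrix w v x : R :=
  if [&& v != x, v != u & x != u] then
    cone_selected w [set v]%SET * cone_selected w [set x]%SET *
    (cone_selected w [set v; x]%SET - q)
  else 0.

Lemma link_matrix_sym w v x : link_matrix w v x = link_matrix w x v.
Proof.
rewrite /link_matrix eq_sym [(v != u) && _]andbC finset.setUC.
by case: ifP => // _; rewrite [cone_selected w _ * cone_selected w _]mulrC.
Qed.

Lemma cone_prod (f : {set 'I_n} -> R) e : u \notin e ->
  \prod_(s in cone_block e) f s = f e * f (u |: e)%SET.
Proof.
move=> ue; rewrite /cone_block big_setU1/= ?big_set1// inE.
by apply: contra ue => /eqP ->; rewrite !inE eqxx.
Qed.

Lemma cone_selectedE w e : u \notin e -> cone_selected w e = (w e && w (u |: e)%SET)%:R.
Proof. by move=> ue; rewrite /cone_selected cone_prod// -natrM mulnb. Qed.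

(** Deleting [u] recovers [e] from any member of its block, so distinct simplexes have disjoint
    blocks. *)
Lemma cone_block_inj e s : u \notin e -> s \in cone_block e -> (s :\ u)%SET = e.
Proof.
by move=> ue; rewrite !inE => /orP[] /eqP ->; apply/setP => x; rewrite !inE;
  case: (eqVneq x u) => //= ->; rewrite (negbTE ue).
Qed.

Lemma cone_prob1 x : x != u -> \prod_(s in cone_block [set x]%SET) P s = b.
Proof.
move=> xu; rewrite cone_prod ?inE 1?eq_sym// /P cards1 cardsU1 cards1 inE.
by rewrite eq_sym xu.
Qed.

Lemma cone_prob2 e : #|e| = 2 -> u \notin e -> \prod_(s in cone_block e) P s = q.
Proof. by move=> e2 ue; rewrite cone_prod// /P cardsU1 ue e2. Qed.

Definition link_step (a : 'I_n * 'I_n) : bool :=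
  [&& a.1 != a.2, a.1 != u & a.2 != u].

Lemma link_step_vertices v s : s != [::] -> all link_step (pairmap pair v s) ->
  forall x, x \in v :: s -> x != u.
Proof.
elim: s v => // y s IH v _ /= /andP[/and3P[/= _ vu yu] ys] x.
rewrite inE => /orP[/eqP -> //|].
case: s IH ys => [_ _|z s IH ys]; first by rewrite inE => /eqP ->.
exact: IH.
Qed.

Lemma link_step_edges v s : all link_step (pairmap pair v s) ->
  forall e, e \in walk_edges v s -> #|e| = 2 /\ u \notin e.
Proof.
elim: s v => // y s IH v /= /andP[/and3P[/= vy vu yu] ys] e.
rewrite inE => /orP[/eqP ->|]; last exact: IH.
by rewrite cards2 vy !inE negb_or ![u == _]eq_sym vu yu.
Qed.

(** Vertex indicators are idempotent, so repeated visits leave one factor per vertex; centred edge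
    factors keep their multiplicity. *)
Lemma walk_prod_link w v s : s != [::] -> all link_step (pairmap pair v s) ->
  walk_prod (link_matrix w) v s =
  (\prod_(x in [set x in v :: s]%SET) cone_selected w [set x]%SET) *
  \prod_(e in [set e in walk_edges v s]%SET)
    (cone_selected w e - q) ^+ count_mem e (walk_edges v s).
Proof.
move=> s_neq0 steps.
pose c x := cone_selected w [set x]%SET.
have idem x : x != u -> c x * c x = c x.
  by move=> xu; rewrite /c cone_selectedE ?inE 1?eq_sym// -natrM mulnb andbb.
have vert := link_step_vertices s_neq0 steps.
transitivity ((\prod_(a <- pairmap pair v s) (c a.1 * c a.2)) *
    \prod_(e <- walk_edges v s) (cone_selected w e - q)).
  move: steps; clear s_neq0 vert; elim: s v => [|y s IH] v /=; first by rewrite !big_nil mulr1.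
  move=> /andP[vy ys]; rewrite IH// !big_cons/= -/(walk_edges y s).
  by rewrite /link_matrix /link_step in vy *; rewrite vy -/(c v) -/(c y); ring.
rewrite (prod_count (walk_edges v s)); congr (_ * _).
have aux t z : all link_step (pairmap pair z t) -> (forall x, x \in z :: t -> x != u) ->
    c z * \prod_(a <- pairmap pair z t) (c a.1 * c a.2) =
    \prod_(x in [set x in z :: t]%SET) c x.
  elim: t z => [|y t IH] z /=.
    move=> _ _; rewrite big_nil mulr1 (_ : [set x in [:: z]]%SET = [set z]%SET) ?big_set1//.
    by apply/setP => x; rewrite !inE.
  move=> /andP[_ yt] ztu.
  have ytu x : x \in y :: t -> x != u by move=> xyt; apply: ztu; rewrite inE xyt orbT.
  rewrite big_cons/= mulrA mulrA idem; last by apply: ztu; rewrite mem_head.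
  rewrite -mulrA IH//.
  have -> : [set x in [:: z, y & t]]%SET = (z |: [set x in y :: t])%SET.
    by apply/setP => x; rewrite !inE.
  have [zyt|zyt] := boolP (z \in y :: t).
    rewrite (finset.setUidPr _); last by rewrite finset.sub1set inE.
    by rewrite (bigD1 z) ?inE//= mulrA idem// ytu.
  by rewrite big_setU1// inE.
rewrite -[RHS]aux//; case: s s_neq0 steps vert {aux} => // y s _ _ vert.
by rewrite /= big_cons/= !mulrA idem ?vert ?mem_head.
Qed.

Let h (m : nat) : R := (- q) ^+ m + ((1 - q) ^+ m - (- q) ^+ m) * q.

Let b01 : 0 <= b <= 1.
Proof. by have /andP[? ?] := pi01 0; have /andP[? ?] := pi01 1; rewrite mulr_ge0// mulr_ile1. Qed.

Let q01 : 0 <= q <= 1.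
Proof. by have /andP[? ?] := pi01 1; have /andP[? ?] := pi01 2; rewrite mulr_ge0// mulr_ile1. Qed.

Let h1 : h 1 = 0. Proof. by rewrite /h !expr1; ring. Qed.

Let h_le m : (2 <= m)%N -> `|h m| <= q.
Proof. exact: centered_bernoulli_moment. Qed.

Definition walk_bound l (k : nat) : R :=
  if (k <= l.+1)%N then b ^+ k * q ^+ k.-1 else 0.

Lemma walk_bound_ge0 l k : 0 <= walk_bound l k.
Proof.
have /andP[q0 _] := q01; have /andP[b0 _] := b01.
by rewrite /walk_bound; case: ifP => // _; rewrite mulr_ge0// exprn_ge0.
Qed.

(* A walk using some edge exactly once has expectation 0. Any other walk of
   length [2 * l] has at most [l] distinct edges, hence at most [l + 1] vertices,
   and at least one edge less than vertices. *)
Lemma expect_walk_prod l v s : (0 < l)%N -> size s = (2 * l)%N ->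
  expect P (fun w => walk_prod (link_matrix w) v s) <=
  walk_bound l #|[set x in v :: s]%SET|.
Proof.
move=> l0 sl.
have s_neq0 : s != [::] by rewrite -size_eq0 sl muln_eq0/= -lt0n.
have [steps|] := boolP (all link_step (pairmap pair v s)); last first.
  rewrite -has_predC => /hasP[a as_ /negbTE na].
  rewrite (@expect_ext _ _ _ _ (fun=> 0)) ?expect_cst ?walk_bound_ge0// => w.
  by rewrite walk_prod_edges (big_rem _ as_)/= /link_matrix -/(link_step a) na mul0r.
have vert := link_step_vertices s_neq0 steps.
have edge := link_step_edges steps.
set V := [set x in v :: s]%SET; set E := [set e in walk_edges v s]%SET.
pose m e := count_mem e (walk_edges v s).
(* Vertices and edges of the walk jointly index disjoint blocks. The factor at [j] is affine in the
   indicator of its block, with coefficients [a j] and [c j]. *)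
pose set_of (j : 'I_n + {set 'I_n}) := match j with inl x => [set x]%SET | inr e => e end.
pose D := [set j : 'I_n + {set 'I_n} |
  match j with inl x => x \in V | inr e => e \in E end]%SET.
pose a (j : 'I_n + {set 'I_n}) : R := match j with inl _ => 0 | inr e => (- q) ^+ m e end.
pose c (j : 'I_n + {set 'I_n}) : R :=
  match j with inl _ => 1 | inr e => (1 - q) ^+ m e - (- q) ^+ m e end.
have prodD (f : {set 'I_n} -> R) : \prod_(j in D) (a j + c j * f (set_of j)) =
    (\prod_(x in V) f [set x]%SET) *
    \prod_(e in E) ((- q) ^+ m e + ((1 - q) ^+ m e - (- q) ^+ m e) * f e).
  rewrite big_mkcond big_sumType/= [in RHS]big_mkcond [X in _ = _ * X]big_mkcond.
  congr (_ * _); apply: eq_bigr => j _; rewrite inE//.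
  by case: ifP => // _; rewrite add0r mul1r.
rewrite (@expect_ext _ _ _ _ (fun w => \prod_(j in D)
    (a j + c j * \prod_(s in cone_block (set_of j)) (w s)%:R))); last first.
  move=> w; rewrite walk_prod_link// (prodD (cone_selected w)); congr (_ * _).
  apply: eq_bigr => e; rewrite inE => /edge[_ ue]; rewrite -/(m e) cone_selectedE//.
  by case: (_ && _); rewrite /= ?sub0r; ring.
rewrite expect_blocks; last first.
  have ud j : j \in D -> u \notin set_of j.
    case: j => [x|e]; rewrite !inE; last by case/edge.
    by move=> /vert; rewrite eq_sym.
  move=> j k y jD kD yj yk.
  have : set_of j = set_of k by rewrite -(cone_block_inj (ud _ jD) yj) -(cone_block_inj (ud _ kD) yk).
  case: j k jD kD {yj yk} => [x|e] [x'|e']; rewrite !inE /=.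
  - by move=> _ _ /finset.set1_inj ->.
  - by move=> _ /edge[+ _] eE; rewrite -eE cards1.
  - by move=> /edge[+ _] _ eE; rewrite eE cards1.
  - by move=> _ _ ->.
rewrite (prodD (fun e => \prod_(s in cone_block e) P s)).
have -> : \prod_(x in V) \prod_(s in cone_block [set x]%SET) P s = b ^+ #|V|.
  rewrite -prodr_const; apply: eq_bigr => x; rewrite inE => /vert xu.
  exact: cone_prob1.
have -> : \prod_(e in E) ((- q) ^+ m e + ((1 - q) ^+ m e - (- q) ^+ m e) *
    \prod_(s in cone_block e) P s) = \prod_(e in E) h (m e).
  by apply: eq_bigr => e; rewrite inE => /edge[e2 ue]; rewrite cone_prob2.
have /andP[q0 q1] := q01; have /andP[b0 _] := b01.
have [m2|] := boolP [forall e in E, 1 < m e]%N; last first.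
  rewrite negb_forall => /existsP[e]; rewrite negb_imply -leqNgt => /andP[eE me].
  have -> : \prod_(e in E) h (m e) = 0.
    rewrite (bigD1 e)//= (_ : m e = 1%N) ?h1 ?mul0r//; apply/eqP; rewrite eqn_leq me.
    by rewrite /m -has_count has_pred1; move: eE; rewrite inE.
  by rewrite mulr0 walk_bound_ge0.
have EV : (#|V| <= #|E|.+1)%N := walk_vertices_le v s.
have El : (#|E| <= l)%N.
  have : (\sum_(e in E) 2 <= \sum_(e in E) m e)%N.
    by apply: leq_sum => e eE; exact: (forall_inP m2).
  rewrite sum_nat_const sum_count size_pairmap sl [(2 * l)%N]mulnC leq_mul2r.
  by [].
rewrite /walk_bound (leq_trans EV)//.
apply: ler_wpM2l; first exact: exprn_ge0.
apply: le_trans (ler_norm _) _; rewrite normr_prod.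
apply: (@le_trans _ _ (\prod_(e in E) q)).
  by apply: ler_prod => e eE; rewrite normr_ge0 h_le//; exact: (forall_inP m2).
(* As [q <= 1], the lower bound [#|V|.-1] on the number of edges gives an upper bound on the power
   of [q]. *)
rewrite prodr_const; apply: ler_wiXn2l => //.
by rewrite -ltnS prednK//; apply/card_gt0P; exists v; rewrite inE mem_head.
Qed.

End LinkMatrix.

Lemma bin_le_exp (n k : nat) : ('C(n, k) <= n ^ k)%N.
Proof.
elim: k => [|k IH]; first by rewrite bin0.
rewrite expnS -(leq_pmul2l (ltn0Sn k)) mul_bin_left.
apply: leq_trans (leq_mul (leq_subr k n) IH) _.
by rewrite leq_pmull.
Qed.

(** * Expected traces of links and exponential moments of triangle counts *)

Section Expectations.
Context {R : realType} {n : nat} (pi : nat -> R).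
Hypothesis pi01 : forall i, 0 <= pi i <= 1.
Implicit Types (w : {ffun {set 'I_n} -> bool}) (u v x : 'I_n).

Let P (s : {set 'I_n}) : R := pi #|s|.-1.
Let D : R := n%:R * (pi 0 * pi 1) * (pi 1 * pi 2).

Definition link_trace k w u : R := \sum_v kernel_pow (link_matrix pi u w) k v v.

(** The closing condition is dropped and vertex sequences are grouped by their set [S]. At most
    [n ^ k] sets have size [k], each carrying at most [k ^ (2 l + 1)] sequences, and [n ^ k b ^ k q
    ^ (k - 1) = n b D ^ (k - 1) <= n D ^ l] because [D >= 1] and [k <= l + 1]. *)
Lemma expect_link_trace l u : (0 < l)%N -> 1 <= D ->
  expect P (fun w => link_trace (2 * l) w u) <= l.+2%:R ^+ (2 * l).+2 * (n%:R * D ^+ l).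
Proof.
move=> l0 D1.
have D0 : 0 <= D by apply: le_trans D1.
have /andP[b0 b1] : 0 <= pi 0 * pi 1 <= 1.
  by have /andP[? ?] := pi01 0; have /andP[? ?] := pi01 1; rewrite mulr_ge0// mulr_ile1.
have wb0 k : 0 <= walk_bound pi l k by exact: walk_bound_ge0.
pose K : R := l.+2%:R ^+ (2 * l).+1 * (n%:R * D ^+ l).
have K0 : 0 <= K by rewrite !mulr_ge0 ?exprn_ge0.
rewrite expect_sum.
apply: (@le_trans _ _ (\sum_v \sum_(t : (2 * l).-tuple 'I_n)
    walk_bound pi l #|[set x in v :: t]%SET|)).
  apply: ler_sum => v _.
  rewrite (@expect_ext _ _ _ _ (fun w => \sum_(t : (2 * l).-tuple 'I_n | last v t == v)
    walk_prod (link_matrix pi u w) v t)) => [|w]; last exact: kernel_pow_walk.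
  rewrite expect_sum [leLHS]big_mkcond; apply: ler_sum => t _.
  case: ifP => // _; apply: expect_walk_prod => //; exact: size_tuple.
have := big_tuple_cons (fun t : (2 * l).+1.-tuple 'I_n =>
  walk_bound pi l #|[set x in tval t]%SET|) xpredT.
move=> /= <-.
rewrite (partition_big (fun t : (2 * l).+1.-tuple 'I_n => [set x in tval t]%SET) xpredT)//=.
apply: (@le_trans _ _ (\sum_(S : {set 'I_n}) (#|S| ^ (2 * l).+1)%:R * walk_bound pi l #|S|)).
  apply: ler_sum => S _.
  rewrite (eq_bigr (fun=> walk_bound pi l #|S|)) => [|t /eqP <-//].
  rewrite -sum_tuple_in mulr_suml [leLHS]big_mkcond; apply: ler_sum => t _.
  case: ifP => [/eqP tS|_]; last by rewrite mulr_ge0.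
  have -> : all (mem S) t.
    by apply/allP => x xt; have : x \in S by rewrite -tS inE.
  by rewrite mul1r.
rewrite (bigID (fun S : {set 'I_n} => #|S| < l.+2)%N)/= addrC big1 ?add0r; last first.
  by move=> S /negbTE; rewrite ltnS /walk_bound => ->; rewrite mulr0.
rewrite (partition_big (fun S : {set 'I_n} => inord #|S| : 'I_l.+2) xpredT)//=.
(* The [l.+2] possible sizes of [S] supply the last factor [l.+2] of the bound. *)
apply: (@le_trans _ _ (\sum_(k < l.+2) K)); last first.
  by rewrite sumr_const card_ord -[leLHS]mulr_natl /K mulrA -exprS.
apply: ler_sum => k _.
apply: (@le_trans _ _ (\sum_(S : {set 'I_n} | #|S| == k)
    (k ^ (2 * l).+1)%:R * walk_bound pi l k)).
  rewrite [leLHS]big_mkcond [leRHS]big_mkcond; apply: ler_sum => S _.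
  case: ifP => [/andP[Sl]|_]; last by case: ifP => // _; rewrite mulr_ge0.
  by rewrite -val_eqE/= inordK// => /eqP Sk; rewrite Sk eqxx.
rewrite (eq_bigl (fun S => S \in [set S : {set 'I_n} | #|S| == k]%SET)) => [|S]; last by rewrite inE.
rewrite sumr_const card_draws card_ord -[leLHS]mulr_natl /walk_bound -ltnS ltn_ord.
case: (val k) (ltn_ord k) => [|m] ml /=; first by rewrite exp0n// mul0r mulr0.
apply: (@le_trans _ _ (n%:R ^+ m.+1 * (l.+2%:R ^+ (2 * l).+1 *
  ((pi 0 * pi 1) ^+ m.+1 * (pi 1 * pi 2) ^+ m)))).
  have bq0 : 0 <= (pi 0 * pi 1) ^+ m.+1 * (pi 1 * pi 2) ^+ m.
    have /andP[? _] := pi01 1; have /andP[? _] := pi01 2.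
    by rewrite mulr_ge0 ?exprn_ge0// mulr_ge0.
  apply: ler_pM => //; first by apply: mulr_ge0.
    by rewrite -natrX ler_nat bin_le_exp.
  by rewrite ler_wpM2r// -natrX ler_nat leq_exp2r// ltnW.
have -> : n%:R ^+ m.+1 * (l.+2%:R ^+ (2 * l).+1 *
    ((pi 0 * pi 1) ^+ m.+1 * (pi 1 * pi 2) ^+ m)) =
    l.+2%:R ^+ (2 * l).+1 * (n%:R * (pi 0 * pi 1) * D ^+ m) :> R.
  by rewrite /D !exprMn !exprS; ring.
rewrite /K ler_wpM2l ?exprn_ge0//; apply: ler_pM.
- by apply: mulr_ge0.
- exact: exprn_ge0.
- by rewrite ler_piMr.
- by rewrite ler_weXn2l.
Qed.

(** The faces of the triangle on [u], [v], [x] that contain [x]. Faces without [x] are left out so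
    that the blocks of different [x] are disjoint. *)
Definition common_block u v x : {set {set 'I_n}} :=
  ([set u; v; x] |: ([set v; x] |: [set [set u; x]; [set x]]))%SET.

Definition common_selected w u v x : bool := [forall s in common_block u v x, w s].

Definition common_count w u v : nat :=
  #|[set x | [&& x != u, x != v & common_selected w u v x]]%SET|.

(** Each factor is 1/2 or 1 according to whether [x] completes a triangle, so this is the
    expectation of 2 to the power minus the count, as a Chernoff bound needs. The blocks are
    disjoint, since removing [u] and [v] from a member of a block leaves [x] alone. *)
Lemma expect_common u v : u != v ->
  expect P (fun w => \prod_(x in ([set~ u] :\ v)%SET)
    (1 - 2^-1 * \prod_(s in common_block u v x) (w s)%:R)) =
  (1 - 2^-1 * (pi 0 * pi 1 * (pi 1 * pi 2))) ^+ n.-2.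
Proof.
move=> uv.
have vu : v != u by rewrite eq_sym.
rewrite (@expect_ext _ _ _ _ (fun w => \prod_(x in ([set~ u] :\ v)%SET)
    (1 + - 2^-1 * \prod_(s in common_block u v x) (w s)%:R))); last first.
  by move=> w; apply: eq_bigr => x _; rewrite mulNr.
rewrite (@expect_blocks _ _ P _ _ (common_block u v) (fun=> 1) (fun=> - 2^-1)); last first.
  have rem x s : x \in ([set~ u] :\ v)%SET -> s \in common_block u v x ->
      ((s :\ u) :\ v)%SET = [set x]%SET.
    rewrite !inE => /andP[xv xu] sx; apply/setP => y; rewrite !inE.
    move: sx => /or4P[] /eqP ->; rewrite !inE;
      case: (eqVneq y v) => [->|_]; rewrite /= ?(eq_sym v) ?(negbTE xv)//;
      case: (eqVneq y u) => [->|_]; rewrite /= ?(eq_sym u) ?(negbTE xu)//.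
  move=> x y s xD yD sx sy; apply: finset.set1_inj.
  by rewrite -(rem x s)// (rem y s).
rewrite (eq_bigr (fun=> 1 - 2^-1 * (pi 0 * pi 1 * (pi 1 * pi 2)))); last first.
  move=> x; rewrite !inE => /andP[xv xu]; rewrite mulNr.
  have c1 : #|[set u; x]%SET| = 2%N by rewrite cards2 eq_sym xu.
  have c2 : #|[set v; x]%SET| = 2%N by rewrite cards2 eq_sym xv.
  have c3 : #|[set u; v; x]%SET| = 3%N.
    by rewrite finset.setUC cardsU1 !inE negb_or xu xv cards2 uv.
  rewrite /common_block big_setU1/=; last first.
    rewrite !inE; apply/or3P => -[] /eqP /(congr1 (fun s : {set 'I_n} => #|s|)) /=;
      by rewrite c3 ?cards1 ?c1 ?c2.
  rewrite big_setU1/=; last first.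
    rewrite !inE; apply/orP => -[/eqP|/eqP /(congr1 (fun s : {set 'I_n} => #|s|)) /=]; last first.
      by rewrite c2 cards1.
    move=> /setP /(_ v); rewrite !inE eqxx (negbTE vu)/= => /esym/eqP vx.
    by rewrite vx eqxx in xv.
  rewrite big_setU1/=; last first.
    by rewrite !inE; apply/eqP => /(congr1 (fun s : {set 'I_n} => #|s|)) /=; rewrite c1 cards1.
  by rewrite big_set1 /P c1 c2 c3 cards1 /=; ring.
rewrite prodr_const; congr (_ ^+ _).
have := cardsD1 v [set~ u]; rewrite cardsC1 card_ord !inE vu add1n => /(congr1 predn) /= ->.
by [].
Qed.

End Expectations.

(** * Property (T) with high probability *)

Section GoodSelection.
Context {R : realType} {n r : nat} (pi : nat -> R) (w : {ffun {set 'I_n} -> bool}).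
Hypothesis r_ge2 : (2 <= r)%N.
Local Notation Y := (selected_complex r w).
Local Notation q := (pi 1 * pi 2).
Implicit Types (a b c u v x : 'I_n).

Lemma subset2P (t : {set 'I_n}) a b : (0 < #|t|)%N -> t \subset [set a; b]%SET ->
  [\/ t = [set a]%SET, t = [set b]%SET | t = [set a; b]%SET].
Proof.
move=> t0 /fintype.subsetP tab.
have ta z : z \in t -> (z == a) || (z == b) by move=> /tab; rewrite !inE.
have [at_|na] := boolP (a \in t); have [bt|nb] := boolP (b \in t).
- by apply: Or33; apply/setP => z; rewrite !inE; apply/idP/idP => [/ta//|/orP[]/eqP->].
- apply: Or31; apply/setP => z; rewrite !inE; apply/idP/eqP => [zt|-> //].
  by case/orP: (ta z zt) => /eqP// zb; rewrite -zb zt in nb.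
- apply: Or32; apply/setP => z; rewrite !inE; apply/idP/eqP => [zt|-> //].
  by case/orP: (ta z zt) => /eqP// za; rewrite -za zt in na.
- case/card_gt0P: t0 => z zt.
  by case/orP: (ta z zt) => /eqP zz; rewrite -zz zt in na nb.
Qed.

Lemma subset3P (t : {set 'I_n}) a b c : t \subset [set a; b; c]%SET ->
  [\/ t \subset [set a; b]%SET, t \subset [set a; c]%SET, t \subset [set b; c]%SET |
      t = [set a; b; c]%SET].
Proof.
move=> /fintype.subsetP tabc.
have ta z : z \in t -> [|| z == a, z == b | z == c].
  by move=> /tabc; rewrite !inE -orbA.
have [at_|na] := boolP (a \in t); last first.
  apply: Or43; apply/fintype.subsetP => z zt; rewrite !inE.
  by case/or3P: (ta z zt) => [/eqP za|->|->]; rewrite ?orbT//; rewrite -za zt in na.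
have [bt|nb] := boolP (b \in t); last first.
  apply: Or42; apply/fintype.subsetP => z zt; rewrite !inE.
  by case/or3P: (ta z zt) => [->|/eqP zb|->]; rewrite ?orbT//; rewrite -zb zt in nb.
have [ct|nc] := boolP (c \in t); last first.
  apply: Or41; apply/fintype.subsetP => z zt; rewrite !inE.
  by case/or3P: (ta z zt) => [->|->|/eqP zc]; rewrite ?orbT//; rewrite -zc zt in nc.
apply: Or44; apply/setP => z; rewrite !inE -orbA; apply/idP/idP => [/ta//|].
by case/or3P => /eqP ->.
Qed.

Lemma edge_selected a b :
  ([set a; b]%SET \in Y) = [&& w [set a]%SET, w [set b]%SET & w [set a; b]%SET].
Proof.
apply/selected_complexP/and3P => [[_ wab]|[wa wb wab]].
  split; apply: wab; rewrite ?cards1 ?cards2 ?finset.sub1set ?subxx ?inE ?eqxx ?orbT//.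
split; first by rewrite cards2; case: (a != b); rewrite /= ?ltnS// (leq_trans _ r_ge2).
by move=> t t0 /(subset2P t0)[] ->.
Qed.

Lemma vertex_selected a : ([set a]%SET \in Y) = w [set a]%SET.
Proof.
by rewrite -[in LHS](finset.setUid [set a]%SET) edge_selected finset.setUid !andbb.
Qed.

Lemma triangle_selected a b c :
  ([set a; b; c]%SET \in Y) = [&& [set a; b]%SET \in Y, [set a; c]%SET \in Y,
     w [set b; c]%SET & w [set a; b; c]%SET].
Proof.
apply/idP/and4P => [abc|[ab ac wbc wabc]].
  have sub (t : {set 'I_n}) : (0 < #|t|)%N -> t \subset [set a; b; c]%SET -> t \in Y.
    by move=> t0 ts; exact: (subcomplex_face (selected_complex_sub r w) abc t0 ts).
  have wsub (t : {set 'I_n}) : (0 < #|t|)%N -> t \subset [set a; b; c]%SET -> w t.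
    by case/selected_complexP: abc => _; apply.
  split; [apply: sub|apply: sub|apply: wsub|apply: wsub]; rewrite ?cards2//.
  - exact: finset.subsetUl.
  - by rewrite finset.subUset !finset.sub1set !inE !eqxx !orbT.
  - by rewrite finset.subUset !finset.sub1set !inE !eqxx !orbT.
  - by apply/card_gt0P; exists a; rewrite !inE eqxx.
have := ab; have := ac; rewrite !edge_selected => /and3P[_ wc _] /and3P[_ wb _].
apply/selected_complexP; split => [|t t0 /subset3P[] tabc].
- apply/andP; split; first by apply/card_gt0P; exists a; rewrite !inE eqxx.
  apply: leq_trans (leq_card_setU _ _) _; rewrite cards1 cards2 addn1 ltnS.
  by apply: leq_trans r_ge2; case: (a != b).
- by case/selected_complexP: ab => _; apply.
- by case/selected_complexP: ac => _; apply.
- by case: (subset2P t0 tabc) => ->.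
- by rewrite tabc.
Qed.

Lemma skeleton_edge_cone u v : skeleton_edge Y u v -> cone_selected u w [set v]%SET = 1 :> R.
Proof.
case/andP => uv; rewrite edge_selected => /and3P[_ wv wuv].
by rewrite cone_selectedE ?inE// wv wuv.
Qed.

Lemma triangle_cone u v x : skeleton_edge Y u v -> skeleton_edge Y u x -> v != x ->
  (triangle Y u v x)%:R = cone_selected u w [set v; x]%SET :> R.
Proof.
move=> /andP[uv uvY] /andP[ux uxY] vx.
rewrite /triangle uv ux vx triangle_selected uvY uxY/= cone_selectedE; last first.
  by rewrite !inE negb_or uv.
by rewrite finset.setUA.
Qed.

Lemma triangle_edges u v x : triangle Y u v x -> [/\ skeleton_edge Y u v, skeleton_edge Y u x & v != x].
Proof.
have sub := selected_complex_sub r w.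
move=> T; have := T; rewrite triangle_swap23 => T'; split.
- exact: (triangle_edge sub T).
- exact: (triangle_edge sub T').
- by case/and4P: T.
Qed.

(** On functions supported by the link, adjacency is [link_matrix] plus [q (J - 1)] with [J] the
    all-ones matrix. The trace controls the first term, and the part [- q] of the second has a
    favourable sign. Cutting [x] off to [y] realizes the support condition. *)
Lemma links_quadratic_form (H : hilbertSpace R) (e : R) (j : nat) u (x : 'I_n -> H) :
  0 <= e -> 0 <= q -> link_trace pi (2 ^ j.+1) w u <= e ^+ (2 ^ j.+1) ->
  \sum_v \sum_z (triangle Y u v z)%:R * rinner (x v) (x z) <=
  e * (\sum_(v | skeleton_edge Y u v) rnorm (x v) ^+ 2) +
  q * rnorm (\sum_(v | skeleton_edge Y u v) x v) ^+ 2.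
Proof.
move=> e0 q0 tr_e.
pose y v := if skeleton_edge Y u v then x v else 0.
have yN : \sum_(v | skeleton_edge Y u v) rnorm (x v) ^+ 2 = \sum_v rnorm (y v) ^+ 2.
  by rewrite big_mkcond; apply: eq_bigr => v _; rewrite /y; case: ifP; rewrite ?rnorm0 ?expr0n.
have yS : \sum_(v | skeleton_edge Y u v) x v = \sum_v y v by rewrite big_mkcond.
rewrite yN yS; set N := \sum_v rnorm (y v) ^+ 2.
have N0 : 0 <= N by apply: sumr_ge0 => v _; exact: sqr_ge0.
pose M := link_matrix pi u w.
have -> : \sum_v \sum_z (triangle Y u v z)%:R * rinner (x v) (x z) =
    \sum_v \sum_z M v z * rinner (y v) (y z) + q * (rnorm (\sum_v y v) ^+ 2 - N).
  have -> : rnorm (\sum_v y v) ^+ 2 - N =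
      \sum_v \sum_z (v != z)%:R * rinner (y v) (y z).
    rewrite -rinner_norm rinner_suml -sumrB; apply: eq_bigr => v _.
    rewrite rinner_sumr (bigD1 v)//= rinner_norm addrAC subrr add0r.
    rewrite [RHS](bigD1 v)//= eqxx mul0r add0r; apply: eq_bigr => z zv.
    by rewrite eq_sym zv mul1r.
  rewrite mulr_sumr -big_split/=; apply: eq_bigr => v _.
  rewrite mulr_sumr -big_split/=; apply: eq_bigr => z _.
  rewrite /y; case: (boolP (skeleton_edge Y u v)) => uv /=; last first.
    rewrite rinner0l !mulr0 addr0; case: (boolP (triangle _ _ _ _)); rewrite ?mul0r//.
    by move=> /triangle_edges[]; rewrite (negbTE uv).
  case: (boolP (skeleton_edge Y u z)) => uz /=; last first.
    rewrite (rinnerC _ 0) rinner0l !mulr0 addr0.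
    case: (boolP (triangle _ _ _ _)); rewrite ?mul0r//.
    by move=> /triangle_edges[]; rewrite (negbTE uz).
  have [<-|vz] := eqVneq v z.
    rewrite /M /link_matrix eqxx /= mul0r mulr0 addr0.
    case: (boolP (triangle _ _ _ _)); rewrite ?mul0r//.
    by move=> /triangle_edges[]; rewrite eqxx.
  rewrite triangle_cone// /M /link_matrix vz !skeleton_edge_cone//.
  have /andP[uv' _] := uv; have /andP[uz' _] := uz.
  by rewrite ![_ == u]eq_sym uv' uz'/=; ring.
have : \sum_v \sum_z M v z * rinner (y v) (y z) <= e * N.
  apply: le_trans (ler_norm _) _.
  have L0 : (0 < 2 ^ j.+1)%N by rewrite expn_gt0.
  rewrite -(ler_pXn2r L0) ?nnegrE ?mulr_ge0//.
  apply: le_trans (trace_quadratic_form _ j y) _.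
    exact: link_matrix_sym.
  by rewrite -/N exprMn mulrC ler_wpM2r ?exprn_ge0.
have : 0 <= q * N by rewrite mulr_ge0.
by lra.
Qed.

Lemma common_triangle v z x : skeleton_edge Y v z ->
  x != v -> x != z -> common_selected w v z x -> triangle Y x v z.
Proof.
move=> /andP[vz vzY] xv xz /forall_inP wc.
have w1 : w [set v; z; x]%SET by apply: wc; rewrite !inE eqxx.
have w2 : w [set z; x]%SET by apply: wc; rewrite !inE eqxx ?orbT.
have w3 : w [set v; x]%SET by apply: wc; rewrite !inE eqxx ?orbT.
have w4 : w [set x]%SET by apply: wc; rewrite !inE eqxx ?orbT.
have := vzY; rewrite edge_selected => /and3P[wv wz _].
rewrite /triangle xv xz vz/= -finset.setUA finset.setUC triangle_selected vzY w1 w2 !andbT/=.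
by rewrite edge_selected wv w4 w3.
Qed.

(** The deterministic core. As [c] is positive, two distinct vertices always have a common
    neighbour, which also gives nonemptiness and connectedness. *)
Theorem good_selection_property_T (c e : R) (j : nat) :
  (1 < n)%N -> 0 <= q -> 0 <= e -> 2 * e < c ->
  (forall u v, u != v -> c <= (common_count w u v)%:R) ->
  (forall u, link_trace pi (2 ^ j.+1) w u <= e ^+ (2 ^ j.+1)) ->
  realization R Y !=set0 /\ forall x : realization R Y, property_T R (pi1 R x).
Proof.
move=> n_gt1 q0 e0 ec common tr_e.
have subY := selected_complex_sub r w.
have c0 : 0 < c by apply: le_lt_trans ec; rewrite mulr_ge0.
have mid u v : u != v -> exists2 x, w [set x]%SET & w [set u; x]%SET /\ w [set v; x]%SET.
  move=> uv; have : (0 < common_count w u v)%N.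
    by rewrite -(ltr0n R); exact: lt_le_trans (common u v uv).
  case/card_gt0P => x; rewrite inE => /and3P[_ _ /forall_inP wc].
  exists x; first by apply: wc; rewrite !inE eqxx ?orbT.
  by split; apply: wc; rewrite !inE eqxx ?orbT.
split.
  have [x wx _] := mid (Ordinal (ltnW n_gt1)) (Ordinal n_gt1) isT.
  exists (delta_mx ord0 x).
  by apply: (face_hull_realization subY (s := [set x]%SET)); [rewrite vertex_selected|exact: delta_face_hull].
move=> x0; apply: (@property_T_of_links _ _ _ subY _ c e q) => //.
- move=> u v uY vY; have [<-|uv] := eqVneq u v.
    by exists u; rewrite finset.setUid.
  have [x wx [ux vx]] := mid u v uv; exists x.
  rewrite (finset.setUC [set x]) !edge_selected wx ux vx.
  by move: uY vY; rewrite !vertex_selected => -> ->.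
- move=> v z vz; have /andP[v_neq_z _] := vz.
  apply: le_trans (common v z v_neq_z) _.
  rewrite /common_count -sum1_card natr_sum big_mkcond; apply: ler_sum => x _.
  rewrite inE; case: ifP => // /and3P[xv xz wc].
  by rewrite (common_triangle vz xv xz wc).
- by move=> H u x; exact: links_quadratic_form (tr_e u).
Qed.

End GoodSelection.

(** The left side is at most [exp (- D / 8)]. A polynomial bound, of the same order [D ^ - l] as the
    one from the trace, is extracted from [exp y >= y] at [y = D / (8 l)]. *)
Lemma lower_tail_bound (R : realType) (n l : nat) (D rho : R) :
  (4 <= n)%N -> (0 < l)%N -> 0 <= rho <= 1 -> 0 < D -> D = n%:R * rho ->
  expR (D / 8) * (1 - 2^-1 * rho) ^+ n.-2 <= (8 * l%:R) ^+ l / D ^+ l.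
Proof.
move=> n_ge4 l_gt0 /andP[rho0 rho1] D_gt0 Drho.
have n2 : n.-2%:R = n%:R - 2 :> R.
  by rewrite -natrB ?(leq_trans _ n_ge4)//; congr _%:R; case: (n) n_ge4 => [|[|?]]//= _; rewrite subn2.
have n4 : 4 <= n%:R :> R by rewrite ler_nat.
(* Here [n >= 4] enters, through [n - 2 >= n / 2]. *)
have h1 : (1 - 2^-1 * rho) ^+ n.-2 <= expR (- (D / 4)).
  apply: (@le_trans _ _ (expR (- (2^-1 * rho)) ^+ n.-2)).
    rewrite lerXn2r ?nnegrE ?expR_ge0//; first by lra.
    exact: expR_ge1Dx.
  by rewrite -expRM_natr ler_expR n2 Drho; nra.
apply: le_trans (ler_wpM2l (expR_ge0 _) h1) _.
have -> : expR (D / 8) * expR (- (D / 4)) = (expR (D / 8))^-1.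
  by rewrite -expRD -expRN; congr expR; lra.
have l0 : 0 < l%:R :> R by rewrite ltr0n.
have -> : (8 * l%:R) ^+ l / D ^+ l = ((D / (8 * l%:R)) ^+ l)^-1.
  by rewrite expr_div_n invf_div.
rewrite lef_pV2 ?posrE ?expR_gt0 ?exprn_gt0 ?divr_gt0 ?mulr_gt0//.
have -> : D / 8 = D / (8 * l%:R) * l%:R by field; rewrite gt_eqF.
rewrite expRM_natr lerXn2r ?nnegrE ?expR_ge0 ?divr_ge0 ?mulr_ge0 ?(ltW D_gt0)//.
by apply: le_trans (expR_ge1Dx _); rewrite lerDr.
Qed.

(** * The failure probability for a fixed number of vertices *)

Section ProbabilityBound.
Context {R : realType} {r n : nat} (p : 'I_r.+1 -> R) (j : nat).
Hypothesis p01 : forall i, 0 <= p i <= 1.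
Hypothesis r_ge2 : (2 <= r)%N.
Hypothesis n_ge4 : (4 <= n)%N.
Implicit Types (w : {ffun {set 'I_n} -> bool}) (u v : 'I_n).

Let pi i := p (inord i).
Let l := (2 ^ j)%N.
Let D : R := n%:R * (pi 0 * pi 1) * (pi 1 * pi 2).
Hypothesis D_ge1 : 1 <= D.

Let pi01 i : 0 <= pi i <= 1. Proof. exact: p01. Qed.

Let D_gt0 : 0 < D. Proof. exact: lt_le_trans D_ge1. Qed.

Let common_weight w u v : R :=
  \prod_(x in ([set~ u] :\ v)%SET) (1 - 2^-1 * \prod_(s in common_block u v x) (w s)%:R).

(** The trace of an even power of a symmetric matrix is a sum of squares. *)
Lemma link_trace_ge0 k w u : 0 <= link_trace pi (2 * k) w u.
Proof.
apply: sumr_ge0 => v _; rewrite mul2n -addnn kernel_powD; apply: sumr_ge0 => x _.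
rewrite (kernel_pow_sym _ k x v) -?expr2 ?sqr_ge0// => a b.
exact: link_matrix_sym.
Qed.

Let common_weightE w u v : common_weight w u v = 2^-1 ^+ common_count w u v.
Proof.
rewrite /common_weight /common_count -prodr_const.
rewrite big_mkcond [RHS]big_mkcond; apply: eq_bigr => x _.
rewrite !inE andbC; case: (x != u) => //=; case: (x != v) => //=.
rewrite /common_selected; case: ifP => [/forall_inP wc|/negbT].
  by rewrite big1 => [|s /wc ->//]; lra.
rewrite negb_forall => /existsP[s]; rewrite negb_imply => /andP[sc /negbTE ws].
by rewrite (bigD1 s)//= ws mul0r mulr0 subr0.
Qed.

(** As [1 / 2 >= exp (- 1)], a count below [D / 8] has weight at least [exp (- D / 8)]. *)
Let common_weight_large w u v :
  (common_count w u v)%:R < D / 8 -> 1 <= expR (D / 8) * common_weight w u v.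
Proof.
move=> small; rewrite common_weightE.
have half : expR (-1) <= 2^-1 :> R.
  rewrite expRN lef_pV2 ?posrE ?expR_gt0//.
  by apply: le_trans (expR_ge1Dx 1).
have h2 : expR (- (common_count w u v)%:R) <= 2^-1 ^+ common_count w u v :> R.
  rewrite -mulN1r expRM_natr lerXn2r ?nnegrE ?expR_ge0//.
apply: le_trans (ler_wpM2l (expR_ge0 _) h2).
rewrite -expRD; apply: le_trans (expR_ge1Dx _); rewrite lerDl subr_ge0.
exact: ltW.
Qed.

Let l_gt0 : (0 < l)%N. Proof. by rewrite expn_gt0. Qed.

Let expect_common_weight u v : u != v ->
  expect (simplex_prob p) (fun w => expR (D / 8) * common_weight w u v) <=
  (8 * l%:R) ^+ l / D ^+ l.
Proof.
move=> uv; rewrite expectZ (expect_common pi uv).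
apply: lower_tail_bound => //; last by rewrite /D; ring.
have /andP[? ?] := pi01 0; have /andP[? ?] := pi01 1; have /andP[? ?] := pi01 2.
by rewrite !mulr_ge0 ?mulr_ile1 ?mulr_ge0.
Qed.

(** The first summand covers the triangle counts of at most [n ^ 2] pairs, the second the traces of
    [n] links, where 32 comes from the threshold [D / 32]. *)
Definition failure_constant : R :=
  (8 * l%:R) ^+ l + l.+2%:R ^+ (2 * l).+2 * 32 ^+ (2 * l).

Lemma complex_prob_property_T :
  1 - failure_constant * (n%:R ^+ 2 / D ^+ l) <=
  complex_prob p (fun Y : {set {set 'I_n}} => realization R Y !=set0 /\
       forall x : realization R Y, property_T R (pi1 R x)).
Proof.
set Q := (X in complex_prob p X).
have P01 s : 0 <= simplex_prob p s <= 1 by exact: p01.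
(* Union bound and Markov's inequality in one: every condition contributes a nonnegative penalty, at
   least 1 when it fails, so [F w < 1] guarantees all of them. *)
pose F w := \sum_u \sum_(v | u != v) expR (D / 8) * common_weight w u v +
  \sum_u (D / 32) ^- (2 * l) * link_trace pi (2 * l) w u.
have D32 : 0 < D / 32 by rewrite divr_gt0.
have cw0 w u v : 0 <= expR (D / 8) * common_weight w u v.
  by rewrite common_weightE mulr_ge0 ?expR_ge0// exprn_ge0// invr_ge0.
have tr0 w u : 0 <= (D / 32) ^- (2 * l) * link_trace pi (2 * l) w u.
  by rewrite mulr_ge0 ?link_trace_ge0// invr_ge0 exprn_ge0// ltW.
have s1 w : 0 <= \sum_u \sum_(v | u != v) expR (D / 8) * common_weight w u v.
  by do 2![apply: sumr_ge0 => ? _].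
have s2 w : 0 <= \sum_u (D / 32) ^- (2 * l) * link_trace pi (2 * l) w u.
  by apply: sumr_ge0.
have F0 w : 0 <= F w by rewrite addr_ge0.
have F_good w : F w < 1 -> Q (selected_complex r w).
  move=> F1.
  have /andP[? _] := pi01 1; have /andP[? _] := pi01 2.
  apply: (@good_selection_property_T _ _ _ pi w r_ge2 (D / 8) (D / 32) j).
  - exact: leq_trans n_ge4.
  - exact: mulr_ge0.
  - exact: ltW.
  - by have := D_gt0; lra.
  - move=> u v uv; rewrite leNgt; apply/negP => /common_weight_large.
    apply/negP; rewrite -ltNge; apply: le_lt_trans F1.
    apply: (@le_trans _ _ (\sum_u \sum_(v | u != v) expR (D / 8) * common_weight w u v)).
      rewrite [leRHS](bigD1 u)//= (bigD1 v)//= -addrA lerDl addr_ge0//.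
        by apply: sumr_ge0.
      by do 2![apply: sumr_ge0 => ? _].
    by rewrite /F lerDl.
  - move=> u; rewrite expnS -/l.
    have : (D / 32) ^- (2 * l) * link_trace pi (2 * l) w u <= 1.
      apply: le_trans (ltW F1); apply: (@le_trans _ _
        (\sum_u (D / 32) ^- (2 * l) * link_trace pi (2 * l) w u)).
        by rewrite [leRHS](bigD1 u)//= lerDl; apply: sumr_ge0.
      by rewrite /F lerDr.
    by rewrite mulrC ler_pdivrMr ?exprn_gt0// mul1r.
have EF : expect (simplex_prob p) F <= failure_constant * (n%:R ^+ 2 / D ^+ l).
  rewrite /F expectD !expect_sum.
  have -> : failure_constant * (n%:R ^+ 2 / D ^+ l) =
      n%:R * (n%:R * ((8 * l%:R) ^+ l / D ^+ l)) +
      n%:R * ((D / 32) ^- (2 * l) * (l.+2%:R ^+ (2 * l).+2 * (n%:R * D ^+ l))).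
    rewrite /failure_constant expr_div_n invf_div.
    have -> : D ^+ (2 * l) = D ^+ l * D ^+ l by rewrite mul2n -addnn exprD.
    by field; rewrite gt_eqF// exprn_gt0.
  have cst (a : R) : n%:R * a = \sum_(u < n) a by rewrite sumr_const card_ord mulr_natl.
  apply: lerD.
    rewrite [leRHS]cst; apply: ler_sum => u _.
    rewrite expect_sum [leRHS]cst big_mkcond.
    apply: ler_sum => v _; case: ifP => [uv|_]; first exact: expect_common_weight.
    by apply: divr_ge0; apply: exprn_ge0; [exact: mulr_ge0|exact: ltW].
  rewrite [leRHS]cst; apply: ler_sum => u _.
  rewrite expectZ ler_wpM2l ?invr_ge0 ?exprn_ge0 ?(ltW D32)//.
  exact: expect_link_trace.
have total : \sum_w selection_weight (@simplex_prob R r n p) w = 1.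
  transitivity (expect (@simplex_prob R r n p) (fun=> 1)); last exact: expect_cst.
  apply: eq_bigr => w _.
  by rewrite mulr1.
rewrite complex_probE lerBlDr -[leLHS]total (bigID (fun w => `[< Q (selected_complex r w) >]))/=.
rewrite lerD2l; apply: le_trans EF; apply: expect_ge1 => // w.
apply: contraR; rewrite -ltNge => F1.
by apply/asboolP; exact: F_good.
Qed.

End ProbabilityBound.

Lemma complex_prob_le1 (R : realType) (r n : nat) (p : 'I_r.+1 -> R)
    (Q : {set {set 'I_n}} -> Prop) :
  (forall i, 0 <= p i <= 1) -> complex_prob p Q <= 1.
Proof.
move=> p01; rewrite complex_probE -[leRHS](expect_cst (@simplex_prob R r n p) 1).
rewrite big_mkcond; apply: ler_sum => w _; rewrite mulr1; case: ifP => // _.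
by apply: selection_weight_ge0 => s; exact: p01.
Qed.

(** * The exponent of the mean degree *)

Section Exponents.
Context {R : realType} {r : nat}.
Implicit Types (a : 'rV[R]_r.+1).

Lemma psi2E a : (2 <= r)%N ->
  psi 2 a = a ord0 (inord 0) + 2 * a ord0 (inord 1) + a ord0 (inord 2).
Proof.
move=> r2; have r1 := ltnW r2.
have neq i k : (i <= r)%N -> (k <= r)%N -> i != k -> (inord i : 'I_r.+1) != inord k.
  by move=> ir kr ik; rewrite -val_eqE/= !inordK.
rewrite /psi (bigD1 (inord 0))//= (bigD1 (inord 1))/=; last exact: neq.
rewrite (bigD1 (inord 2))/=; last by rewrite !neq.
rewrite !inordK//= big1 ?addr0 => [|i /andP[/andP[i0 i1] i2]].
  by rewrite bin0 bin1 binn !mul1r addrA.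
rewrite bin_small ?mul0r//; move: i0 i1 i2.
by rewrite -!val_eqE/= !inordK//; case: (val i) => [|[|[|]]].
Qed.

Lemma psi_le a (i k : nat) : (forall j, 0 <= a ord0 j) -> (i <= k)%N -> psi i a <= psi k a.
Proof.
move=> a0 ik; apply: ler_sum => j _; rewrite ler_wpM2r// ler_nat.
exact: leq_bin2l.
Qed.

Lemma psi2_cvg (alpha : nat -> 'rV[R]_r.+1) a : (2 <= r)%N ->
  alpha n @[n --> \oo] --> a -> psi 2 (alpha n) @[n --> \oo] --> psi 2 a.
Proof.
move=> r2 cvg_a; rewrite psi2E//; under eq_fun do rewrite psi2E//.
have coord i : alpha n ord0 i @[n --> \oo] --> a ord0 i.
  exact: (cvg_comp _ _ cvg_a (@coord_continuous _ _ _ ord0 i a)).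
by apply: cvgD => //; apply: cvgD => //; apply: cvgMr.
Qed.

Lemma powR_psi2 (n : nat) a : (2 <= r)%N -> (0 < n)%N ->
  let p i := n%:R `^ (- a ord0 (inord i)) in
  n%:R * (p 0 * p 1) * (p 1 * p 2) = n%:R `^ (1 - psi 2 a).
Proof.
move=> r2 n0 p; rewrite psi2E// /p.
have n_neq0 : n%:R != 0 :> R by rewrite pnatr_eq0 -lt0n.
rewrite -[X in X * _ * _]powRr1// -!powRD ?n_neq0 ?implybT//.
by congr (_ `^ _); ring.
Qed.

End Exponents.

Theorem theorem17 (R : realType) (r k : nat)
    (alpha : nat -> 'rV[R]_r.+1) (alphastar : 'rV[R]_r.+1)
    (k_ge2 : (2 <= k)%N)
    (alpha_ge0 : forall n i, 0 <= alpha n ord0 i)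
    (alpha_cvg : alpha n @[n --> \oo] --> alphastar)
    (alphastarD : domain r k alphastar) :
  complex_prob (fun i : 'I_r.+1 => n%:R `^ (- alpha n ord0 i))
    (fun Y : {set {set 'I_n}} => realization R Y !=set0 /\
       forall x : realization R Y, property_T R (pi1 R x))
    @[n --> \oo] --> (1 : R).
Proof.
have [star_ge0 kr psik_lt1 _] := alphastarD.
have r2 : (2 <= r)%N := leq_trans k_ge2 kr.
(* For nonnegative exponents [psi] increases with its index, so every [k >= 2] reduces to the index
   2. *)
have psi2_lt1 : psi 2 alphastar < 1 := le_lt_trans (psi_le star_ge0 k_ge2) psik_lt1.
(* Half of the gap: by convergence [psi 2 (alpha n)] eventually stays below [1 - delta], so
   [D >= n ^ delta]. *)
pose delta := (1 - psi 2 alphastar) / 2.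
have delta_gt0 : 0 < delta by rewrite divr_gt0// subr_gt0.
have psi2_delta : \forall n \near \oo, psi 2 (alpha n) < 1 - delta.
  apply: (cvgr_lt _ (psi2_cvg r2 alpha_cvg)); rewrite /delta; lra.
(* Since [2 ^ j > j >= 3 / delta], the power [D ^ (2 ^ j)] is at least [n ^ 3], which beats the
   factor [n ^ 2] of the union bound. *)
pose j := Num.bound (3 / delta).
have jP : 3 <= delta * (2 ^ j)%:R.
  rewrite mulrC -ler_pdivrMr//; apply: le_trans (ltW (archi_boundP _)) _.
    by rewrite divr_ge0// ltW.
  by rewrite ler_nat ltnW// ltn_expl.
pose K := @failure_constant R j.
have p01 n i : (0 < n)%N -> 0 <= n%:R `^ (- alpha n ord0 i) <= 1.
  move=> n0; rewrite powR_ge0/= -[leRHS](powRr0 n%:R).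
  by apply: ler_powR; rewrite ?ler1n// oppr_le0.
(* [harmonic n] is [1 / (n + 1)]; the factor 2 absorbs [1 / n <= 2 / (n + 1)]. *)
apply: (@squeeze_cvgr _ _ _ _ (fun n => 1 - 2 * K * harmonic n) (fun=> 1)); last 2 first.
- rewrite -[X in _ --> X]subr0; apply: cvgB; first exact: cvg_cst.
  by rewrite -[X in _ --> X](mulr0 (2 * K)); apply: cvgMr; exact: cvg_harmonic.
- exact: cvg_cst.
near=> n.
have n4 : (4 <= n)%N by near: n; exact: nbhs_infty_ge.
have n0 : (0 < n)%N := leq_trans (isT : (0 < 4)%N) n4.
have n1 : 1 <= n%:R :> R by rewrite ler1n.
have n_gt0 : 0 < n%:R :> R by rewrite ltr0n.
rewrite complex_prob_le1 ?andbT; last by move=> i; exact: p01.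
pose p (i : 'I_r.+1) := n%:R `^ (- alpha n ord0 i).
have DE := powR_psi2 (alpha n) r2 n0.
have psi_n : psi 2 (alpha n) < 1 - delta by near: n.
have D_delta : n%:R `^ delta <= n%:R `^ (1 - psi 2 (alpha n)).
  by apply: ler_powR => //; lra.
have D_ge1 : 1 <= n%:R `^ (1 - psi 2 (alpha n)).
  by apply: le_trans D_delta; rewrite -[leLHS](powRr0 n%:R) ler_powR// ltW.
have := @complex_prob_property_T R r n p j (fun i => p01 n i n0) r2 n4.
rewrite /= DE => /(_ D_ge1); apply: le_trans.
rewrite lerD2l lerN2 -/K.
have K_ge0 : 0 <= K by rewrite /K /failure_constant addr_ge0// ?mulr_ge0 ?exprn_ge0 ?mulr_ge0.
have -> : 2 * K * harmonic n = K * (2 * harmonic n) by ring.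
rewrite ler_wpM2l//.
have D_n3 : n%:R ^+ 3 <= (n%:R `^ (1 - psi 2 (alpha n))) ^+ (2 ^ j).
  apply: (@le_trans _ _ ((n%:R `^ delta) ^+ (2 ^ j))); last first.
    by rewrite lerXn2r ?nnegrE ?powR_ge0.
  by rewrite -!powR_mulrn ?powR_ge0// -powRrM ler_powR.
have D_gt0 : 0 < (n%:R `^ (1 - psi 2 (alpha n))) ^+ (2 ^ j).
  by apply: lt_le_trans D_n3; rewrite exprn_gt0.
rewrite ler_pdivrMr// /harmonic/=.
apply: (@le_trans _ _ (2 / n.+1%:R * n%:R ^+ 3)); last by rewrite ler_wpM2l.
have m0 : 0 < n.+1%:R :> R by rewrite ltr0n.
rewrite mulrAC ler_pdivlMr//.
have -> : 2 * n%:R ^+ 3 = n%:R ^+ 2 * (2 * n%:R) :> R by ring.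
rewrite ler_wpM2l ?exprn_ge0//.
by rewrite -natrM ler_nat mul2n -addnn -addn1 leq_add2l.
Unshelve. all: by end_near.
Qed.
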